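(* Let $X_1(t),X_2(t)$, $t\ge 0$, be two independent Goldstein-Kac telegraph processes on $\mathbb{R}$ with arbitrary speeds $c_1,c_2>0$, arbitrary Poisson rates $\lambda_1,\lambda_2>0$ and arbitrary starting points $x_1^0,x_2^0\in\mathbb{R}$. Let $S^{\pm}(t)=X_1(t)\pm X_2(t)$. Then the transition probability densities $p^{\pm}(x,t)$ of the processes $S^{\pm}(t)$ are the solutions of the initial-value problems $$\begin{aligned} &\biggl\{\left(\frac{\partial}{\partial t}+(\lambda_1+\lambda_2)\right)^2\left[\frac{\partial^2}{\partial t^2}+2(\lambda_1+\lambda_2)\frac{\partial}{\partial t}-2(c_1^2+c_2^2)\frac{\partial^2}{\partial x^2}-(\lambda_1-\lambda_2)^2\right]\\ &\qquad\qquad+\left[(c_1^2-c_2^2)\frac{\partial^2}{\partial x^2}+(\lambda_1^2-\lambda_2^2)\right]^2\biggr\}p^{\pm}(x,t)=0, \end{aligned}$$ $$\begin{aligned} p^{\pm}(x,t)\big|_{t=0}&=\delta\bigl(x-(x_1^0\pm x_2^0)\bigr),\qquad \frac{\partial p^{\pm}(x,t)}{\partial t}\Big|_{t=0}=0,\\ \frac{\partial^2p^{\pm}(x,t)}{\partial t^2}\Big|_{t=0}&=(c_1^2+c_2^2)\,\delta''\bigl(x-(x_1^0\pm x_2^0)\bigr),\\ \frac{\partial^3p^{\pm}(x,t)}{\partial t^3}\Big|_{t=0}&=-2(\lambda_1c_1^2+\lambda_2c_2^2)\,\delta''\bigl(x-(x_1^0\pm x_2^0)\bigr), \end{aligned}$$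 where $\delta''(x)$ is the second generalized derivative of the Dirac delta-function $\delta(x)$. Moreover, the displayed fourth-order equation is hyperbolic, and for arbitrary $t>0$ the solutions $p^{\pm}(x,t)$ of these initial-value problems exist and are unique in the class of generalized functions $\mathscr{S}'$.
   Context: Telegraph process: given $c>0$, $\lambda>0$, $x^0\in\mathbb{R}$, the Goldstein-Kac telegraph process with speed $c$, rate $\lambda$ and starting point $x^0$ is the position $X(t)$ of a particle that starts from $x^0$ at time $0$, picks an initial direction $D(0)\in\{-1,+1\}$ with probabilities $1/2$ each, moves with constant speed $c$, and instantaneously reverses direction at every event of a homogeneous Poisson process $N(t)$ of rate $\lambda$ independent of $D(0)$. Thus $X(t)=x^0+c\int_0^t D(0)(-1)^{N(s)}\,ds$. Independence of $X_1,X_2$ means that the initial directions and the governing Poisson processes are all mutually independent. $\mathscr{S}'$ is the space of tempered distributions on $\mathbb{R}$ (in the variable $x$). The transition density $p^{\pm}(\cdot,t)\in\mathscr{S}'$ is the density, as a generalized function, of the probability distribution of $S^{\pm}(t)$ (which has atoms). A solution of the initial-value problem is a family $t\mapsto p(\cdot,t)\in\mathscr{S}'$, $t\ge0$, which is four times continuously differentiable in $t$ in the weak (distributional) sense, i.e. $t\mapsto\langle p(\cdot,t),\varphi\rangle$ is $C^4$ on $[0,\infty)$ for every Schwartz function $\varphi$; it is required to satisfy the equation with $x$-derivatives in the sense of generalized functions, and to satisfy the initial conditions with $t$-derivatives at $t=0$ taken from the right. A scalar constant-coefficient operator $P(\partial_t,\partial_x)$ of order $m$ is hyperbolic (with respect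 to $t$) in the usual sense (Gårding) if the coefficient of $\partial_t^m$ is non-zero and there is a constant $M$ such that, for every $\xi\in\mathbb{R}$, all complex roots $\tau$ of $P(\tau,i\xi)=0$ satisfy $|\operatorname{Re}\tau|\le M$. *)

(* Defs.v *)
From mathcomp Require Export all_boot all_order all_algebra.
From mathcomp Require Export polyXY complex.
From mathcomp Require Export all_classical all_reals all_analysis.
From mathcomp Require Export measurable_realfun.

Set Implicit Arguments.
Unset Strict Implicit.
Unset Printing Implicit Defensive.

Export Order.TTheory GRing.Theory Num.Theory.
Export numFieldNormedType.Exports.

Local Open Scope classical_set_scope.
Local Open Scope ring_scope.

Section Probability.
Context d (Omega : measurableType d) (R : realType) (P : probability Omega R).

Definition mutually_independent (I : finType) (F : I -> set (set Omega)) :=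
  forall (J : {set I}) (A : I -> set Omega),
    (forall i, i \in J -> F i (A i)) ->
    P (\bigcap_(i in [set` J]) A i) = (\prod_(i in J) fine (P (A i)))%:E.

Definition sigma_rv d' (T : measurableType d') (Y : Omega -> T) :
  set (set Omega) := preimage_set_system setT Y measurable.

Definition sigma_process d' (T : measurableType d') (Y : R -> Omega -> T) :
  set (set Omega) := <<s \bigcup_(t in `[0, +oo[) sigma_rv (Y t) >>.

(* [poisson_pmf] is applied only for s < t: the library sets
   [poisson_pmf 0 k = 1] for every [k].  The process is indexed by R, but only
   its values at nonnegative times matter. *)
Record poisson_process (l : R) (N : R -> {RV P >-> nat}) : Prop :=
  PoissonProcess {
  poisson_start : forall w, N 0 w = 0%N ;
  poisson_nondecreasing : forall w s t, 0 <= s -> s <= t ->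
    (N s w <= N t w)%N ;
  poisson_right_continuous : forall w t, 0 <= t ->
    \forall s \near t^'+, N s w = N t w ;
  poisson_increment_law : forall s t k, 0 <= s -> s < t ->
    P [set w | (N t w - N s w)%N = k] = (poisson_pmf (l * (t - s)) k)%:E ;
  poisson_independent_increments : forall (n : nat) (t : nat -> R),
    0 <= t 0%N -> {homo t : i j / (i <= j)%N >-> i <= j} ->
    mutually_independent
      (fun i : 'I_n => sigma_rv (fun w => (N (t i.+1) w - N (t i) w)%N)) }.

Record telegraph_process (c l x0 : R) (D : {RV P >-> R})
    (N : R -> {RV P >-> nat}) (X : R -> {RV P >-> R}) : Prop :=
  TelegraphProcess {
  telegraph_direction : forall w, D w = 1 \/ D w = - 1 ;
  telegraph_right : P [set w | D w = 1] = (2^-1)%:E ;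
  telegraph_left : P [set w | D w = - 1] = (2^-1)%:E ;
  telegraph_poisson : poisson_process l N ;
  telegraph_independent : mutually_independent
    (fun i : 'I_2 => nth set0 [:: sigma_rv D; sigma_process N] i) ;
  telegraph_position : forall t w, 0 <= t ->
    X t w = x0 + c * \int[lebesgue_measure]_(s in `[0, t])
                       (D w * (- 1) ^+ (N s w)) }.

End Probability.

Section Distributions.
Context {R : realType}.
Implicit Types (phi f : R -> R[i]).

Definition cderive phi : R -> R[i] :=
  fun x => Complex (derive1 (@complex.Re R \o phi) x)
                   (derive1 (@complex.Im R \o phi) x).

Definition csmooth phi := forall k x,
  derivable (@complex.Re R \o iter k cderive phi) x 1 /\
  derivable (@complex.Im R \o iter k cderive phi) x 1.

Definition schwartz phi := csmooth phi /\
  forall j k, exists M : R, forall x,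
    `|x| ^+ j * Normc.normc (iter k cderive phi x) <= M.

Definition schwartz_seminorm (j k : nat) phi : R :=
  sup (range (fun x => `|x| ^+ j * Normc.normc (iter k cderive phi x))).

(* Functionals are total on R -> R[i], but only their values on Schwartz
   functions are meaningful; [eqd] is equality of distributions. *)
Definition functional := (R -> R[i]) -> R[i].

Definition eqd (T U : functional) := forall phi, schwartz phi -> T phi = U phi.

Record tempered (T : functional) : Prop := Tempered {
  tempered_linear : forall (a : R[i]) phi psi, schwartz phi -> schwartz psi ->
    T (fun x => a * phi x + psi x) = a * T phi + T psi ;
  tempered_continuous : forall phi_ : nat -> R -> R[i],
    (forall n, schwartz (phi_ n)) ->
    (forall j k, schwartz_seminorm j k (phi_ n) @[n --> \oo] --> (0 : R)) ->
    Normc.normc (T (phi_ n)) @[n --> \oo] --> (0 : R) }.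

Definition delta (y : R) : functional := fun phi => phi y.

Definition zerod : functional := fun=> 0.

Definition scaled (a : R) (T : functional) : functional :=
  fun phi => real_complex R a * T phi.

Definition ddx (T : functional) : functional := fun phi => - T (cderive phi).

(* Derivatives on the half-line [0, +oo[: two-sided at t > 0, from the right
   at t = 0. *)
Definition hquotient (g : R -> R) (t s : R) : R := (g s - g t) / (s - t).

Definition hderivable (g : R -> R) (t : R) :=
  cvg (hquotient g t s @[s --> within `[0, +oo[ t^']).

Definition hderive (g : R -> R) (t : R) : R :=
  lim (hquotient g t s @[s --> within `[0, +oo[ t^']).

Definition chderive f : R -> R[i] :=
  fun t => Complex (hderive (@complex.Re R \o f) t) (hderive (@complex.Im R \o f) t).

Definition half_line_C (n : nat) f :=
  (forall k t, (k < n)%N -> 0 <= t ->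
     hderivable (@complex.Re R \o iter k chderive f) t /\
     hderivable (@complex.Im R \o iter k chderive f) t) /\
  {within `[0, +oo[, continuous (@complex.Re R \o iter n chderive f)} /\
  {within `[0, +oo[, continuous (@complex.Im R \o iter n chderive f)}.

Definition weakly_C (n : nat) (p : R -> functional) :=
  forall phi, schwartz phi -> half_line_C n (fun t => p t phi).

Definition ddt (p : R -> functional) : R -> functional :=
  fun t phi => chderive (fun s => p s phi) t.

(* A constant-coefficient operator in d/dt and d/dx is a bivariate polynomial:
   the outer indeterminate stands for d/dt and the inner one for d/dx. *)
Definition apply_op (Q : {poly {poly R[i]}}) (p : R -> functional) :
    R -> functional :=
  fun t phi => \sum_(k < size Q) \sum_(j < size Q`_k)
    Q`_k`_j * iter k ddt (fun s => iter j ddx (p s)) t phi.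

(* Total degree in (d/dt, d/dx); the monomial d/dt^m then has a scalar
   coefficient, the constant term of the inner polynomial Q`_m. *)
Definition op_order (Q : {poly {poly R[i]}}) : nat :=
  \max_(k < size Q | Q`_k != 0) (k + (size (Q`_k)%R).-1)%N.

Definition hyperbolic (Q : {poly {poly R[i]}}) :=
  Q`_(op_order Q)`_0 != 0 /\
  exists M : R, forall (xi : R) (tau : R[i]),
    Q.[tau, Complex 0 xi] = 0 -> `|complex.Re tau| <= M.

Record ivp_solution (Q : {poly {poly R[i]}}) (g : seq functional)
    (p : R -> functional) : Prop := IvpSolution {
  ivp_tempered : forall t, 0 <= t -> tempered (p t) ;
  ivp_weakly_C : weakly_C (size g) p ;
  ivp_equation : forall t, 0 < t -> eqd (apply_op Q p t) zerod ;
  ivp_initial : forall k, (k < size g)%N ->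
    eqd (iter k ddt p 0) (nth zerod g k) }.

Definition unique_ivp_solution (Q : {poly {poly R[i]}}) (g : seq functional)
    (p : R -> functional) :=
  ivp_solution Q g p /\
  forall q, ivp_solution Q g q -> forall t, 0 <= t -> eqd (q t) (p t).

Definition op_const (a : R) : {poly {poly R[i]}} := ((real_complex R a)%:P)%:P.

Definition telegraph_sum_op (c1 c2 l1 l2 : R) : {poly {poly R[i]}} :=
  let dt : {poly {poly R[i]}} := 'X in
  let dx : {poly {poly R[i]}} := ('X)%:P in
  (dt + op_const (l1 + l2)) ^+ 2 *
    (dt ^+ 2 + op_const (2 * (l1 + l2)) * dt
     - op_const (2 * (c1 ^+ 2 + c2 ^+ 2)) * dx ^+ 2
     - op_const ((l1 - l2) ^+ 2))
  + (op_const (c1 ^+ 2 - c2 ^+ 2) * dx ^+ 2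
     + op_const (l1 ^+ 2 - l2 ^+ 2)) ^+ 2.

Definition telegraph_sum_data (c1 c2 l1 l2 y : R) : seq functional :=
  [:: delta y;
      zerod;
      scaled (c1 ^+ 2 + c2 ^+ 2) (iter 2 ddx (delta y));
      scaled (- (2 * (l1 * c1 ^+ 2 + l2 * c2 ^+ 2))) (iter 2 ddx (delta y))].

End Distributions.

(* The generalized density of a random variable is its law, tested against
   phi. *)
Definition density d (Omega : measurableType d) (R : realType)
    (P : probability Omega R) (Y : {mfun Omega >-> R}) : @functional R :=
  fun phi => Complex (\int[distribution P Y]_x complex.Re (phi x))
                     (\int[distribution P Y]_x complex.Im (phi x)).

(* Main.v *)
Require Import Defs.
From mathcomp Require Import ring lra.

(* Existence.  With unit velocities V1, V2 and S = X1 + X2, independence of the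
   Poisson increments gives a one-step estimate for E[V1^a V2^b phi(S(t))]: its
   time derivative is given by a first-order system with four components
   (a, b in {0, 1}).  Eliminating three of them yields the fourth-order
   equation for E[phi(S(t))], which is therefore C^oo in t, and the initial
   data are read off the system at t = 0.

   Uniqueness.  Let w be a solution with zero data.  By the uniform boundedness
   principle w and its time derivatives are bounded uniformly in t on [0, T]
   over bounded sets of test functions, hence they may be paired with the law
   of S.  A suitable bilinear pairing of w at time s with the dual solution
   E[D1 D2 V1^a V2^b phi(S)] at time T - s is constant in s; it vanishes at
   s = 0, and at s = T it is 2 c1 c2 (d_t + l1 + l2) <w(T), phi''>.  So
   <w, phi''> = 0 for every phi, and the equation reduces to an ordinary
   differential equation in t for <w, phi>.

   Hyperbolicity.  The roots are tau = -(l1 + l2) +- s1 +- s2 where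
   si^2 = li^2 - ci^2 xi^2 is real and at most li^2. *)

Set Implicit Arguments.
Unset Strict Implicit.
Unset Printing Implicit Defensive.

Local Open Scope classical_set_scope.
Local Open Scope ring_scope.

(** * Derivatives on the line and on the half-line *)

(** Distributions are tested on translates r(. + x), which turns them into smooth functions of x.
    Since |S(t)| is bounded by a constant growing linearly in t, only bounded x matter, and pairing
    w with the law of S means taking the expectation of such a function at S. The weight D1 D2 of
    the dual solution is chosen because the directions are centred and independent: at time 0 only
    the component a = b = 1 survives, and it enters the pairing with the factor c1 c2. This is where
    nonzero speeds are used. Derivatives are mostly obtained from estimates with error O(h^2) whose
    constant is uniform over a class of test functions. This replaces differentiation under the
    expectation, and it tolerates a test function that itself varies with time, as in the pairing.
    The difference X1 - X2 is the sum of X1 and - X2, a telegraph process with speed - c2; hence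
    before the final theorem speeds are assumed at most nonzero, never positive. *)

Section RealDerivatives.
Context {R : realType}.
Implicit Types (f g : R -> R) (x y t l C : R).

Lemma sqrnorm x : `|x| ^+ 2 = x ^+ 2.
Proof. by rewrite real_normK ?num_real. Qed.

Lemma is_derive_quadratic f x l C :
  (forall h, `|h| <= 1 -> `|f (x + h) - f x - h * l| <= C * h ^+ 2) ->
  is_derive x 1 f l.
Proof.
move=> H.
have C0 : 0 <= C.
  have := H 1; rewrite normr1 expr1n mulr1 => /(_ (lexx _)).
  exact: le_trans.
have cv : (fun h : R => h^-1 *: ((f \o shift x) (h *: (1 : R)) - f x)) @ 0^' --> l.
  apply/cvgrPdist_le => e e0; near=> h.
  have h0 : h != 0 by near: h; exact: nbhs_dnbhs_neq.
  have h1 : `|h| <= 1.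
    near: h; apply: dnbhs0_le; exact: ltr01.
  have h2 : `|h| <= e / (C + 1).
    near: h; apply: dnbhs0_le; by rewrite divr_gt0// ltr_wpDl.
  have -> : l - h^-1 *: ((f \o shift x) (h *: (1 : R)) - f x) =
            - (h^-1 * (f (x + h) - f x - h * l)).
    by rewrite /GRing.scale/= mulr1 [h + x]addrC; field.
  rewrite normrN normrM normfV.
  apply: (@le_trans _ _ (`|h|^-1 * (C * h ^+ 2))).
    by rewrite ler_wpM2l ?invr_ge0//; exact: H.
  rewrite -(sqrnorm h) mulrCA expr2 [_^-1 * _]mulrA mulVf ?normr_eq0// mul1r.
  apply: (@le_trans _ _ (C * (e / (C + 1)))); first by rewrite ler_wpM2l.
  by rewrite mulrCA ger_pMr// ler_pdivrMr; lra.
by apply: DeriveDef; [apply/cvg_ex; exists l | apply/cvg_lim].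
Unshelve. all: by end_near. Qed.

Lemma mvt_bound f df a b C : a <= b ->
  (forall x, x \in `]a, b[ -> is_derive x 1 f (df x)) ->
  {within `[a, b], continuous f} ->
  (forall x, x \in `]a, b[ -> `|df x| <= C) ->
  `|f b - f a| <= C * (b - a).
Proof.
rewrite le_eqVlt => /predU1P[-> _ _ _|ab fd fc dfC].
  by rewrite !subrr normr0 mulr0.
have [c cab ->] := MVT ab fd fc.
have ba : 0 <= b - a by rewrite subr_ge0 ltW.
by rewrite normrM (ger0_norm ba) ler_wpM2r// dfC.
Qed.

Lemma is_derive_continuous f (df : R -> R) :
  (forall x, is_derive x 1 f (df x)) -> continuous f.
Proof.
by move=> fd x; apply/differentiable_continuous/derivable1_diffP; case: (fd x).
Qed.

Lemma lipschitz_bound f df C x y : (forall z : R, is_derive z 1 f (df z)) ->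
  (forall z, `|z - x| <= `|y - x| -> `|df z| <= C) -> `|f y - f x| <= C * `|y - x|.
Proof.
move=> fd dfC; have fc a b : {within `[a, b], continuous f}.
  by apply: continuous_subspaceT; exact: is_derive_continuous fd.
have [xy|/ltW yx] := leP x y.
  rewrite (ger0_norm (x := y - x)) ?subr_ge0//.
  apply: (@mvt_bound f df) => // z; rewrite in_itv/= => /andP[xz zy].
  by apply: dfC; rewrite !ger0_norm; lra.
rewrite distrC [`|y - x|]distrC (ger0_norm (x := x - y)) ?subr_ge0//.
apply: (@mvt_bound f df) => // z; rewrite in_itv/= => /andP[yz zx].
by apply: dfC; rewrite !ler0_norm; lra.
Qed.

Lemma taylor1_bound f f1 f2 C x y : (forall z : R, is_derive z 1 f (f1 z)) ->
  (forall z : R, is_derive z 1 f1 (f2 z)) ->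
  (forall z, `|z - x| <= `|y - x| -> `|f2 z| <= C) ->
  `|f y - f x - (y - x) * f1 x| <= C * (y - x) ^+ 2.
Proof.
move=> fd f1d f2C.
have C0 : 0 <= C by apply: le_trans (f2C x _); rewrite // subrr normr0.
pose g : R -> R := f - (id - cst x) * cst (f1 x).
have gE z : g z = f z - (z - x) * f1 x by [].
have gd (z : R) : is_derive z (1 : R) g (f1 z - f1 x).
  have := fd z => ?.
  by apply: is_derive_eq; rewrite /GRing.scale/= /cst; ring.
suff : `|g y - g x| <= C * `|y - x| * `|y - x|.
  by rewrite !gE subrr mul0r subr0 -mulrA -expr2 sqrnorm [_ - _ - f x]addrAC.
apply: (lipschitz_bound gd) => z zx.
apply: (@le_trans _ _ (C * `|z - x|)); last by rewrite ler_wpM2l.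
apply: (lipschitz_bound f1d) => w wx; apply: f2C; exact: le_trans zx.
Qed.

(** The derivative on the half-line without a quotient: the point s = t needs no exclusion, and sums
    and bounds are handled by plain inequalities. [hderP] links it to [hquotient]. *)
Definition hder f t l := forall e, 0 < e -> exists2 d, 0 < d &
  forall s, 0 <= s -> `|s - t| < d -> `|f s - f t - l * (s - t)| <= e * `|s - t|.

Definition hcont f t := forall e, 0 < e -> exists2 d, 0 < d &
  forall s, 0 <= s -> `|s - t| < d -> `|f s - f t| <= e.

Lemma hderP f t l : hder f t l <->
  hquotient f t s @[s --> within `[0, +oo[ t^'] --> l.
Proof.
split=> [H|/cvgrPdist_le H].
  apply/cvgrPdist_le => e e0.
  have [d d0 dH] := H e e0.
  rewrite near_withinE.
  near=> s; rewrite /= in_itv/= andbT => s0.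
  have st : s != t by near: s; exact: nbhs_dnbhs_neq.
  have sd : `|s - t| < d.
    by rewrite distrC; near: s; apply: nbhs_dnbhs; exact: nbhsx_ballx.
  rewrite /hquotient.
  have st0 : s - t != 0 by rewrite subr_eq0.
  have -> : l - (f s - f t) / (s - t) = - ((f s - f t - l * (s - t)) / (s - t)).
    by field.
  rewrite normrN normrM normfV ler_pdivrMr ?normr_gt0//.
  exact: dH.
move=> e e0; have := H e e0.
rewrite near_withinE /dnbhs near_withinE.
move=> /nbhs_ballP[d d0 dH]; exists d => // s s0 sd.
have [->|st] := eqVneq s t.
  by rewrite !subrr mulr0 subrr normr0 mulr0.
have := dH s; rewrite /ball/= distrC => /(_ sd st).
rewrite in_itv/= andbT => /(_ s0).
have st0 : s - t != 0 by rewrite subr_eq0.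
rewrite /hquotient.
have -> : l - (f s - f t) / (s - t) = - ((f s - f t - l * (s - t)) / (s - t)).
  by field.
by rewrite normrN normrM normfV ler_pdivrMr ?normr_gt0.
Unshelve. all: by end_near. Qed.

Lemma hcontP f : {within `[0, +oo[, continuous f} <->
  (forall t, 0 <= t -> hcont f t).
Proof.
rewrite subspace_continuousP; split=> H t.
  move=> t0; have : `[0, +oo[%classic t by rewrite /= in_itv/= t0.
  move=> /(H t)/cvgrPdist_le {}H e e0.
  have := H e e0; rewrite near_withinE.
  move=> /nbhs_ballP[d d0 dH]; exists d => // s s0 sd.
  by rewrite distrC; apply: dH; [rewrite /ball/= distrC|rewrite /= in_itv/= s0].
rewrite /= in_itv/= andbT => t0; apply/cvgrPdist_le => e e0.
have [d d0 dH] := H t t0 e e0.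
rewrite near_withinE; near=> s; rewrite /= in_itv/= andbT => s0.
rewrite distrC; apply: dH => //; rewrite distrC; near: s; exact: nbhsx_ballx.
Unshelve. all: by end_near. Qed.

Lemma hder_scaleD f g t l m (a : R) : hder f t l -> hder g t m ->
  hder (fun s => a * f s + g s) t (a * l + m).
Proof.
move=> fl gm e e0.
have a0 : 0 < `|a| + 1 by rewrite ltr_wpDl.
have [|d d0 fd] := fl (e / (`|a| + 1) / 2); first by rewrite !divr_gt0.
have [|d' d'0 gd] := gm (e / 2); first by rewrite !divr_gt0.
exists (Num.min d d'); first by rewrite lt_min d0.
move=> s s0; rewrite lt_min => /andP[sd sd'].
have -> : a * f s + g s - (a * f t + g t) - (a * l + m) * (s - t) =
  a * (f s - f t - l * (s - t)) + (g s - g t - m * (s - t)) by ring.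
apply: (le_trans (ler_normD _ _)); rewrite normrM.
have {sd}fs := fd s s0 sd; have {sd'}gs := gd s s0 sd'.
have : `|a| * `|f s - f t - l * (s - t)| <= e / 2 * `|s - t|; last lra.
apply: (le_trans (ler_wpM2l _ fs)) => //.
rewrite mulrA ler_wpM2r//.
rewrite -[X in _ <= X](mulfVK (lt0r_neq0 a0)).
have : 0 <= e / (`|a| + 1) / 2 by rewrite !divr_ge0// ltW.
have -> : e / 2 / (`|a| + 1) = e / (`|a| + 1) / 2 by rewrite mulrAC.
nra.
Qed.

Lemma hder_cst (c : R) t : hder (fun=> c) t 0.
Proof. by move=> e e0; exists 1 => // s _ _; rewrite subrr mul0r subr0 normr0 mulr_ge0// ltW. Qed.

Lemma hder_ext f g t l : 0 <= t -> (forall s, 0 <= s -> f s = g s) ->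
  hder f t l -> hder g t l.
Proof.
move=> t0 fg fl e /fl[d d0 H]; exists d => // s s0 sd.
by rewrite -!fg//; exact: H.
Qed.

Lemma hderZ f t l (a : R) : hder f t l -> hder (fun s => a * f s) t (a * l).
Proof.
move=> /(@hder_scaleD _ _ _ _ _ a)/(_ (@hder_cst 0 t)).
by rewrite addr0; congr hder; apply/funext => s; rewrite addr0.
Qed.

Lemma hderD f g t l m : hder f t l -> hder g t m ->
  hder (fun s => f s + g s) t (l + m).
Proof.
move=> fl gm; have := hder_scaleD 1 fl gm; rewrite mul1r; congr hder.
by apply/funext => s; rewrite mul1r.
Qed.

Lemma hderB f g t l m : hder f t l -> hder g t m ->
  hder (fun s => f s - g s) t (l - m).
Proof.
move=> fl gm; have := hderD fl (hderZ (-1) gm); rewrite mulN1r; congr hder.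
by apply/funext => s; rewrite mulN1r.
Qed.

Lemma hder_quadratic f t l C : 0 <= C ->
  (forall s, 0 <= s -> s <= t + 1 -> `|f s - f t - l * (s - t)| <= C * (s - t) ^+ 2) ->
  hder f t l.
Proof.
move=> C0 H e e0; exists (Num.min 1 (e / (C + 1))).
  by rewrite lt_min ltr01/= divr_gt0// ltr_wpDl.
move=> s s0; rewrite lt_min => /andP[s1 s2].
apply: le_trans (H s s0 _) _.
  by have := ler_norm (s - t); lra.
rewrite -sqrnorm expr2 mulrA ler_wpM2r//.
apply: (@le_trans _ _ (C * (e / (C + 1)))); first by rewrite ler_wpM2l// ltW.
by rewrite mulrCA ger_pMr// ler_pdivrMr; lra.
Qed.

(** Points t + h with h > 0 stay in the half-line even when t = 0. With tolerance |l - m| / 3 for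
    each slope, the two errors cannot add up to |l - m| h. *)
Lemma hder_unique f t l m : 0 <= t -> hder f t l -> hder f t m -> l = m.
Proof.
move=> t0 fl fm; apply/eqP; rewrite -subr_eq0 -normr_eq0; apply/negP => /negP lm.
have e0 : 0 < `|l - m| / 3 by rewrite divr_gt0// normr_gt0 -normr_eq0.
have [d d0 fd] := fl _ e0; have [d' d'0 fd'] := fm _ e0.
pose h := Num.min d d' / 2.
have h0 : 0 < h by rewrite divr_gt0// lt_min d0.
have hd : h < d.
  by rewrite /h ltr_pdivrMr//; have := ge_min d d d'; rewrite lexx/=; lra.
have hd' : h < d'.
  by rewrite /h ltr_pdivrMr//; have := ge_min d' d d'; rewrite lexx orbT; lra.
have E : t + h - t = h by rewrite addrAC subrr add0r.
have th : 0 <= t + h by rewrite addr_ge0// ltW.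
have := fd (t + h) th; have := fd' (t + h) th.
rewrite E gtr0_norm// => /(_ hd') A /(_ hd) B.
have : `|(l - m) * h| <= 2 * (`|l - m| / 3 * h).
  have -> : (l - m) * h = (f (t + h) - f t - m * h) - (f (t + h) - f t - l * h).
    by ring.
  by apply: (le_trans (ler_normB _ _)); lra.
rewrite normrM (gtr0_norm h0).
have := mulr_gt0 e0 h0.
by lra.
Qed.

Lemma hder_hderivable f t l : 0 <= t -> hder f t l ->
  hderivable f t /\ hderive f t = l.
Proof.
move=> t0 fl; have cv := fl; move/hderP in cv.
have fd : hderivable f t by apply/cvg_ex; exists l.
split=> //; apply: (@hder_unique f t) => //.
exact/hderP.
Qed.

Lemma hderivable_hder f t : hderivable f t -> hder f t (hderive f t).
Proof. by move=> fd; exact/hderP. Qed.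

Lemma hder_is_derive f t l : 0 < t -> hder f t l -> is_derive t 1 f l.
Proof.
move=> t0 fl.
have cv : (fun h : R => h^-1 *: ((f \o shift t) (h *: (1 : R)) - f t)) @ 0^' --> l.
  apply/cvgrPdist_le => e e0; have [d d0 fd] := fl e e0; near=> h.
  have h0 : h != 0 by near: h; exact: nbhs_dnbhs_neq.
  have hd : `|h| < d by near: h; exact: dnbhs0_lt.
  have ht : `|h| < t by near: h; exact: dnbhs0_lt.
  have th : 0 <= t + h by have := ler_norm (- h); rewrite normrN; lra.
  have E : t + h - t = h by rewrite addrAC subrr add0r.
  have -> : l - h^-1 *: ((f \o shift t) (h *: (1 : R)) - f t) =
            - ((f (t + h) - f t - l * h) / h).
    by rewrite /GRing.scale/= mulr1 [h + t]addrC; field.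
  rewrite normrN normrM normfV ler_pdivrMr ?normr_gt0//.
  by have := fd _ th; rewrite E; apply.
by apply: DeriveDef; [apply/cvg_ex; exists l | apply/cvg_lim].
Unshelve. all: by end_near. Qed.

Lemma hder_hcont f t l : hder f t l -> hcont f t.
Proof.
move=> fl e e0; have [d d0 fd] := fl 1 ltr01.
have l0 : 0 < `|l| + 1 by rewrite ltr_wpDl.
exists (Num.min d (e / (`|l| + 1))); first by rewrite lt_min d0/= divr_gt0.
move=> s s0; rewrite lt_min => /andP[sd].
rewrite ltr_pdivlMr// => se; have := fd s s0 sd; rewrite mul1r => fs.
have -> : f s - f t = (f s - f t - l * (s - t)) + l * (s - t) by ring.
apply: (le_trans (ler_normD _ _)); rewrite normrM; nra.
Qed.

Lemma hcontZ f t (a : R) : hcont f t -> hcont (fun s => a * f s) t.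
Proof.
move=> fc e e0; have a0 : 0 < `|a| + 1 by rewrite ltr_wpDl.
have [|d d0 fd] := fc (e / (`|a| + 1)); first by rewrite divr_gt0.
exists d => // s s0 sd; rewrite -mulrBr normrM.
apply: (le_trans (ler_wpM2l (normr_ge0 a) (fd s s0 sd))).
by rewrite mulrCA ger_pMr// ler_pdivrMr; lra.
Qed.

Lemma hcontD f g t : hcont f t -> hcont g t -> hcont (fun s => f s + g s) t.
Proof.
move=> fc gc e e0; have e2 : 0 < e / 2 by rewrite divr_gt0.
have [d d0 fd] := fc _ e2; have [d' d'0 gd] := gc _ e2.
exists (Num.min d d'); first by rewrite lt_min d0.
move=> s s0; rewrite lt_min => /andP[sd sd'].
have := fd s s0 sd; have := gd s s0 sd' => A B.
have -> : f s + g s - (f t + g t) = (f s - f t) + (g s - g t) by ring.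
by apply: (le_trans (ler_normD _ _)); lra.
Qed.

Lemma hcontB f g t : hcont f t -> hcont g t -> hcont (fun s => f s - g s) t.
Proof.
move=> fc gc; have := hcontD fc (hcontZ (-1) gc); congr hcont.
by apply/funext => s; rewrite mulN1r.
Qed.

Lemma hcont0_eq0 f : hcont f 0 -> (forall t, 0 < t -> f t = 0) -> f 0 = 0.
Proof.
move=> fc f0; apply/eqP; rewrite -normr_eq0; apply/negP => /negP f00.
have e0 : 0 < `|f 0| / 2 by rewrite divr_gt0// lt_def f00 normr_ge0.
have [d d0 fd] := fc _ e0.
have d2 : 0 < d / 2 by rewrite divr_gt0.
have := fd (d / 2) (ltW d2); rewrite subr0 (gtr0_norm d2) f0// sub0r normrN.
have : d / 2 < d by lra.
by move=> -> /(_ isT); lra.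
Qed.

Lemma hcont_within f a b : 0 <= a -> (forall t, 0 <= t -> hcont f t) ->
  {within `[a, b], continuous f}.
Proof.
move=> a0 /hcontP; apply: continuous_subspaceW => x /=.
by rewrite !in_itv/= andbT => /andP[ax _]; apply: le_trans ax.
Qed.

Lemma hcont_bounded f b : (forall t, 0 <= t -> hcont f t) ->
  exists C, forall t, 0 <= t -> t <= b -> `|f t| <= C.
Proof.
move=> /(hcont_within (b := b) (lexx 0)) fc.
have /compact_bounded[M [_ MP]] := continuous_compact fc (segment_compact (a := 0) (b := b)).
exists (M + 1) => t t0 tb; apply: MP; first by rewrite ltrDl.
by exists t => //=; rewrite in_itv/= t0.
Qed.

Lemma hder_mvt f g a b C : 0 <= a -> a <= b ->
  (forall t, 0 <= t -> hcont f t) ->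
  (forall t, 0 < t -> hder f t (g t)) ->
  (forall t, a < t -> t < b -> `|g t| <= C) -> `|f b - f a| <= C * (b - a).
Proof.
move=> a0 ab fc fg gC; apply: (@mvt_bound f g) => //.
- move=> x; rewrite in_itv/= => /andP[ax _]; apply: hder_is_derive.
    exact: le_lt_trans ax.
  by apply: fg; exact: le_lt_trans ax.
- exact: hcont_within.
- by move=> x; rewrite in_itv/= => /andP[ax xb]; exact: gC.
Qed.

Lemma hder_mvt2 f g C b : (forall t, 0 <= t -> hder f t (g t)) ->
  (forall t, 0 <= t -> t <= b -> `|g t| <= C) ->
  forall s t, 0 <= s -> s <= b -> 0 <= t -> t <= b ->
  `|f t - f s| <= C * `|t - s|.
Proof.
move=> fg gC s t; wlog st : s t / s <= t => [H|].
  move=> s0 sb t0 tb; have [st|/ltW ts] := leP s t; first exact: H.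
  by rewrite distrC [`|t - s|]distrC; apply: H.
move=> s0 sb t0 tb; rewrite (ger0_norm (x := t - s)) ?subr_ge0//.
apply: (@hder_mvt f g) => //.
- by move=> x x0; apply: hder_hcont (fg x x0).
- by move=> x x0; apply: fg; exact: ltW.
- move=> x sx xt; apply: gC; [apply: le_trans (ltW sx)|apply: le_trans (ltW xt) _] => //.
Qed.

Lemma hder0_cst f : (forall t, 0 <= t -> hder f t 0) ->
  forall t, 0 <= t -> f t = f 0.
Proof.
move=> f0 t t0; apply/eqP; rewrite -subr_eq0 -normr_le0.
have := @hder_mvt2 f (fun=> 0) 0 t f0 (fun _ _ _ => _) 0 t (lexx _) t0 t0 (lexx _).
by rewrite mul0r; apply; rewrite normr0.
Qed.

(** Quadratic increments force a zero derivative. This is how the dual pairing is shown to be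
    constant, with no product rule. *)
Lemma quadratic_cst f C b :
  (forall s t, 0 <= s -> s <= t -> t <= b -> `|f t - f s| <= C * (t - s) ^+ 2) ->
  0 <= b -> f b = f 0.
Proof.
move=> H b0; have C0 : 0 <= C \/ b = 0.
  have [->|b1] := eqVneq b 0; [by right|left].
  have := H 0 b (lexx _) b0 (lexx _); rewrite subr0 => /(le_trans (normr_ge0 _)).
  by rewrite pmulr_lge0// exprn_gt0// lt_def b1.
case: C0 => [C0|->//].
(* Freezing f beyond b carries the estimate to the whole half-line, as [hder0_cst] requires. *)
pose g t := f (Num.min t b).
have gd t : 0 <= t -> hder g t 0.
  move=> t0; apply: (@hder_quadratic _ _ _ C) => // s s0 _.
  rewrite mul0r subr0 /g.
  wlog : s t s0 t0 / t <= s => [W|ts].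
    have [ts|/ltW st] := leP t s; first exact: W.
    by rewrite distrC -[(s - t) ^+ 2]sqrnorm [`|s - t|]distrC sqrnorm; apply: W.
  apply: le_trans (H _ _ _ _ _) _.
  - by rewrite le_min t0.
  - by rewrite le_min !ge_min ts lexx !orbT.
  - by rewrite ge_min lexx orbT.
  - rewrite ler_wpM2l// ler_sqr ?nnegrE ?subr_ge0//; last first.
      by rewrite le_min !ge_min ts lexx !orbT.
    by have [] := leP s b; have [] := leP t b; lra.
by have := hder0_cst gd b0; rewrite /g !min_l.
Qed.

(** A sequence of difference quotients is what the uniform boundedness principle can be applied
    to. *)
Lemma hder_seq f t l : 0 <= t -> hder f t l ->
  (f (t + n.+1%:R^-1) - f t) * n.+1%:R @[n --> \oo] --> l.
Proof.
move=> t0 fl; apply/cvgrPdist_le => e e0; have [d d0 fd] := fl e e0; near=> n.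
have n0 : 0 < n.+1%:R :> R by [].
have E : t + n.+1%:R^-1 - t = n.+1%:R^-1 by rewrite addrAC subrr add0r.
have := fd (t + n.+1%:R^-1); rewrite E (gtr0_norm (x := n.+1%:R^-1)) ?invr_gt0//.
rewrite addr_ge0 ?invr_ge0// => /(_ isT).
have -> : n.+1%:R^-1 < d.
  near: n.
  have /cvgrPdist_lt/(_ d d0) := @cvg_harmonic R.
  apply: filterS => n; rewrite /harmonic sub0r normrN gtr0_norm// invr_gt0//.
move=> /(_ isT).
have -> : l - (f (t + n.+1%:R^-1) - f t) * n.+1%:R =
  - ((f (t + n.+1%:R^-1) - f t - l / n.+1%:R) * n.+1%:R).
  by field; rewrite addrC natr1 lt0r_neq0.
by rewrite normrN normrM (gtr0_norm n0) -ler_pdivlMr.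
Unshelve. all: by end_near. Qed.

(** Integrating factor: e^(k t) f(t) has zero derivative and starts at 0. *)
Lemma hder_exp_unique f (k : R) : (forall t, 0 <= t -> hder f t (- k * f t)) ->
  f 0 = 0 -> forall t, 0 <= t -> f t = 0.
Proof.
move=> fk f0 b b0.
have [->//|bn0] := eqVneq b 0.
have bp : 0 < b by rewrite lt_def bn0.
pose g : R -> R := (fun t => expR (k * t)) * f.
have ed (t : R) : is_derive t (1 : R) (fun t => expR (k * t)) (k * expR (k * t)).
  have -> : (fun t => expR (k * t)) = expR \o ( *%R k) by [].
  apply: is_derive_eq; rewrite /GRing.scale/= mulr1; ring.
have gd t : t \in `]0, b[ -> is_derive t 1 g 0.
  rewrite in_itv/= => /andP[t0 _].
  have := hder_is_derive t0 (fk t (ltW t0)) => ?; have := ed t => ?.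
  by apply: is_derive_eq; rewrite /GRing.scale/=; ring.
have gc : {within `[0, b], continuous g}.
  move=> x; apply: continuousM.
    exact: (continuous_subspaceT (is_derive_continuous ed)).
  by apply: hcont_within => // t t0; exact: hder_hcont (fk t t0).
have z0 x : x \in `]0, b[ -> `|0 : R| <= 0 by rewrite normr0.
have := @mvt_bound g (fun=> 0) 0 b 0 b0 gd gc z0.
rewrite mul0r normr_le0 subr_eq0 => /eqP.
rewrite /g /GRing.mul/= f0 mulr0 => /eqP.
by rewrite mulf_eq0 expR_eq0/= => /eqP.
Qed.

End RealDerivatives.

(** * Schwartz functions *)

Local Notation "f ^` ()" := (derive1 f) : ring_scope.
Local Notation "f ^` ( n )" := (derive1n n f) : ring_scope.

Section SchwartzFunctions.
Context {R : realType}.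
Implicit Types (f g r s : R -> R) (m : nat -> nat -> R) (x y : R).

(** The weight a stands for |x|^j, which may vanish; dividing by it is possible only otherwise,
    hence the two cases. *)
Lemma taylor1_bound_weighted f f1 f2 (a C x y : R) : 0 <= a ->
  (forall z : R, is_derive z 1 f (f1 z)) -> (forall z : R, is_derive z 1 f1 (f2 z)) ->
  (forall z, `|z - x| <= `|y - x| -> a * `|f2 z| <= C) ->
  a * `|f y - f x - (y - x) * f1 x| <= C * (y - x) ^+ 2.
Proof.
rewrite le_eqVlt => /predU1P[<- _ _ H|a0 fd f1d H].
  rewrite mul0r mulr_ge0 ?sqr_ge0//.
  by have := H x; rewrite subrr normr0 mul0r; apply.
rewrite -ler_pdivlMl// mulrA; apply: (taylor1_bound fd f1d) => z zx.
by rewrite ler_pdivlMl//; exact: H.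
Qed.

Definition rsmooth r := forall k x, derivable r^`(k) x 1.

(* The bounded subsets of the Schwartz space are those contained in some [bset m]. *)
Definition bset m r := rsmooth r /\ forall j k x, `|x| ^+ j * `|r^`(k) x| <= m j k.

Definition rschwartz r := exists m, bset m r.

Lemma rsmooth_is_derive r k x : rsmooth r -> is_derive x 1 r^`(k) (r^`(k.+1) x).
Proof.
move=> rs; apply: DeriveDef; first exact: rs.
by rewrite derive1nS derive1E.
Qed.

(** All iterated derivatives are identified at once by guessing the whole sequence and checking one
    differentiation step. *)
Lemma derivation_chain (g : nat -> R -> R) :
  (forall k x, is_derive x 1 (g k) (g k.+1 x)) ->
  rsmooth (g 0%N) /\ forall k, (g 0%N)^`(k) = g k.
Proof.
move=> gd; have E k : (g 0%N)^`(k) = g k.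
  elim: k => [//|k IH]; rewrite derive1nS IH; apply/funext => x.
  by rewrite derive1E; have [_ ->] := gd k x.
by split=> // k x; rewrite E; have [] := gd k x.
Qed.

Lemma bset_chain (g : nat -> R -> R) m :
  (forall k x, is_derive x 1 (g k) (g k.+1 x)) ->
  (forall j k x, `|x| ^+ j * `|g k x| <= m j k) -> bset m (g 0%N).
Proof.
move=> gd gm; have [gs gE] := derivation_chain gd.
by split=> // j k x; rewrite gE.
Qed.

Lemma derive1n_lin (a : R) r s : rsmooth r -> rsmooth s ->
  rsmooth (fun x => a * r x + s x) /\
  forall k, (fun x => a * r x + s x)^`(k) = (fun x => a * r^`(k) x + s^`(k) x).
Proof.
move=> rs ss.
apply: (@derivation_chain (fun k x => a * r^`(k) x + s^`(k) x)) => k x.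
have := @rsmooth_is_derive r k x rs => ?.
have := @rsmooth_is_derive s k x ss => ?.
have -> : (fun x => a * r^`(k) x + s^`(k) x) = cst a * r^`(k) + s^`(k) by [].
by apply: is_derive_eq; rewrite /GRing.scale/=; ring.
Qed.

Lemma bset_lin (a : R) m m' r s : bset m r -> bset m' s ->
  bset (fun j k => `|a| * m j k + m' j k) (fun x => a * r x + s x).
Proof.
move=> [rs rm] [ss sm]; have [H E] := derive1n_lin a rs ss.
split=> // j k x; rewrite E.
apply: (@le_trans _ _ (`|x| ^+ j * (`|a| * `|r^`(k) x| + `|s^`(k) x|))).
  by rewrite ler_wpM2l ?exprn_ge0// -normrM ler_normD.
rewrite mulrDr lerD// mulrCA ler_wpM2l//.
Qed.

Lemma rschwartz_lin (a : R) r s : rschwartz r -> rschwartz s ->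
  rschwartz (fun x => a * r x + s x).
Proof. by move=> [m rm] [m' sm]; eexists; apply: bset_lin rm sm. Qed.

Lemma derive1n_cst0 k : (fun=> 0 : R)^`(k) = (fun=> 0).
Proof. by elim: k => // k IH; rewrite derive1nS IH; apply/funext => y; exact: derive1_cst. Qed.

Lemma bset0 : bset (fun _ _ => 0) (fun=> 0 : R).
Proof.
by split=> [k x|j k x]; rewrite derive1n_cst0; [exact: derivable_cst|rewrite normr0 mulr0].
Qed.

Lemma rschwartz0 : rschwartz (fun=> 0 : R).
Proof. by eexists; apply: bset0. Qed.

Lemma bsetW m m' r : (forall j k, m j k <= m' j k) -> bset m r -> bset m' r.
Proof. by move=> mm [rs rm]; split=> // j k x; apply: le_trans (rm j k x) _. Qed.

Lemma bset_scale (a : R) m r : bset m r ->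
  bset (fun j k => `|a| * m j k) (fun x => a * r x).
Proof.
move=> rm; have := bset_lin a rm bset0.
have -> : (fun x => a * r x + 0) = (fun x => a * r x).
  by apply/funext => x; rewrite addr0.
by apply: bsetW => j k; rewrite addr0.
Qed.

Lemma derive1n_derive1n r j k : (r^`(j))^`(k) = r^`(j + k).
Proof. by rewrite /derive1n addnC iterD. Qed.

Lemma bset_derive1n m r i : bset m r -> bset (fun j k => m j (i + k)%N) r^`(i).
Proof.
move=> [rs rm]; split=> [k x|j k x]; rewrite derive1n_derive1n; [exact: rs|exact: rm].
Qed.

Lemma rschwartz_derive1n r i : rschwartz r -> rschwartz r^`(i).
Proof. by move=> [m rm]; eexists; apply: bset_derive1n rm. Qed.

Lemma derive1n_shift r z : rsmooth r -> rsmooth (fun x => r (x + z)) /\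
  forall k, (fun x => r (x + z))^`(k) = (fun x => r^`(k) (x + z)).
Proof.
move=> rs; apply: (@derivation_chain (fun k x => r^`(k) (x + z))) => k x.
have -> : (fun x => r^`(k) (x + z)) = r^`(k) \o shift z by [].
have := @rsmooth_is_derive r k (x + z) rs => H.
have := is_derive_shift x (1 : R) z => ?.
by apply: is_derive_eq; rewrite mulr1.
Qed.

Lemma exprD_le (a b : R) j : 0 <= a -> 0 <= b -> (a + b) ^+ j <= (2 ^+ j * (a ^+ j + b ^+ j) : R).
Proof.
move=> a0 b0; wlog ab : a b a0 b0 / a <= b => [H|].
  have [ab|/ltW ba] := leP a b; first exact: H.
  by rewrite addrC [a ^+ j + _]addrC; exact: H.
apply: (@le_trans _ _ ((2 * b) ^+ j)).
  by rewrite lerXn2r ?nnegrE ?addr_ge0 ?mulr_ge0//; lra.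
by rewrite exprMn ler_wpM2l ?exprn_ge0// lerDr exprn_ge0.
Qed.

(** From |x| <= |x + z| + C the weight is moved to the translated argument, where the bounds of
    [bset m] apply. *)
Lemma shift_weight m r C x z j k : bset m r -> `|z| <= C ->
  `|x| ^+ j * `|r^`(k) (x + z)| <= 2 ^+ j * (m j k + C ^+ j * m 0%N k).
Proof.
move=> [_ rm] zC; have C0 : 0 <= C by apply: le_trans zC.
apply: (@le_trans _ _ ((2 ^+ j * (`|x + z| ^+ j + C ^+ j)) * `|r^`(k) (x + z)|)).
  rewrite ler_wpM2r//; apply: le_trans (exprD_le j (normr_ge0 _) C0).
  rewrite lerXn2r ?nnegrE ?addr_ge0//.
  have -> : x = (x + z) - z by rewrite addrK.
  by apply: (le_trans (ler_normB _ _)); rewrite subrK lerD2l.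
rewrite -mulrA ler_wpM2l ?exprn_ge0// mulrDl lerD//.
rewrite ler_wpM2l ?exprn_ge0//.
by have := rm 0%N k (x + z); rewrite expr0 mul1r.
Qed.

Lemma bset_shift r C : rschwartz r -> exists m, forall z, `|z| <= C ->
  bset m (fun x => r (x + z)).
Proof.
move=> [m rm]; exists (fun j k => 2 ^+ j * (m j k + C ^+ j * m 0%N k)) => z zC.
have [rs _] := rm; have [H E] := derive1n_shift z rs.
by split=> // j k x; rewrite E; exact: shift_weight.
Qed.

Lemma rschwartz_shift r z : rschwartz r -> rschwartz (fun x => r (x + z)).
Proof. by move=> /(bset_shift `|z|)[m /(_ z (lexx _))]; exists m. Qed.

(** Normalised second-order remainders of translates form a bounded set. A functional bounded on
    that set therefore satisfies a quadratic Taylor estimate in the translation parameter. *)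
Lemma bset_shift_taylor r C : rschwartz r -> exists m, forall z z' : R,
  `|z| <= C -> `|z'| <= C -> z' != z ->
  bset m (fun x => ((z' - z) ^+ 2)^-1 * (r (x + z') - r (x + z) - (z' - z) * r^`() (x + z))).
Proof.
(* An intermediate point y satisfies |y - x| <= |y - (x + z)| + |z| <= 2 C + C. *)
move=> [m rm]; exists (fun j k => 2 ^+ j * (m j k.+2 + (3 * C) ^+ j * m 0%N k.+2)).
move=> z z' zC z'C zz'; have [rs _] := rm.
have d0 : 0 < (z' - z) ^+ 2 by rewrite exprn_even_gt0//= subr_eq0.
apply: (@bset_chain (fun k x => ((z' - z) ^+ 2)^-1 *
  (r^`(k) (x + z') - r^`(k) (x + z) - (z' - z) * r^`(k.+1) (x + z)))) => [k x|j k x].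
  have sd (y : R) i : is_derive x 1 (fun x => r^`(i) (x + y)) (r^`(i.+1) (x + y)).
    have [H E] := derive1n_shift y rs.
    by have := @rsmooth_is_derive _ i x H; rewrite !E.
  have -> : (fun x => ((z' - z) ^+ 2)^-1 *
     (r^`(k) (x + z') - r^`(k) (x + z) - (z' - z) * r^`(k.+1) (x + z))) =
     cst ((z' - z) ^+ 2)^-1 * ((fun x => r^`(k) (x + z')) - (fun x => r^`(k) (x + z))
       - cst (z' - z) * (fun x => r^`(k.+1) (x + z))) by [].
  have := sd z' k => ?; have := sd z k => ?; have := sd z k.+1 => ?.
  by apply: is_derive_eq; rewrite /GRing.scale/=; ring.
rewrite normrM normfV (gtr0_norm d0) mulrCA ler_pdivrMl// [X in _ <= X]mulrC.
have -> : z' - z = (x + z') - (x + z) by ring.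
apply: (@taylor1_bound_weighted r^`(k) r^`(k.+1) r^`(k.+2)).
- exact: exprn_ge0.
- by move=> y; exact: rsmooth_is_derive.
- by move=> y; exact: rsmooth_is_derive.
- move=> y yx; have -> : y = x + (y - x) by ring.
  apply: shift_weight => //.
  have -> : y - x = (y - (x + z)) + z by ring.
  apply: (le_trans (ler_normD _ _)).
  have : `|x + z' - (x + z)| <= C + C.
    have -> : x + z' - (x + z) = z' - z by ring.
    by apply: (le_trans (ler_normB _ _)); rewrite lerD.
  by lra.
Qed.

End SchwartzFunctions.

(** * Uniform boundedness on Schwartz space *)

Section UniformBoundedness.
Context {R : realType}.
Implicit Types (r s : R -> R) (m : nat -> nat -> R).

(** The factor 3 / 2 is the sum of the powers of 1 / 3. *)
Lemma geometric_dominated (u : R ^nat) (K : R) :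
  (forall n, `|u n| <= K * (3^-1) ^+ n) ->
  cvgn (series u) /\ `|limn (series u)| <= 3 / 2 * K.
Proof.
move=> uK.
have K0 : 0 <= K by have := uK 0%N; rewrite expr0 mulr1; apply: le_trans.
have q1 : `|3^-1 : R| < 1 by rewrite ger0_norm; lra.
have cg := cvg_geometric_series (a := K) q1.
have cn : cvgn [normed series u].
  apply: (@series_le_cvg _ _ (geometric K 3^-1)).
  - by move=> n; exact: normr_ge0.
  - by move=> n; rewrite /geometric/= mulr_ge0// exprn_ge0.
  - exact: uK.
  - by apply/cvg_ex; eexists; exact: cg.
split; first exact: normed_cvg.
apply: (le_trans (lim_series_norm cn)).
apply: (le_trans (lim_series_le cn (cvgP _ cg) uK)).
rewrite (cvg_lim _ cg)//.
have -> : (1 - 3^-1 : R)^-1 = 3 / 2 by field.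
by rewrite mulrC.
Qed.

Lemma lim_series_lin (a : R) (u v : R ^nat) : cvgn (series u) -> cvgn (series v) ->
  limn (series (fun n => a * u n + v n)) = a * limn (series u) + limn (series v) :> R.
Proof.
move=> cu cv; have := lim_seriesD (is_cvg_seriesZ (k := a) cu) cv.
by rewrite lim_seriesZ.
Qed.

Lemma cvg_series_lin (a : R) (u v : R ^nat) : cvgn (series u) -> cvgn (series v) ->
  cvgn (series (fun n => a * u n + v n)).
Proof. by move=> cu cv; apply: is_cvg_seriesD => //; exact: is_cvg_seriesZ. Qed.

(** Termwise differentiation holds because the Taylor remainders of the terms, uniformly quadratic
    in h, are summed against a geometric series. The gliding hump uses it for the full series and
    for its tails. *)
Lemma bset_series m (b : nat -> R -> R) (c : nat -> R) (q : R) : 0 <= q ->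
  (forall n, bset m (b n)) -> (forall n, `|c n| <= q * (3^-1) ^+ n) ->
  (forall x, cvgn (series (fun n => c n * b n x))) /\
  bset (fun j k => 3 / 2 * (q * m j k)) (fun x => limn (series (fun n => c n * b n x))).
Proof.
move=> q0 bm cq.
have E (u : R ^nat) (K : R) : (forall n, `|u n| <= K) -> 
    forall n, `|c n * u n| <= (q * K) * (3^-1) ^+ n.
  by move=> uK n; rewrite normrM mulrAC ler_pM.
have B k x n : `|(b n)^`(k) x| <= m 0%N k.
  by have [_ /(_ 0%N k x)] := bm n; rewrite expr0 mul1r.
pose g k x : R := limn (series (fun n => c n * (b n)^`(k) x)).
have cv k x : cvgn (series (fun n => c n * (b n)^`(k) x)).
  by have [] := geometric_dominated (E _ _ (B k x)).
split; first exact: (cv 0%N).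
apply: (@bset_chain _ g) => [k x|j k x].
  apply: (@is_derive_quadratic _ _ _ _ (3 / 2 * (q * m 0%N k.+2))) => h _.
  have T n : `|(b n)^`(k) (x + h) - (b n)^`(k) x - h * (b n)^`(k.+1) x| <= m 0%N k.+2 * h ^+ 2.
    have [bs _] := bm n.
    have := @taylor1_bound _ (b n)^`(k) (b n)^`(k.+1) (b n)^`(k.+2) (m 0%N k.+2) x (x + h).
    have -> : x + h - x = h by ring.
    by apply => y; [exact: rsmooth_is_derive|exact: rsmooth_is_derive|move=> _; exact: B].
  have [_] := geometric_dominated (E _ _ T).
  rewrite -!mulrA; congr (`|_| <= _).
  rewrite [LHS](_ : _ = limn (series (fun n => (- h) * (c n * (b n)^`(k.+1) x) +
    (-1 * (c n * (b n)^`(k) x) + c n * (b n)^`(k) (x + h))))); last first.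
    by congr (limn (series _)); apply/funext => n; ring.
  have cvA := cvg_series_lin (a := -1) (cv k x) (cv k (x + h)).
  rewrite (lim_series_lin (- h) (cv k.+1 x) cvA).
  rewrite (lim_series_lin (-1) (cv k x) (cv k (x + h))).
  by rewrite -/(g _ _) -/(g _ _) -/(g _ _); ring.
have W n : `| `|x| ^+ j * (b n)^`(k) x| <= m j k.
  by have [_ /(_ j k x)] := bm n; rewrite normrM normrX normr_id.
have [_] := geometric_dominated (E _ _ W).
apply: le_trans; rewrite -{1}(ger0_norm (x := `|x| ^+ j)) ?exprn_ge0// -normrM.
have -> : `|x| ^+ j * g k x = limn (series (fun n => `|x| ^+ j * (c n * (b n)^`(k) x))).
  exact/esym/(lim_seriesZ (`|x| ^+ j) (cv k x)).
rewrite le_eqVlt; apply/orP; left; apply/eqP.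
by congr (`|limn (series _)|); apply/funext => n; ring.
Qed.

Definition rlin (T : (R -> R) -> R) := forall (a : R) r s, rschwartz r -> rschwartz s ->
  T (fun x => a * r x + s x) = a * T r + T s.

Definition rbounded (T : (R -> R) -> R) := forall m, exists M : R, forall r,
  bset m r -> `|T r| <= M.

Lemma rlinZ T (a : R) r : rlin T -> rschwartz r -> T (fun x => a * r x) = a * T r.
Proof.
move=> Tl rs.
have T0 : T (fun=> 0) = 0.
  have := Tl (-1) _ _ (@rschwartz0 R) (@rschwartz0 R).
  have -> : (fun x : R => -1 * 0 + 0 : R) = (fun=> 0) by apply/funext => x; rewrite mulr0 addr0.
  by rewrite mulN1r addNr.
have := Tl a _ _ rs (@rschwartz0 R).
have -> : (fun x => a * r x + 0) = (fun x => a * r x).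
  by apply/funext => x; rewrite addr0.
by rewrite T0 addr0.
Qed.

(** An element within a quarter of the supremum gives the factor 4 / 3; if it falls below the given
    [r0], then [r0] itself is near-maximal and is kept. *)
Lemma near_maximizer T m r0 : rbounded T -> bset m r0 -> 0 < `|T r0| ->
  exists r, [/\ bset m r, `|T r0| <= `|T r| &
    forall s, bset m s -> `|T s| <= 4 / 3 * `|T r|].
Proof.
move=> /(_ m)[M TM] r0m T0.
pose A := [set `|T r| | r in bset m].
have hA : has_sup A.
  split; first by exists `|T r0|, r0.
  by exists M => _ [r /TM ? <-].
have sA s : bset m s -> `|T s| <= sup A.
  by move=> sm; apply: ub_le_sup; [case: hA|exists s].
have S0 : 0 < sup A by apply: lt_le_trans (sA _ r0m).
have [|_ [r rm <-] Sr] := @sup_adherent _ A (sup A / 4) _ hA; first lra.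
have {}Sr : sup A <= 4 / 3 * `|T r| by lra.
have [rr0|r0r] := leP `|T r0| `|T r|.
  by exists r; split=> // s sm; apply: le_trans (sA _ sm) _.
by exists r0; split=> // s sm; apply: le_trans (sA _ sm) _; lra.
Qed.

(* Sokal's gliding hump: the signs of [psi = \sum_n +- 3^-n r_n] are chosen so
   that the n-th term cannot be cancelled by the earlier ones, while the later
   ones are dominated by near-maximality of [r_n]. *)
Theorem uniform_boundedness (I : Type) (T : I -> (R -> R) -> R) :
  (forall i, rlin (T i)) -> (forall i, rbounded (T i)) ->
  (forall r, rschwartz r -> exists M : R, forall i, `|T i r| <= M) ->
  forall m, exists M : R, forall i r, bset m r -> `|T i r| <= M.
Proof.
move=> Tl Tb Tp m; apply: contrapT => noM.
(* Growth 9^n beats the coefficients 3^-n: the n-th hump still has size at least 3^n. *)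
have H n : exists ir : I * (R -> R), [/\ bset m ir.2, 9 ^+ n <= `|T ir.1 ir.2| &
    forall s, bset m s -> `|T ir.1 s| <= 4 / 3 * `|T ir.1 ir.2|].
  apply: contrapT => nH; apply: noM; exists (9 ^+ n) => i r0 r0m.
  rewrite leNgt; apply/negP => big; apply: nH.
  have [|r [rm r0r rmax]] := near_maximizer (Tb i) r0m.
    by apply: lt_trans big; rewrite exprn_gt0.
  by exists (i, r); split=> //=; apply: le_trans r0r; exact: ltW.
have [ir irP] := choice H.
pose i n := (ir n).1; pose b n := (ir n).2.
have bm n : bset m (b n) by case: (irP n).
have big n : 9 ^+ n <= `|T (i n) (b n)| by case: (irP n).
have bmax n s : bset m s -> `|T (i n) s| <= 4 / 3 * `|T (i n) (b n)|.
  by case: (irP n) => _ _; apply.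
pose q : R := 3^-1.
have q0 n : 0 <= q ^+ n by apply: exprn_ge0; rewrite invr_ge0.
pose good n (f : R -> R) (c : R) :=
  q ^+ n * `|T (i n) (b n)| <= `|T (i n) (fun x => c * q ^+ n * b n x + f x)|.
pose sg n f : R := if good n f 1 then 1 else -1.
have sg1 n f : `|sg n f| = 1 by rewrite /sg; case: ifP => _; rewrite ?normrN normr1.
(* The values for the signs 1 and -1 differ by 2 q^n T(b_n), so at least one of them is as large as
   the hump. *)
have sgP n f : rschwartz f -> good n f (sg n f).
  move=> fs; rewrite /sg; case: ifPn => // ng1; apply: contraT => ngN.
  have bs : rschwartz (b n) by exists m.
  move: ng1 ngN; rewrite /good !(Tl (i n))// -!ltNge => A1 A2.
  have : `|2 * (q ^+ n * T (i n) (b n))| < 2 * (q ^+ n * `|T (i n) (b n)|).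
    have -> : 2 * (q ^+ n * T (i n) (b n)) =
       (1 * q ^+ n * T (i n) (b n) + T (i n) f) - (-1 * q ^+ n * T (i n) (b n) + T (i n) f) by ring.
    apply: (le_lt_trans (ler_normB _ _)); lra.
  by rewrite !normrM (ger0_norm (q0 n)) ger0_norm// ltxx.
pose F := fix F n : R -> R := if n is n'.+1 then
  fun x => sg n' (F n') * q ^+ n' * b n' x + F n' x else fun=> 0.
have Fs n : rschwartz (F n).
  elim: n => [|n IH]; first exact: rschwartz0.
  by apply: rschwartz_lin => //; exists m.
pose c n := sg n (F n) * q ^+ n.
have cq n : `|c n| <= 1 * q ^+ n by rewrite normrM sg1 (ger0_norm (q0 n)).
have FE n x : F n x = series (fun k => c k * b k x) n.
  elim: n => [|n IH]; first by rewrite /series/= big_nil.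
  by rewrite seriesEnat/= big_nat_recr//= IH seriesEnat/= addrC.
have [cvF [+ _]] := bset_series ler01 bm cq.
set psi := (fun x => limn _) => _.
have psis : rschwartz psi by have [_ ?] := bset_series ler01 bm cq; eexists; eassumption.
have [M TM] := Tp psi psis.
suff K n : 3 ^+ n / 3 <= `|T (i n) psi|.
  have [n nM] : exists n : nat, 3 * M < n%:R.
    by exists (Num.truncn (3 * M)).+1; exact: truncnS_gt.
  have := le_trans (K n) (TM _).
  have : n%:R <= 3 ^+ n :> R.
    by rewrite -natrX ler_nat ltnW// ltn_expl.
  by lra.
(* The tail after the n-th term has mass at most 3^-n / 2; multiplying it by 2 * 3^n puts it back
   into [bset m], where near-maximality of b_n applies. *)
pose c' k := 2 * 3 ^+ n * c (n.+1 + k)%N.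
have c'q k : `|c' k| <= 2 / 3 * q ^+ k.
  rewrite /c' normrM ger0_norm ?mulr_ge0 ?exprn_ge0//.
  apply: le_trans (ler_wpM2l _ (cq _)) _; first by rewrite mulr_ge0// exprn_ge0.
  rewrite mul1r addSn exprS exprD /q.
  have -> : 2 * 3 ^+ n * (3^-1 * (3^-1 ^+ n * 3^-1 ^+ k)) =
     2 / 3 * (3 * 3^-1) ^+ n * 3^-1 ^+ k :> R by rewrite exprMn; ring.
  by rewrite mulfV// expr1n mulr1.
have q' : 0 <= 2 / 3 :> R by [].
have [cvt tm] := bset_series q' (fun k => bm (n.+1 + k)%N) c'q.
set tau := (fun x => limn _) in tm.
have {}tm : bset m tau.
  by apply: bsetW tm => j k; rewrite mulrA; have -> : 3 / 2 * (2 / 3) = 1 :> R by [field]; rewrite mul1r.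
have psiE : psi = (fun x => (2^-1 * q ^+ n) * tau x + F n.+1 x).
  apply/funext => x; rewrite /psi; apply/cvg_lim => //.
  rewrite -(cvg_shiftn n.+1).
  have -> : (fun k => series (fun j => c j * b j x) (k + n.+1)%N) =
    (fun k => (2^-1 * q ^+ n) * series (fun j => c' j * b (n.+1 + j)%N x) k + F n.+1 x).
    apply/funext => k; rewrite FE !seriesEnat/= addrC addnC (big_cat_nat _ (n := n.+1))//=; last exact: leq_addr.
    congr (_ + _); rewrite -{1}[n.+1]add0n big_addn addKn mulr_sumr.
    apply: eq_bigr => j _; rewrite /c' addnC.
    have q3 : q ^+ n * 3 ^+ n = 1 by rewrite -exprMn mulVf// expr1n.
    have -> : 2^-1 * q ^+ n * (2 * 3 ^+ n * c (n.+1 + j)%N * b (n.+1 + j)%N x) =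
      (q ^+ n * 3 ^+ n) * (c (n.+1 + j)%N * b (n.+1 + j)%N x) by field.
    by rewrite q3 mul1r.
  apply: cvgD; last exact: cvg_cst.
  by apply: cvgM; [exact: cvg_cst|exact: cvt].
rewrite psiE Tl//; last by exists m.
have gF := sgP n (F n) (Fs n); rewrite /good -/(F n.+1) in gF.
have tb := bmax n _ tm.
(* The tail costs at most (1 / 2) (4 / 3) = 2 / 3 of the hump, so a third of it survives. *)
have := ler_normB (2^-1 * q ^+ n * T (i n) tau + T (i n) (F n.+1)) (2^-1 * q ^+ n * T (i n) tau).
rewrite [X in `|X|]addrAC subrr add0r => /(le_trans gF).
rewrite [X in _ + X]normrM (ger0_norm (x := 2^-1 * _)) ?mulr_ge0// => Z.
have : 2^-1 * q ^+ n * `|T (i n) tau| <= 2^-1 * q ^+ n * (4 / 3 * `|T (i n) (b n)|).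
  by rewrite ler_wpM2l// mulr_ge0.
have : 3 ^+ n <= q ^+ n * `|T (i n) (b n)|.
  rewrite /q exprVn ler_pdivlMl ?exprn_gt0// -exprMn.
  by apply: le_trans (big n); rewrite -natrM.
lra.
Qed.

End UniformBoundedness.

(** * The telegraph process and its increments *)

Section BoundedExpectation.
Context d (Omega : measurableType d) (R : realType) (P : probability Omega R).
Implicit Types f g : Omega -> R.

(** This class is stable under products and integrable for a probability, so every integrability
    condition below reduces to it. *)
Definition bmeas f := measurable_fun setT f /\ exists K : R, forall w, `|f w| <= K.

Local Notation Ex := (Rintegral P setT).

Lemma bmeas_integrable f : bmeas f -> P.-integrable setT (EFin \o f).
Proof.
move=> [mf [K fK]]; apply: measurable_bounded_integrable => //.
  by apply: le_lt_trans (probability_le1 P measurableT) _; exact: ltry.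
exists K; split; first exact: num_real.
by move=> M KM w _; apply: le_trans (fK w) (ltW KM).
Qed.

Lemma bmeas_cst (k : R) : bmeas (fun=> k).
Proof. by split=> //; exists `|k|. Qed.

Lemma bmeasD f g : bmeas f -> bmeas g -> bmeas (fun w => f w + g w).
Proof.
move=> [mf [K fK]] [mg [L gL]]; split; first exact: measurable_funD.
by exists (K + L) => w; apply: le_trans (ler_normD _ _) _; exact: lerD.
Qed.

Lemma bmeasM f g : bmeas f -> bmeas g -> bmeas (fun w => f w * g w).
Proof.
move=> [mf [K fK]] [mg [L gL]]; split; first exact: measurable_funM.
by exists (K * L) => w; rewrite normrM ler_pM.
Qed.

Lemma bmeasX f n : bmeas f -> bmeas (fun w => f w ^+ n).
Proof.
move=> bf; elim: n => [|n IH]; first exact: bmeas_cst.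
have -> : (fun w => f w ^+ n.+1) = (fun w => f w * f w ^+ n).
  by apply/funext => w; rewrite exprS.
exact: bmeasM.
Qed.

Lemma bmeasZ (k : R) f : bmeas f -> bmeas (fun w => k * f w).
Proof. by move=> bf; apply: bmeasM => //; exact: bmeas_cst. Qed.

Lemma bmeasB f g : bmeas f -> bmeas g -> bmeas (fun w => f w - g w).
Proof.
move=> bf bg; have -> : (fun w => f w - g w) = (fun w => f w + (-1) * g w).
  by apply/funext => w; rewrite mulN1r.
by apply: bmeasD => //; exact: bmeasZ.
Qed.

Lemma bmeas_sum (I : Type) (r : seq I) (F : I -> Omega -> R) : (forall i, bmeas (F i)) ->
  bmeas (fun w => \sum_(i <- r) F i w).
Proof.
move=> bF; elim: r => [|i r IH].
  have -> : (fun w => \sum_(i <- [::]) F i w) = (fun=> 0) by apply/funext => w; rewrite big_nil.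
  exact: bmeas_cst.
have -> : (fun w => \sum_(j <- i :: r) F j w) = (fun w => F i w + \sum_(j <- r) F j w).
  by apply/funext => w; rewrite big_cons.
exact: bmeasD.
Qed.

Lemma bmeas_norm f : bmeas f -> bmeas (fun w => `|f w|).
Proof.
move=> [mf [K fK]]; split; last by exists K => w; rewrite normr_id.
exact: measurableT_comp.
Qed.

Lemma bmeas_indic A : measurable A -> bmeas (\1_A : Omega -> R).
Proof.
move=> mA; split; first exact: measurable_indic.
by exists 1 => w; rewrite indicE; case: (_ \in _); rewrite ?normr0 ?normr1.
Qed.

Lemma ExD f g : bmeas f -> bmeas g -> Ex (fun w => f w + g w) = Ex f + Ex g.
Proof. by move=> bf bg; rewrite RintegralD//; exact: bmeas_integrable. Qed.

Lemma ExB f g : bmeas f -> bmeas g -> Ex (fun w => f w - g w) = Ex f - Ex g.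
Proof. by move=> bf bg; rewrite RintegralB//; exact: bmeas_integrable. Qed.

Lemma ExZ (k : R) f : bmeas f -> Ex (fun w => k * f w) = k * Ex f.
Proof. by move=> bf; rewrite RintegralZl//; exact: bmeas_integrable. Qed.

Lemma Ex_cst (k : R) : Ex (fun=> k) = k.
Proof. by rewrite Rintegral_cst//= [X in fine X](probability_setT P) mulr1. Qed.

Lemma Ex_le f g : bmeas f -> bmeas g -> (forall w, f w <= g w) -> Ex f <= Ex g.
Proof. by move=> bf bg fg; apply: le_Rintegral => //; exact: bmeas_integrable. Qed.

Lemma Ex_norm_le f g : bmeas f -> bmeas g -> (forall w, `|f w| <= g w) -> `|Ex f| <= Ex g.
Proof.
move=> bf bg fg; rewrite ler_norml; apply/andP; split.
  rewrite -mulN1r -ExZ//; apply: Ex_le => // [|w]; first exact: bmeasZ.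
  by have := fg w; rewrite ler_norml mulN1r => /andP[].
by apply: Ex_le => // w; have := fg w; rewrite ler_norml => /andP[].
Qed.

Lemma Ex_norm_bound f (K : R) : bmeas f -> (forall w, `|f w| <= K) -> `|Ex f| <= K.
Proof.
by move=> bf fK; rewrite -(Ex_cst K); apply: Ex_norm_le => //; exact: bmeas_cst.
Qed.

Lemma Ex_sum (I : Type) (r : seq I) (F : I -> Omega -> R) : (forall i, bmeas (F i)) ->
  Ex (fun w => \sum_(i <- r) F i w) = \sum_(i <- r) Ex (F i).
Proof.
move=> bF; elim: r => [|i r IH].
  by under eq_Rintegral do rewrite big_nil; rewrite Ex_cst big_nil.
under eq_Rintegral do rewrite big_cons.
by rewrite ExD ?IH ?big_cons//; exact: bmeas_sum.
Qed.

Lemma Ex_indic A : measurable A -> Ex (\1_A) = fine (P A).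
Proof. by move=> mA; rewrite /Rintegral integral_indic// setIT. Qed.

End BoundedExpectation.

(** * Poisson increments over short intervals *)

Section PoissonIncrement.
Context d (Omega : measurableType d) (R : realType) (P : probability Omega R).
Variables (l : R) (N : R -> {RV P >-> nat}).
Hypotheses (l0 : 0 <= l) (HN : poisson_process l N).
Local Notation Ex := (Rintegral P setT).

(** The subtraction is truncated; for 0 <= s <= t monotonicity makes it the true increment, so that
    this is the sign picked up by the velocity ([parityK]). *)
Definition parity s t w : R := (- 1) ^+ (N t w - N s w).

Lemma parityK s t w : 0 <= s -> s <= t ->
  (- 1) ^+ (N t w) = (- 1) ^+ (N s w) * parity s t w :> R.
Proof.
move=> s0 st; rewrite /parity -exprD subnKC//.
exact: poisson_nondecreasing HN w s t s0 st.
Qed.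

Lemma measurable_increment s t : measurable_fun setT (fun w => (N t w - N s w)%N).
Proof. by apply: measurable_fun_subn. Qed.

Lemma bmeas_fun_nat (X : Omega -> nat) (h : nat -> R) (K : R) : measurable_fun setT X ->
  (forall n, `|h n| <= K) -> bmeas (fun w => h (X w)).
Proof.
move=> mX hK; split; last by exists K => w.
have mh : measurable_fun setT h by [].
by rewrite -[X in measurable_fun _ X]/(h \o X); exact: measurableT_comp.
Qed.

Lemma bmeas_parity s t : bmeas (parity s t).
Proof.
apply: (@bmeas_fun_nat (fun w => (N t w - N s w)%N) (fun n => (- 1) ^+ n) 1).
  exact: measurable_increment.
by move=> n; rewrite normr_sign.
Qed.

Definition jump s t w : R := (N s w != N t w)%:R.

Lemma bmeas_jump s t : 0 <= s -> s <= t -> bmeas (jump s t).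
Proof.
move=> s0 st.
have -> : jump s t = (fun w => ((N t w - N s w)%N != 0%N)%:R).
  apply/funext => w; rewrite /jump subn_eq0 -ltnNge.
  by have := poisson_nondecreasing HN w s0 st; rewrite ltn_neqAle => ->; rewrite andbT.
apply: (@bmeas_fun_nat (fun w => (N t w - N s w)%N) (fun n => (n != 0%N)%:R) 1).
  exact: measurable_increment.
by move=> n; case: (_ != _); rewrite ?normr1 ?normr0.
Qed.

Lemma measurable_increment_eq s t k : measurable [set w | (N t w - N s w)%N = k].
Proof.
have -> : [set w | (N t w - N s w)%N = k] =
   setT `&` (fun w => (N t w - N s w)%N) @^-1` [set k] by rewrite setTI.
exact: measurable_increment.
Qed.

Let Pk s t k : 0 <= s -> s < t ->
  Ex (\1_[set w | (N t w - N s w)%N = k]) = poisson_pmf (l * (t - s)) k.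
Proof.
by move=> s0 st; rewrite Ex_indic ?(poisson_increment_law HN)//; exact: measurable_increment_eq.
Qed.

Lemma Ex_jump s t : 0 <= s -> s <= t -> Ex (jump s t) <= l * (t - s).
Proof.
move=> s0; rewrite le_eqVlt => /predU1P[->|st].
  rewrite subrr mulr0 (_ : jump t t = fun=> 0) ?Ex_cst//.
  by apply/funext => w; rewrite /jump eqxx.
have -> : jump s t = (fun w => 1 - \1_[set w | (N t w - N s w)%N = 0%N] w).
  apply/funext => w; rewrite /jump indicE.
  have := poisson_nondecreasing HN w s0 (ltW st) => Nst.
  case: (boolP (w \in _)); rewrite ?inE ?notin_setE/= => H.
    move/eqP: H; rewrite subn_eq0 => H; have -> : N s w = N t w by apply/eqP; rewrite eqn_leq Nst.
    by rewrite eqxx subrr.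
  rewrite subr0; case: eqVneq => // E; exfalso; apply: H; by rewrite E subnn.
rewrite ExB; [|exact: bmeas_cst|apply: bmeas_indic; exact: measurable_increment_eq].
rewrite Ex_cst Pk// /poisson_pmf.
(* The second branch is rate 0, where [poisson_pmf] takes the value 1. *)
case: ifP => [lt0|_]; last by rewrite subrr mulr_ge0// subr_ge0 ltW.
rewrite expr0 fact0 invr1 !mul1r.
by have := expR_ge1Dx (- (l * (t - s))); lra.
Qed.

(** The exact value e^(-2 x), x = l (t - s), would require summing a series. Only the events of zero
    and one jump are computed; two or more jumps have probability at most x^2, and expanding e^-x -
    x e^-x costs another 2 x^2. *)
Lemma Ex_parity s t : 0 <= s -> s <= t ->
  `|Ex (parity s t) - (1 - 2 * l * (t - s))| <= 4 * l ^+ 2 * (t - s) ^+ 2.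
Proof.
move=> s0; rewrite le_eqVlt => /predU1P[->|st].
  rewrite subrr !mulr0 subr0 expr0n/= mulr0.
  rewrite (_ : parity t t = fun=> 1) ?Ex_cst ?subrr ?normr0//.
  by apply/funext => w; rewrite /parity subnn.
pose A k := [set w | (N t w - N s w)%N = k].
have bA k : bmeas (\1_(A k) : Omega -> R).
  by apply: bmeas_indic; exact: measurable_increment_eq.
have inA k w : (w \in A k) = ((N t w - N s w)%N == k).
  by apply/idP/eqP; rewrite inE.
set x := l * (t - s).
(* If x <= 0 then l = 0, and [poisson_pmf] is a conventional 1 that does not give the values [p0]
   and [p1] below; [Ex_jump] shows instead that the expected jump indicator is at most 0. *)
have [x0|] := ltP 0 x; last first.
  move=> xle; have : l = 0.
    apply/eqP; rewrite eq_le l0 andbT.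
    by move: xle; rewrite pmulr_lle0// subr_gt0.
  move=> l00.
  have : Ex (jump s t) <= 0 by have := Ex_jump s0 (ltW st); rewrite l00 mul0r.
  rewrite l00 expr0n/= !mulr0 !mul0r subr0 => J0.
  rewrite -[1](Ex_cst P) -ExB; [|exact: bmeas_parity|exact: bmeas_cst].
  apply: (@le_trans _ _ (Ex (fun w => 2 * jump s t w))).
    apply: Ex_norm_le.
    - by apply: bmeasB; [exact: bmeas_parity|exact: bmeas_cst].
    - by apply: bmeasZ; apply: bmeas_jump => //; exact: ltW.
    - move=> w; rewrite /jump /parity; have [->|_] := eqVneq.
        by rewrite subnn expr0 subrr normr0 mulr0.
      by rewrite mulr1; apply: le_trans (ler_normB _ _) _; rewrite normr_sign normr1.
  by rewrite ExZ; [lra|apply: bmeas_jump => //; exact: ltW].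
have p0 : Ex (\1_(A 0%N)) = expR (- x).
  by rewrite Pk// /poisson_pmf -/x x0 expr0 fact0 invr1 !mul1r.
have p1 : Ex (\1_(A 1%N)) = x * expR (- x).
  by rewrite Pk// /poisson_pmf -/x x0 expr1 invr1 mulr1.
have -> : Ex (parity s t) - (1 - 2 * l * (t - s)) =
  Ex (fun w => parity s t w - \1_(A 0%N) w + \1_(A 1%N) w) + (expR (- x) - x * expR (- x) - (1 - 2 * x)).
  rewrite ExD; [|by apply: bmeasB => //; exact: bmeas_parity|exact: bA].
  rewrite ExB; [|exact: bmeas_parity|exact: bA].
  by rewrite p0 p1 /x; ring.
have r1 : `|Ex (fun w => parity s t w - \1_(A 0%N) w + \1_(A 1%N) w)| <=
    1 - expR (- x) - x * expR (- x).
  rewrite -p1 -p0 -[X in X - _ - _](Ex_cst P) -ExB; [|exact: bmeas_cst|exact: bA].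
  rewrite -ExB; [|by apply: bmeasB => //; exact: bmeas_cst|exact: bA].
  apply: Ex_norm_le.
  - by apply: bmeasD => //; apply: bmeasB => //; exact: bmeas_parity.
  - by apply: bmeasB => //; apply: bmeasB => //; exact: bmeas_cst.
  - move=> w; rewrite !indicE /parity !inA.
    case: (N t w - N s w)%N => [|[|n]]; rewrite ?eqxx/=.
    + by rewrite expr0 subrr add0r normr0 subr0.
    + by rewrite expr1 !subr0 addNr normr0 subrr.
    + by rewrite !subr0 addr0 normr_sign.
have e1 := expR_ge1Dx (- x).
have e2 : expR (- x) <= 1 by rewrite expR_le1 oppr_le0 ltW.
have -> : 4 * l ^+ 2 * (t - s) ^+ 2 = 4 * x ^+ 2 by rewrite /x; ring.
have xe : x * (1 - x) <= x * expR (- x) by rewrite ler_pM2l.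
have xe2 : x * expR (- x) <= x by rewrite ger_pMr.
have r2 : `|expR (- x) - x * expR (- x) - (1 - 2 * x)| <= 2 * x ^+ 2.
  have : expR (- x) <= 1 - x + x ^+ 2.
    (* e^-x (1 + x) <= 1 and 1 / (1 + x) <= 1 - x + x^2 *)
    have : expR (- x) * (1 + x) <= 1.
      rewrite expRN -ler_pdivlMl ?invr_gt0 ?expR_gt0// invrK mulr1; exact: expR_ge1Dx.
    nra.
  rewrite ler_norml => e3; apply/andP; split; nra.
apply: le_trans (ler_normD _ _) _; nra.
Qed.

End PoissonIncrement.

(** * Paths of one telegraph process and their Riemann sums *)

Section TelegraphPath.
Context d (Omega : measurableType d) (R : realType) (P : probability Omega R).
Variables (c l x0 : R) (D : {RV P >-> R}) (N : R -> {RV P >-> nat}) (X : R -> {RV P >-> R}).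
Hypothesis HX : telegraph_process c l x0 D N X.

Let HN := telegraph_poisson HX.

Definition velocity t w : R := D w * (- 1) ^+ (N t w).

Lemma sqr_direction w : D w * D w = 1.
Proof. by have [->|->] := telegraph_direction HX w; rewrite ?mulrNN mulr1. Qed.

Lemma norm_direction w : `|D w| = 1.
Proof. by have [->|->] := telegraph_direction HX w; rewrite ?normrN normr1. Qed.

Lemma norm_velocity t w : `|velocity t w| = 1.
Proof. by rewrite normrM norm_direction normr_sign mulr1. Qed.

Lemma sqr_velocity t w : velocity t w * velocity t w = 1.
Proof.
by rewrite /velocity mulrACA sqr_direction mul1r -expr2 sqrr_sign.
Qed.

Lemma velocity_parity s t w : 0 <= s -> s <= t ->
  velocity t w = velocity s w * parity N s t w.
Proof. by move=> s0 st; rewrite /velocity (parityK HN w s0 st) mulrA. Qed.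

Lemma velocity_jump0 s t w : N s w = N t w -> velocity t w = velocity s w.
Proof. by rewrite /velocity => ->. Qed.

Lemma bmeas_direction : bmeas (D : Omega -> R).
Proof. by split=> //; exists 1 => w; rewrite norm_direction. Qed.

Lemma bmeas_velocity t : bmeas (velocity t).
Proof.
apply: bmeasM; first exact: bmeas_direction.
apply: (@bmeas_fun_nat _ _ _ (N t) (fun n => (- 1) ^+ n) 1) => //.
by move=> n; rewrite normr_sign.
Qed.

(** Each path of N is monotone, so its level sets in [0, b] are intervals; a preimage is a countable
    union of these. *)
Lemma measurable_velocity w (b : R) : measurable_fun `[0, b] (velocity ^~ w).
Proof.
have mN : measurable_fun `[0, b] (fun s => N s w).
  move=> _ Y _.
  have -> : `[0, b]%classic `&` (fun s => N s w) @^-1` Y =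
    \bigcup_(k in Y) (`[0, b]%classic `&` [set s | N s w = k]).
    apply/seteqP; split=> [s [sb Ys]|s [k Yk [sb sk]]]; first by exists (N s w).
    by split=> //=; rewrite sk.
  apply: bigcup_measurable => k _; apply: is_interval_measurable => r t /=.
  rewrite !in_itv/= => -[/andP[r0 rb] rk] [/andP[t0 tb] tk] u /andP[ru ut].
  have u0 := le_trans r0 ru.
  split; first by rewrite /= in_itv/= u0 (le_trans ut).
  apply/eqP; rewrite eqn_leq -{1}tk -rk.
  by rewrite !(poisson_nondecreasing HN).
apply: measurable_funM => //.
have mh : measurable_fun [set: nat] (fun n : nat => (- 1) ^+ n : R) by [].
rewrite -[X in measurable_fun _ X]/((fun n : nat => (- 1) ^+ n : R) \o (fun s => N s w)).
exact: measurableT_comp.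
Qed.

Lemma integrable_velocity w (b : R) :
  lebesgue_measure.-integrable `[0, b] (EFin \o (velocity ^~ w)).
Proof.
apply: measurable_bounded_integrable => //.
- by rewrite/= lebesgue_measure_itv/=; case: ifP; rewrite ?ltry// -EFinB ltry.
- exact: measurable_velocity.
- exists 1; split; first exact: num_real.
  by move=> M M1 s _ /=; rewrite norm_velocity ltW.
Qed.

Lemma displacement s t w : 0 <= s -> s <= t ->
  X t w - X s w = c * \int[lebesgue_measure]_(r in `]s, t]) velocity r w.
Proof.
move=> s0 st; rewrite !(telegraph_position HX) ?(le_trans s0)//.
rewrite opprD addrACA subrr add0r -mulrBr; congr (_ * _).
by apply: Rintegral_itvB; [exact: integrable_velocity|rewrite bnd_simp|rewrite bnd_simp].
Qed.

Lemma Rintegral_itv_cst s t (k : R) : s <= t ->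
  \int[lebesgue_measure]_(r in `]s, t]) k = k * (t - s).
Proof.
move=> st; rewrite Rintegral_cst//= lebesgue_measure_itv/= lte_fin.
by move: st; rewrite le_eqVlt => /predU1P[->|->]; rewrite ?ltxx ?subrr.
Qed.

(** Without a jump the velocity is constant and the left side is 0; with a jump both terms are at
    most |c| (t - s). The error is thus of first order only on an event of probability O(t - s),
    which makes its expectation quadratic. *)
Lemma displacement_jump s t w : 0 <= s -> s <= t ->
  `|X t w - X s w - c * (t - s) * velocity s w| <= 2 * `|c| * (t - s) * jump N s t w.
Proof.
move=> s0 st; rewrite displacement//.
have ts0 : 0 <= t - s by rewrite subr_ge0.
have vi : lebesgue_measure.-integrable `]s, t] (EFin \o (velocity ^~ w)).
  apply: (integrableS _ _ _ (@integrable_velocity w t)) => //.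
  move=> r /=; rewrite !in_itv/= => /andP[sr ->]; rewrite andbT.
  by apply: le_trans (ltW sr).
rewrite /jump; have [Nst|_] := eqVneq; last first.
  have : `|\int[lebesgue_measure]_(r in `]s, t]) velocity r w| <= t - s.
    apply: le_trans; first by apply: le_normr_Rintegral => //; exact: vi.
    under eq_Rintegral do rewrite norm_velocity.
    by rewrite Rintegral_itv_cst// mul1r.
  move=> I; rewrite mulr1 -[c * (t - s) * _]mulrA -mulrBr normrM.
  rewrite [2 * `|c|]mulrC -[`|c| * 2 * _]mulrA ler_wpM2l//.
  apply: le_trans (ler_normB _ _) _.
  by rewrite normrM norm_velocity (ger0_norm ts0); lra.
rewrite [X in c * X](_ : _ = \int[lebesgue_measure]_(r in `]s, t]) velocity s w); last first.
  apply: eq_Rintegral => r; rewrite inE/= in_itv/= => /andP[sr rt].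
  apply: velocity_jump0; apply/eqP; rewrite eqn_leq.
  rewrite {2}Nst !(poisson_nondecreasing HN)//; first by rewrite (le_trans s0)// ltW.
    by rewrite ltW.
rewrite Rintegral_itv_cst//.
have -> : c * (velocity s w * (t - s)) - c * (t - s) * velocity s w = 0 by ring.
by rewrite normr0 mulr0.
Qed.

Lemma displacement_le s t w : 0 <= s -> s <= t -> `|X t w - X s w| <= `|c| * (t - s).
Proof.
move=> s0 st; rewrite displacement// normrM ler_wpM2l//.
have vi : lebesgue_measure.-integrable `]s, t] (EFin \o (velocity ^~ w)).
  apply: (integrableS _ _ _ (@integrable_velocity w t)) => //.
  move=> r /=; rewrite !in_itv/= => /andP[sr ->]; rewrite andbT.
  by apply: le_trans (ltW sr).
apply: le_trans; first by apply: le_normr_Rintegral => //; exact: vi.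
under eq_Rintegral do rewrite norm_velocity.
  by rewrite Rintegral_itv_cst// mul1r.
Qed.

Lemma telegraph_start w : X 0 w = x0.
Proof.
rewrite (telegraph_position HX)// set_itv1 Rintegral_set1 mulr0 addr0//.
Qed.

(** Left endpoints: the sum sees only velocities at grid times up to t, hence only the direction and
    the parities of finitely many past increments. *)
Definition riemann_position t n w : R :=
  x0 + c * (t / n.+1%:R) * \sum_(i < n.+1) velocity (i%:R * (t / n.+1%:R)) w.

Lemma bmeas_riemann t n : bmeas (riemann_position t n).
Proof.
apply: bmeasD; first exact: bmeas_cst.
apply: bmeasZ; apply: (@bmeas_sum _ _ _ _ _ (fun (i : 'I_n.+1) => velocity (i%:R * (t / n.+1%:R)))) => i.
exact: bmeas_velocity.
Qed.

(** [displacement_jump] is summed over the cells; only cells containing a jump contribute. *)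
Lemma riemann_error t n w : 0 <= t ->
  `|X t w - riemann_position t n w| <=
  2 * `|c| * (t / n.+1%:R) * \sum_(i < n.+1) jump N (i%:R * (t / n.+1%:R)) (i.+1%:R * (t / n.+1%:R)) w.
Proof.
move=> t0; set h := t / n.+1%:R.
have h0 : 0 <= h by rewrite divr_ge0.
have tE : t = n.+1%:R * h by rewrite /h mulrCA mulfV ?mulr1.
have -> : X t w - riemann_position t n w =
  \sum_(i < n.+1) (X (i.+1%:R * h) w - X (i%:R * h) w - c * h * velocity (i%:R * h) w).
  rewrite big_split/= -(big_mkord xpredT (fun i => X (i.+1%:R * h) w - X (i%:R * h) w)).
  rewrite telescope_sumr// mul0r telegraph_start -tE sumrN -mulr_sumr /riemann_position -/h.
  by ring.
rewrite mulr_sumr; apply: le_trans (ler_norm_sum _ _ _) _; apply: ler_sum => i _.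
have := @displacement_jump (i%:R * h) (i.+1%:R * h) w.
have -> : i.+1%:R * h - i%:R * h = h by rewrite -natr1; ring.
apply; first by rewrite mulr_ge0.
by rewrite ler_wpM2r// ler_nat.
Qed.

Lemma position_le t w : 0 <= t -> `|X t w| <= `|x0| + `|c| * t.
Proof.
move=> t0; have := @displacement_le 0 t w (lexx _) t0; rewrite telegraph_start subr0 => H.
by rewrite -[X t w](subrK x0) addrC; apply: le_trans (ler_normD _ _) _; rewrite lerD2l.
Qed.

Lemma bmeas_position t : 0 <= t -> bmeas (X t : Omega -> R).
Proof.
by move=> t0; split=> //; exists (`|x0| + `|c| * t) => w; exact: position_le.
Qed.

Lemma riemann_le t n w : 0 <= t -> `|riemann_position t n w| <= `|x0| + `|c| * t.
Proof.
move=> t0; apply: le_trans (ler_normD _ _) _; rewrite lerD2l normrM normrM -mulrA ler_wpM2l//.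
rewrite ger0_norm ?divr_ge0//.
apply: (@le_trans _ _ (t / n.+1%:R * \sum_(i < n.+1) 1)).
  rewrite ler_wpM2l ?divr_ge0//; apply: le_trans (ler_norm_sum _ _ _) _.
  by apply: ler_sum => i _; rewrite norm_velocity.
by rewrite sumr_const card_ord divfK// pnatr_eq0.
Qed.

Lemma Ex_riemann_error t n : 0 <= l -> 0 <= t ->
  Rintegral P setT (fun w => `|X t w - riemann_position t n w|) <=
  2 * `|c| * l * t ^+ 2 / n.+1%:R.
Proof.
move=> l0 t0.
have bf : bmeas (fun w => `|X t w - riemann_position t n w|).
  by apply/bmeas_norm/bmeasB; [exact: bmeas_position|exact: bmeas_riemann].
set h := t / n.+1%:R.
have h0 : 0 <= h by rewrite divr_ge0.
have bj i : bmeas (jump N (i%:R * h) (i.+1%:R * h)).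
  by apply: (bmeas_jump HN); rewrite ?mulr_ge0// ler_wpM2r// ler_nat.
have bs : bmeas (fun w => \sum_(i < n.+1) jump N (i%:R * h) (i.+1%:R * h) w).
  by apply: (@bmeas_sum _ _ _ _ _ (fun (i : 'I_n.+1) => jump N (i%:R * h) (i.+1%:R * h))).
pose g w := 2 * `|c| * h * \sum_(i < n.+1) jump N (i%:R * h) (i.+1%:R * h) w.
apply: (@le_trans _ _ (Rintegral P setT g)).
  by apply: Ex_le => // [|w]; [exact: bmeasZ|exact: riemann_error].
rewrite ExZ//.
rewrite (@Ex_sum _ _ _ _ _ _ (fun (i : 'I_n.+1) => jump N (i%:R * h) (i.+1%:R * h)))//.
apply: (@le_trans _ _ (2 * `|c| * h * \sum_(i < n.+1) (l * h))).
  rewrite ler_wpM2l ?mulr_ge0//; apply: ler_sum => i _.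
  have := @Ex_jump _ _ _ _ _ _ l0 HN (i%:R * h) (i.+1%:R * h).
  have -> : i.+1%:R * h - i%:R * h = h by rewrite -natr1; ring.
  apply; first by rewrite mulr_ge0.
  by rewrite ler_wpM2r// ler_nat.
rewrite sumr_const card_ord -mulr_natl /h.
rewrite le_eqVlt; apply/orP; left; apply/eqP.
by field; rewrite nat1r pnatr_eq0.
Qed.

End TelegraphPath.

(** * Events on a time grid and independence of the past from the next increment *)

Section PoissonGrid.
Context d (Omega : measurableType d) (R : realType) (P : probability Omega R).
Variables (l : R) (N : R -> {RV P >-> nat}).
Hypothesis HN : poisson_process l N.

Definition grid_event (t : nat -> R) (K : nat -> set nat) n : set Omega :=
  [set w | forall i, (i < n)%N -> K i (N (t i.+1) w - N (t i) w)%N].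

Definition increment_event (t : nat -> R) (K : nat -> set nat) i : set Omega :=
  [set w | K i (N (t i.+1) w - N (t i) w)%N].

Lemma increment_event_process t K i : (forall i, 0 <= t i) ->
  sigma_process N (increment_event t K i).
Proof.
move=> t0; rewrite /sigma_process.
set G := \bigcup_(t in _) _.
(* N is read as a map on the space equipped with the generated sigma-algebra, so that measurability
   of differences can be used there. *)
have mNt s : 0 <= s -> measurable_fun [set: g_sigma_algebraType G] (N s : g_sigma_algebraType G -> nat).
  move=> s0 _ Y mY; apply: sub_sigma_algebra; exists s; first by rewrite /= in_itv/= s0.
  by exists Y.
have := @measurable_fun_subn _ (g_sigma_algebraType G) setT (N (t i.+1)) (N (t i))
  (mNt _ (t0 _)) (mNt _ (t0 _)).
move=> /(_ measurableT (K i)); rewrite setTI; apply.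
done.
Qed.

Lemma grid_event_process t K n : (forall i, 0 <= t i) -> sigma_process N (grid_event t K n).
Proof.
move=> t0.
have -> : grid_event t K n = \bigcap_(i in [set i | (i < n)%N]) increment_event t K i.
  by apply/seteqP; split=> w.
rewrite /sigma_process; set G := \bigcup_(t in _) _.
have m i : @measurable _ (g_sigma_algebraType G) (increment_event t K i).
  exact: increment_event_process.
exact: (@bigcap_measurableType _ (g_sigma_algebraType G) _ _ (fun i _ => m i)).
Qed.

Lemma grid_event_prob t K n : 0 <= t 0%N -> {homo t : i j / (i <= j)%N >-> i <= j} ->
  fine (P (grid_event t K n)) = \prod_(i < n) fine (P (increment_event t K i)).
Proof.
move=> t0 tm.
have := @poisson_independent_increments _ _ _ _ _ _ HN n t t0 tm [set: 'I_n]%SET (fun i => increment_event t K i).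
have -> : \bigcap_(i in [set` [set: 'I_n]%SET]) increment_event t K i = grid_event t K n.
  apply/seteqP; split=> w H i.
    by move=> ni; by apply: (H (Ordinal ni)) => /=; rewrite inE.
  by move=> _; exact: H.
move=> ->; first by rewrite /=; apply: eq_bigl => i; rewrite inE.
by move=> i _; exists (K i) => //; rewrite setTI.
Qed.

End PoissonGrid.

Section Independence.
Context d (Omega : measurableType d) (R : realType) (P : probability Omega R).
Variables (c1 c2 l1 l2 x1 x2 : R) (D1 D2 : {RV P >-> R}) (N1 N2 : R -> {RV P >-> nat})
  (X1 X2 : R -> {RV P >-> R}).
Hypotheses (H1 : telegraph_process c1 l1 x1 D1 N1 X1)
  (H2 : telegraph_process c2 l2 x2 D2 N2 X2).
Hypothesis HI : mutually_independent P (fun i : 'I_4 =>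
    nth set0 [:: sigma_rv D1; sigma_process N1; sigma_rv D2; sigma_process N2] i).
Local Notation Ex := (Rintegral P setT).

Lemma independence4 A B C E : sigma_rv D1 A -> sigma_process N1 B ->
  sigma_rv D2 C -> sigma_process N2 E ->
  fine (P (A `&` B `&` C `&` E)) = fine (P A) * fine (P B) * fine (P C) * fine (P E).
Proof.
move=> hA hB hC hE.
have := HI (J := [set: 'I_4]%SET) (A := fun i : 'I_4 => nth set0 [:: A; B; C; E] i).
have -> : \bigcap_(i in [set` [set: 'I_4]%SET]) nth set0 [:: A; B; C; E] i = A `&` B `&` C `&` E.
  apply/seteqP; split=> w.
    move=> H; have h i : (nth set0 [:: A; B; C; E] (i : 'I_4)) w by apply: H => /=; rewrite inE.
    by split; [split; [split|]|]; [exact: (h (@Ordinal 4 0 isT))|exact: (h (@Ordinal 4 1 isT))|exact: (h (@Ordinal 4 2 isT))|exact: (h (@Ordinal 4 3 isT))].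
  by move=> [[[wA wB] wC] wE] [[|[|[|[|]]]]].
move=> ->; last by move=> [[|[|[|[|]]]]].
rewrite /= (eq_bigl xpredT); last by move=> i; rewrite inE.
by rewrite !big_ord_recl big_ord0/= mulr1 !mulrA.
Qed.

Variables (t : nat -> R) (n : nat).
Hypotheses (t0 : 0 <= t 0%N) (tm : {homo t : i j / (i <= j)%N >-> i <= j}).

(** All information about the past that the velocities on the grid depend on. It has finitely many
    values, so a function of it is a finite combination of indicators. *)
Definition sign_pattern w : (bool * bool) * ({ffun 'I_n -> bool} * {ffun 'I_n -> bool}) :=
  ((D1 w == 1, D2 w == 1),
   ([ffun i : 'I_n => odd (N1 (t i.+1) w - N1 (t i) w)],
    [ffun i : 'I_n => odd (N2 (t i.+1) w - N2 (t i) w)])).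

Definition last_event (L1 L2 : set nat) : set Omega :=
  increment_event N1 t (fun=> L1) n `&` increment_event N2 t (fun=> L2) n.

Let tge0 i : 0 <= t i. Proof. by apply: le_trans t0 _; exact: tm. Qed.

(** Product shape required by [independence4]. Among the n + 1 increments, [insub i] succeeds for
    the n past ones and fails exactly at i = n, where the condition on the last increment is
    placed. *)
Let pattern_set (y : (bool * bool) * ({ffun 'I_n -> bool} * {ffun 'I_n -> bool})) L1 L2 :
  sign_pattern @^-1` [set y] `&` last_event L1 L2 =
  [set w | (D1 w == 1) = y.1.1] `&`
  grid_event N1 t (fun i => if insub i is Some j then [set k | odd k = y.2.1 j] else L1) n.+1 `&`
  [set w | (D2 w == 1) = y.1.2] `&`
  grid_event N2 t (fun i => if insub i is Some j then [set k | odd k = y.2.2 j] else L2) n.+1.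
Proof.
case: y => [[y1 y2] [z1 z2]]; rewrite /last_event /increment_event /grid_event.
apply/seteqP; split=> w /=.
  move=> [[<- <- <- <-] [L1w L2w]]; split; [split; [split|]|] => // i.
    rewrite ltnS leq_eqVlt => /predU1P[->|ni]; first by rewrite insubF ?ltnn.
    by rewrite insubT/= ffunE.
  rewrite ltnS leq_eqVlt => /predU1P[->|ni]; first by rewrite insubF ?ltnn.
  by rewrite insubT/= ffunE.
move=> [[[d1 g1] d2] g2]; split; last first.
  have := g1 n (ltnSn n); have := g2 n (ltnSn n).
  by rewrite !insubF ?ltnn// => ? ?; split.
rewrite /sign_pattern d1 d2; congr (_, (_, _)); apply/ffunP => i; rewrite ffunE.
  by have := g1 i (ltnW (ltn_ord i)); rewrite (valK i).
by have := g2 i (ltnW (ltn_ord i)); rewrite (valK i).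
Qed.

Let direction_set (D : {RV P >-> R}) (b : bool) :
  [set w | (D w == 1) = b] = setT `&` D @^-1` [set x | (x == 1) = b].
Proof. by rewrite setTI. Qed.

Let measurable_dir b : measurable [set x : R | (x == 1) = b].
Proof.
case: b; first by rewrite (_ : [set x | _] = [set 1])//; apply/seteqP; split=> x /eqP.
rewrite (_ : [set x | _] = ~` [set 1]); first exact: measurableC.
by apply/seteqP; split=> x /=; [move/eqP|move=> /eqP/negbTE].
Qed.

Let sigma_dir (D : {RV P >-> R}) (b : bool) : sigma_rv D [set w | (D w == 1) = b].
Proof. by rewrite direction_set; exists [set x : R | (x == 1) = b]. Qed.

Let HN1 := telegraph_poisson H1.
Let HN2 := telegraph_poisson H2.

Let pattern_prob y L1 L2 : fine (P (sign_pattern @^-1` [set y] `&` last_event L1 L2)) =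
  fine (P (sign_pattern @^-1` [set y] `&` last_event setT setT)) *
  fine (P (increment_event N1 t (fun=> L1) n)) * fine (P (increment_event N2 t (fun=> L2) n)).
Proof.
rewrite !pattern_set !independence4//; try exact: grid_event_process.
rewrite !(grid_event_prob HN1)// !(grid_event_prob HN2)// !big_ord_recr/=.
have rest (N : R -> {RV P >-> nat}) (L : set nat) (z : {ffun 'I_n -> bool}) :
    \prod_(i < n) fine (P (increment_event N t
     (fun i => if insub i is Some j then [set k | odd k = z j] else L) (widen_ord (leqnSn n) i))) =
    \prod_(i < n) fine (P (increment_event N t
     (fun i => if insub i is Some j then [set k | odd k = z j] else setT) (widen_ord (leqnSn n) i))).
  by apply: eq_bigr => i _; rewrite /increment_event/= insubT.
have lst (N : R -> {RV P >-> nat}) (L : set nat) (z : {ffun 'I_n -> bool}) :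
    increment_event N t
     (fun i => if insub i is Some j then [set k | odd k = z j] else L) n =
    increment_event N t (fun=> L) n.
  by rewrite /increment_event/= insubF ?ltnn.
rewrite !lst [X in _ * (X * _) * _ * _]rest [X in _ * _ * _ * (X * _)]rest.
have -> N : increment_event N t (fun=> setT) n = setT by apply/seteqP; split.
rewrite [P setT](probability_setT P) /=; ring.
Qed.

Let measurable_increment_event (N : R -> {RV P >-> nat}) L i :
  measurable (increment_event N t (fun=> L) i).
Proof.
rewrite /increment_event.
rewrite -[X in measurable X]/((fun w => (N (t i.+1) w - N (t i) w)%N) @^-1` L) -[X in measurable X]setTI.
exact: measurable_increment.
Qed.

Let measurable_pattern y : measurable (sign_pattern @^-1` [set y]).
Proof.
have := pattern_set y setT setT; have -> : last_event setT setT = setT by apply/seteqP; split.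
rewrite setIT => ->.
have mg (N : R -> {RV P >-> nat}) K : measurable (grid_event N t K n.+1).
  have -> : grid_event N t K n.+1 = \bigcap_(i in [set i | (i < n.+1)%N]) increment_event N t K i.
    by apply/seteqP; split=> w.
  by apply: bigcap_measurableType => i _; apply: (measurable_increment_event N (K i) i).
have md (D : {RV P >-> R}) b : measurable [set w | (D w == 1) = b].
  by rewrite direction_set; apply: measurable_funP => //; exact: measurable_dir.
by do 3?apply: measurableI.
Qed.

Lemma Ex_pattern f L1 L2 : bmeas f ->
  (forall w w', sign_pattern w = sign_pattern w' -> f w = f w') ->
  Ex (fun w => f w * (\1_(increment_event N1 t (fun=> L1) n) w *
                      \1_(increment_event N2 t (fun=> L2) n) w)) =
  Ex f * (fine (P (increment_event N1 t (fun=> L1) n)) *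
          fine (P (increment_event N2 t (fun=> L2) n))).
Proof.
move=> bf fpat.
(* [z] reads f off the pattern; patterns that never occur get the value 0, and their indicators
   vanish. *)
pose z y : R := if pselect (exists w, sign_pattern w = y) is left h then f (projT1 (cid h)) else 0.
have zE w : z (sign_pattern w) = f w.
  by rewrite /z; case: pselect => [h|[]]; [apply: fpat; case: cid|exists w].
pose A y := sign_pattern @^-1` [set y].
have fE w : f w = \sum_y z y * \1_(A y) w.
  rewrite (bigD1 (sign_pattern w))//= big1 ?addr0.
    by rewrite zE indicE mem_set// mulr1.
  move=> y yw; rewrite indicE memNset ?mulr0// => /= H; move: yw; by rewrite H eqxx.
have mA y : measurable (A y) by exact: measurable_pattern.
have bA y : bmeas (\1_(A y) : Omega -> R) by exact: bmeas_indic.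
have mE1 := measurable_increment_event N1 L1 n.
have mE2 := measurable_increment_event N2 L2 n.
set E1 := increment_event _ _ _ _ in mE1 *; set E2 := increment_event _ _ _ _ in mE2 *.
have bE : bmeas (fun w => \1_E1 w * \1_E2 w : R) by apply: bmeasM; exact: bmeas_indic.
have -> : (fun w => f w * (\1_E1 w * \1_E2 w)) = (fun w => \sum_y z y * \1_(A y `&` (E1 `&` E2)) w).
  by apply/funext => w; rewrite fE mulr_suml; apply: eq_bigr => y _; rewrite !indicI/= -!mulrA.
have -> : f = (fun w => \sum_y z y * \1_(A y) w) by apply/funext => w; exact: fE.
rewrite !Ex_sum; last 2 first.
- by move=> y; exact: bmeasZ.
- by move=> y; apply/bmeasZ/bmeas_indic; exact: measurableI (mA y) (measurableI _ _ mE1 mE2).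
rewrite mulr_suml; apply: eq_bigr => y _.
rewrite !ExZ//; last by apply: bmeas_indic; exact: measurableI (mA y) (measurableI _ _ mE1 mE2).
rewrite -mulrA; congr (_ * _).
rewrite !Ex_indic//; last by exact: measurableI (mA y) (measurableI _ _ mE1 mE2).
rewrite pattern_prob -mulrA; congr (fine (P _) * _).
by apply/seteqP; split=> w //= [].
Qed.

(** A parity is 1 - 2 times the indicator of an odd increment. Expanding both factors leaves four
    terms of the form treated in [Ex_pattern]. *)
Lemma Ex_past_future f (a b : bool) : bmeas f ->
  (forall w w', sign_pattern w = sign_pattern w' -> f w = f w') ->
  Ex (fun w => f w * (parity N1 (t n) (t n.+1) w ^+ a * parity N2 (t n) (t n.+1) w ^+ b)) =
  Ex f * (Ex (parity N1 (t n) (t n.+1)) ^+ a * Ex (parity N2 (t n) (t n.+1)) ^+ b).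
Proof.
move=> bf fpat.
pose O (N : R -> {RV P >-> nat}) := increment_event N t (fun=> [set k | odd k]) n.
pose T (N : R -> {RV P >-> nat}) := increment_event N t (fun=> setT) n.
have bO N : bmeas (\1_(O N) : Omega -> R) by apply: bmeas_indic; exact: measurable_increment_event.
have TT N : T N = setT by apply/seteqP; split.
pose k (a : bool) : R := if a then -2 else 0.
have parE N w : parity N (t n) (t n.+1) w = 1 - 2 * \1_(O N) w.
  rewrite /parity indicE -signr_odd.
  have -> : (w \in O N) = odd (N (t n.+1) w - N (t n) w) by apply/idP/idP; rewrite inE.
  by case: (odd _) => /=; rewrite ?expr1 ?expr0; ring.
have parX N (e : bool) w : parity N (t n) (t n.+1) w ^+ e = \1_(T N) w + k e * \1_(O N) w.
  by rewrite parE TT indicT /k; case: e => /=; rewrite ?expr1 ?expr0; ring.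
pose p N := fine (P (O N)).
have Epar N : Ex (parity N (t n) (t n.+1)) = 1 - 2 * p N.
  have -> : parity N (t n) (t n.+1) = (fun w => 1 - 2 * \1_(O N) w) by apply/funext => w.
  rewrite ExB; [|exact: bmeas_cst|exact: bmeasZ].
  by rewrite Ex_cst ExZ// Ex_indic//; exact: measurable_increment_event.
have EparX N (e : bool) : Ex (parity N (t n) (t n.+1)) ^+ e = 1 + k e * p N.
  by rewrite Epar /k; case: e => /=; rewrite ?expr1 ?expr0; ring.
rewrite !EparX.
pose F (U V : set Omega) w : R := f w * (\1_U w * \1_V w).
have bF U V : measurable U -> measurable V -> bmeas (F U V).
  by move=> mU mV; apply: bmeasM => //; apply: bmeasM; exact: bmeas_indic.
have mO N : measurable (O N) by exact: measurable_increment_event.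
have mT N : measurable (T N) by exact: measurable_increment_event.
have -> : (fun w => f w * (parity N1 (t n) (t n.+1) w ^+ a * parity N2 (t n) (t n.+1) w ^+ b)) =
  (fun w => F (T N1) (T N2) w + k a * F (O N1) (T N2) w + k b * F (T N1) (O N2) w
     + (k a * k b) * F (O N1) (O N2) w).
  by apply/funext => w; rewrite !parX /F; ring.
rewrite !ExD ?ExZ//; try by repeat (apply: bmeasD || apply: bmeasZ || apply: bF).
rewrite !Ex_pattern// -!/(O _) -!/(T _) !TT -!/(p _) (probability_setT P)/=; ring.
Qed.

End Independence.

(** * The one-step estimate *)

Section Moments.
Context d (Omega : measurableType d) (R : realType) (P : probability Omega R).
Variables (c1 c2 l1 l2 x1 x2 : R) (D1 D2 : {RV P >-> R}) (N1 N2 : R -> {RV P >-> nat})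
  (X1 X2 : R -> {RV P >-> R}).
Hypotheses (l10 : 0 <= l1) (l20 : 0 <= l2).
Hypotheses (H1 : telegraph_process c1 l1 x1 D1 N1 X1)
  (H2 : telegraph_process c2 l2 x2 D2 N2 X2).
Hypothesis HI : mutually_independent P (fun i : 'I_4 =>
    nth set0 [:: sigma_rv D1; sigma_process N1; sigma_rv D2; sigma_process N2] i).
Local Notation Ex := (Rintegral P setT).

(** Booleans act as exponents, which suffices because squared velocities are 1. The choice
    [e = false] serves existence, [e = true] adds the weight of the dual solution. *)
Definition signs (e a b : bool) t w : R :=
  (D1 w * D2 w) ^+ e * (velocity D1 N1 t w ^+ a * velocity D2 N2 t w ^+ b).

Definition moment e a b t (psi : R -> R) : R :=
  Ex (fun w => signs e a b t w * psi (X1 t w + X2 t w)).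

Definition range_bound (t : R) := `|x1| + `|x2| + (`|c1| + `|c2|) * t.

(* [psi] is C^{1,1} with derivative [psi1], with constant [K] on [-M, M]. *)
Definition test_bound (M K : R) (psi psi1 : R -> R) :=
  [/\ measurable_fun setT psi, measurable_fun setT psi1,
   forall x, `|x| <= M -> `|psi x| <= K, forall x, `|x| <= M -> `|psi1 x| <= K &
   forall x y, `|x| <= M -> `|y| <= M -> `|psi y - psi x - (y - x) * psi1 x| <= K * (y - x) ^+ 2].

Lemma norm_signs e a b t w : `|signs e a b t w| = 1.
Proof.
rewrite !normrM !normrX normrM (norm_direction H1) (norm_direction H2).
by rewrite (norm_velocity H1) (norm_velocity H2) mulr1 !expr1n !mulr1.
Qed.

Lemma bmeas_signs e a b t : bmeas (signs e a b t).
Proof.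
apply: bmeasM.
  by apply: bmeasX; apply: bmeasM; [exact: (bmeas_direction H1)|exact: (bmeas_direction H2)].
by apply: bmeasM; apply: bmeasX; [exact: (bmeas_velocity H1)|exact: (bmeas_velocity H2)].
Qed.

Lemma signs_step e a b s t w : 0 <= s -> s <= t ->
  signs e a b t w = signs e a b s w * (parity N1 s t w ^+ a * parity N2 s t w ^+ b).
Proof.
move=> s0 st; rewrite /signs (velocity_parity H1 w s0 st) (velocity_parity H2 w s0 st) !exprMn.
ring.
Qed.

Lemma signs_velocity1 e a b t w : signs e a b t w * velocity D1 N1 t w = signs e (~~ a) b t w.
Proof.
rewrite /signs; case: a => /=; rewrite ?expr0 ?expr1; last by ring.
have := sqr_velocity H1 t w; set v := velocity _ _ _ _ => vv.
by rewrite -[RHS]mulr1 -[X in _ = _ * X]vv; ring.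
Qed.

Lemma signs_velocity2 e a b t w : signs e a b t w * velocity D2 N2 t w = signs e a (~~ b) t w.
Proof.
rewrite /signs; case: b => /=; rewrite ?expr0 ?expr1; last by ring.
have := sqr_velocity H2 t w; set v := velocity _ _ _ _ => vv.
by rewrite -[RHS]mulr1 -[X in _ = _ * X]vv; ring.
Qed.

Lemma sum_range t w : 0 <= t -> `|X1 t w + X2 t w| <= range_bound t.
Proof.
move=> t0; apply: le_trans (ler_normD _ _) _; rewrite /range_bound.
by have := position_le H1 w t0; have := position_le H2 w t0; lra.
Qed.

Lemma range_bound_le s t : s <= t -> range_bound s <= range_bound t.
Proof. by move=> st; rewrite lerD2l ler_wpM2l// addr_ge0. Qed.

Lemma bmeas_test (M K : R) (psi : R -> R) (Y : Omega -> R) : measurable_fun setT psi ->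
  (forall x, `|x| <= M -> `|psi x| <= K) -> measurable_fun setT Y -> (forall w, `|Y w| <= M) ->
  bmeas (fun w => psi (Y w)).
Proof.
move=> mpsi psiK mY YM; split; last by exists K => w; exact: psiK.
by rewrite -[X in measurable_fun _ X]/(psi \o Y); exact: measurableT_comp.
Qed.

Lemma bmeas_test_sum (M K : R) (psi : R -> R) t : 0 <= t -> range_bound t <= M ->
  measurable_fun setT psi -> (forall x, `|x| <= M -> `|psi x| <= K) ->
  bmeas (fun w => psi (X1 t w + X2 t w)).
Proof.
move=> t0 tM mpsi psiK; apply: (bmeas_test mpsi psiK).
  exact: measurable_funD.
by move=> w; apply: le_trans (sum_range w t0) tM.
Qed.

Lemma direction_pattern (D : {RV P >-> R}) w w' :
  (forall w, D w = 1 \/ D w = - 1) -> (D w == 1) = (D w' == 1) -> D w = D w'.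
Proof.
have n1 : (-1 == 1 :> R) = false by apply/eqP; lra.
by move=> HD; case: (HD w) => ->; case: (HD w') => -> //; rewrite ?eqxx ?n1.
Qed.

(** The velocity starts at D because N(0) = 0, and each grid step multiplies it by the parity of one
    increment. *)
Lemma velocity_pattern c l x D N X (t : nat -> R) n w w' :
  @telegraph_process _ _ _ P c l x D N X ->
  t 0%N = 0 -> {homo t : i j / (i <= j)%N >-> i <= j} ->
  (D w == 1) = (D w' == 1) ->
  (forall i, (i < n)%N -> odd (N (t i.+1) w - N (t i) w) = odd (N (t i.+1) w' - N (t i) w')) ->
  forall k, (k <= n)%N -> velocity D N (t k) w = velocity D N (t k) w'.
Proof.
move=> HX t0 tm DD NN; elim=> [_|k IH kn].
  rewrite t0 /velocity !(poisson_start (telegraph_poisson HX)).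
  by rewrite (direction_pattern (telegraph_direction HX) DD).
have tk0 : 0 <= t k by rewrite -t0; exact: tm.
rewrite !(velocity_parity HX _ tk0 (tm _ _ (leqnSn k))) IH; last exact: ltnW.
by rewrite /parity -signr_odd NN// signr_odd.
Qed.

Lemma inv_natural_eq0 (x C : R) : (forall n, `|x| <= C / n.+1%:R) -> x = 0.
Proof.
move=> xC; apply/eqP; rewrite -normr_eq0 eq_le normr_ge0 andbT leNgt; apply/negP => x0.
pose n := Num.truncn (C / `|x|).
have : C / `|x| < n.+1%:R by exact: truncnS_gt.
rewrite ltr_pdivrMr// => Cn.
by have := xC n; rewrite ler_pdivlMr// leNgt mulrC Cn.
Qed.

(* The positions are limits of Riemann sums, which depend on finitely many
   increments only and so are covered by [Ex_past_future]. *)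
Lemma Ex_independent_step (M K : R) (psi psi1 : R -> R) e a b t h : 0 <= t -> 0 <= h ->
  range_bound t <= M -> test_bound M K psi psi1 ->
  Ex (fun w => signs e a b t w * psi (X1 t w + X2 t w) *
     (parity N1 t (t + h) w ^+ a * parity N2 t (t + h) w ^+ b)) =
  moment e a b t psi * (Ex (parity N1 t (t + h)) ^+ a * Ex (parity N2 t (t + h)) ^+ b).
Proof.
move=> t0 h0 tM [mpsi mpsi1 psiK psi1K psiT].
have M0 : 0 <= M.
  by apply: le_trans tM; rewrite !addr_ge0// mulr_ge0// addr_ge0.
have K0 : 0 <= K by apply: le_trans (psiK 0 _); rewrite ?normr0.
(* Lipschitz constant of [psi] on [-M, M]: K from the linear term, and K |y - x|^2 <= K (2 M) |y -
   x| from the remainder. *)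
pose L := K + K * (2 * M).
have psiL x y : `|x| <= M -> `|y| <= M -> `|psi y - psi x| <= L * `|y - x|.
  move=> xM yM; have -> : psi y - psi x = (psi y - psi x - (y - x) * psi1 x) + (y - x) * psi1 x.
    by ring.
  apply: le_trans (ler_normD _ _) _.
  have A := psiT x y xM yM; have B := psi1K x xM.
  have yx : `|y - x| <= 2 * M by apply: le_trans (ler_normB _ _) _; lra.
  rewrite normrM; rewrite -sqrnorm in A.
  have A' : K * `|y - x| ^+ 2 <= K * (2 * M) * `|y - x|.
    by rewrite -[_ * _ * `|y - x|]mulrA expr2 ler_wpM2l// ler_wpM2r.
  have B' : `|y - x| * `|psi1 x| <= `|y - x| * K by rewrite ler_wpM2l.
  have -> : L * `|y - x| = K * (2 * M) * `|y - x| + `|y - x| * K by rewrite /L; ring.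
  by apply: lerD => //; exact: le_trans A'.
set S := fun w => X1 t w + X2 t w.
pose Sn n w := riemann_position c1 x1 D1 N1 t n w + riemann_position c2 x2 D2 N2 t n w.
pose F w := signs e a b t w * psi (S w).
pose f n w := signs e a b t w * psi (Sn n w).
pose eps w := parity N1 t (t + h) w ^+ a * parity N2 t (t + h) w ^+ b.
have beps : bmeas eps by apply: bmeasM; apply: bmeasX; exact: bmeas_parity.
have eps1 w : `|eps w| = 1.
  by rewrite normrM !normrX normrN1 !expr1n mulr1.
have bpar (N : R -> {RV P >-> nat}) : `|Ex (parity N t (t + h))| <= 1.
  by apply: Ex_norm_bound; [exact: bmeas_parity|move=> w; rewrite /parity normr_sign].
set kappa := Ex (parity N1 t (t + h)) ^+ a * Ex (parity N2 t (t + h)) ^+ b.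
have kappa1 : `|kappa| <= 1.
  rewrite normrM !normrX mulr_ile1// ?exprn_ge0//; apply: exprn_ile1 => //; exact: bpar.
have SnM n w : `|Sn n w| <= M.
  apply: le_trans tM; apply: le_trans (ler_normD _ _) _; rewrite /range_bound.
  by have := riemann_le H1 n w t0; have := riemann_le H2 n w t0; lra.
have SM w : `|S w| <= M by apply: le_trans (sum_range w t0) tM.
have bSn n : bmeas (Sn n).
  by apply: bmeasD; [exact: (bmeas_riemann H1)|exact: (bmeas_riemann H2)].
have bF : bmeas F.
  apply: bmeasM; first exact: bmeas_signs.
  exact: (bmeas_test_sum t0 tM mpsi psiK).
have bf n : bmeas (f n).
  apply: bmeasM; first exact: bmeas_signs.
  by apply: (bmeas_test mpsi psiK) => //; case: (bSn n).
have fE n : Ex (fun w => f n w * eps w) = Ex (f n) * kappa.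
  (* The grid has n + 1 equal cells filling [0, t], followed by the single cell [t, t + h] that
     carries the future parities. *)
  pose tau i := if (i <= n.+1)%N then i%:R * (t / n.+1%:R) else t + h.
  have tau0 : tau 0%N = 0 by rewrite /tau mul0r.
  have tn : n.+1%:R * (t / n.+1%:R) = t by rewrite mulrCA mulfV ?mulr1.
  have taun : tau n.+1 = t by rewrite /tau leqnn tn.
  have taun1 : tau n.+2 = t + h by rewrite /tau ltnn.
  have taum : {homo tau : i j / (i <= j)%N >-> i <= j}.
    move=> i j ij; rewrite /tau; case: (leqP j n.+1) => jn.
      by rewrite (leq_trans ij jn) ler_wpM2r ?divr_ge0// ler_nat.
    case: (leqP i n.+1) => // iN.
    apply: (@le_trans _ _ t); last by rewrite lerDl.
    by rewrite -[X in _ <= X]tn ler_wpM2r ?divr_ge0// ler_nat.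
  have := @Ex_past_future _ _ _ _ _ _ _ _ _ _ _ _ _ _ _ _ H1 H2 HI tau n.+1 _ taum (f n) a b (bf n).
  rewrite taun taun1; apply; first by rewrite tau0.
  move=> w w'; rewrite /sign_pattern => -[dd1 dd2 /ffunP nn1 /ffunP nn2].
  have v1 k : (k <= n.+1)%N -> velocity D1 N1 (tau k) w = velocity D1 N1 (tau k) w'.
    apply: (velocity_pattern H1 tau0 taum dd1) => i ni.
    by have := nn1 (Ordinal ni); rewrite !ffunE.
  have v2 k : (k <= n.+1)%N -> velocity D2 N2 (tau k) w = velocity D2 N2 (tau k) w'.
    apply: (velocity_pattern H2 tau0 taum dd2) => i ni.
    by have := nn2 (Ordinal ni); rewrite !ffunE.
  have d1 := direction_pattern (telegraph_direction H1) dd1.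
  have d2 := direction_pattern (telegraph_direction H2) dd2.
  rewrite /f /signs d1 d2 -{1 2}taun v1// v2// taun.
  rewrite /Sn /riemann_position; congr (_ * psi (_ + _ * _ + (_ + _ * _))).
    apply: eq_bigr => i _; have := v1 i (ltnW (ltn_ord i)).
    by rewrite /tau (ltnW (ltn_ord i)).
  apply: eq_bigr => i _; have := v2 i (ltnW (ltn_ord i)).
  by rewrite /tau (ltnW (ltn_ord i)).
pose C := L * (2 * `|c1| * l1 * t ^+ 2 + 2 * `|c2| * l2 * t ^+ 2).
have L0 : 0 <= L by rewrite addr_ge0// !mulr_ge0.
have diff n (g : Omega -> R) : bmeas g -> (forall w, `|g w| = 1) ->
  `|Ex (fun w => F w * g w) - Ex (fun w => f n w * g w)| <= C / n.+1%:R.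
  move=> bg g1; rewrite -ExB; [|exact: bmeasM|exact: bmeasM].
  pose E1 w := `|X1 t w - riemann_position c1 x1 D1 N1 t n w|.
  pose E2 w := `|X2 t w - riemann_position c2 x2 D2 N2 t n w|.
  have bE1 : bmeas E1.
    by apply/bmeas_norm/bmeasB; [exact: (bmeas_position H1)|exact: (bmeas_riemann H1)].
  have bE2 : bmeas E2.
    by apply/bmeas_norm/bmeasB; [exact: (bmeas_position H2)|exact: (bmeas_riemann H2)].
  apply: (@le_trans _ _ (Ex (fun w => L * (E1 w + E2 w)))).
    apply: Ex_norm_le.
    - by apply: bmeasB; exact: bmeasM.
    - by apply: bmeasZ; exact: bmeasD.
    - move=> w; rewrite -mulrBl normrM g1 mulr1 -mulrBr normrM norm_signs mul1r.
      apply: le_trans (psiL _ _ (SnM n w) (SM w)) _; rewrite ler_wpM2l//.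
      by rewrite /S /Sn opprD addrACA ler_normD.
  rewrite ExZ ?ExD//; last exact: bmeasD.
  rewrite /C -mulrA ler_wpM2l// mulrDl lerD//.
    exact: (Ex_riemann_error H1).
  exact: (Ex_riemann_error H2).
apply/eqP; rewrite -subr_eq0; apply/eqP; apply: (@inv_natural_eq0 _ (2 * C)) => n.
rewrite -/(F _) -[moment _ _ _ _ _]/(Ex F).
have D1n := diff n eps beps eps1.
have := diff n (fun=> 1) (bmeas_cst _ _) (fun=> normr1 _).
have one (g : Omega -> R) : (fun w => g w * 1) = g by apply/funext => w; rewrite mulr1.
rewrite !one.
move=> D2n; rewrite fE in D1n.
have -> : Ex (fun w => F w * eps w) - Ex F * kappa =
  (Ex (fun w => F w * eps w) - Ex (f n) * kappa) - (Ex F - Ex (f n)) * kappa by ring.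
apply: le_trans (ler_normB _ _) _; rewrite normrM.
have Fk : `|Ex F - Ex (f n)| * `|kappa| <= `|Ex F - Ex (f n)| by rewrite ler_piMr.
have -> : 2 * C / n.+1%:R = C / n.+1%:R + C / n.+1%:R by field; rewrite addrC natr1 pnatr_eq0.
by apply: lerD => //; exact: le_trans Fk D2n.
Qed.

Lemma Ex_parity_product (T : R) : 0 <= T -> exists2 C, 0 <= C & forall (a b : bool) t h,
  0 <= t -> 0 <= h -> h <= T ->
  `|Ex (parity N1 t (t + h)) ^+ a * Ex (parity N2 t (t + h)) ^+ b -
    (1 - 2 * (a%:R * l1 + b%:R * l2) * h)| <= C * h ^+ 2.
Proof.
(* Here 1 + 2 l1 T bounds |1 - 2 l1 h|, and 4 l1 l2 h^2 is the cross term of the two linear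
   approximations. *)
move=> T0; exists (4 * l1 ^+ 2 + (1 + 2 * l1 * T) * (4 * l2 ^+ 2) + 4 * l1 * l2).
  by rewrite !addr_ge0 ?mulr_ge0// ?addr_ge0// ?exprn_ge0// !mulr_ge0.
move=> a b t h t0 h0 hT.
have th : t <= t + h by rewrite lerDl.
have E : t + h - t = h by ring.
have := Ex_parity l10 (telegraph_poisson H1) t0 th.
have := Ex_parity l20 (telegraph_poisson H2) t0 th.
rewrite E.
have e2 : `|Ex (parity N2 t (t + h))| <= 1.
  by apply: Ex_norm_bound; [exact: bmeas_parity|move=> w; rewrite /parity normr_sign].
move: e2; set p1 := Ex (parity N1 _ _); set p2 := Ex (parity N2 _ _) => e2 P2 P1.
have h2 : 0 <= h ^+ 2 by exact: sqr_ge0.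
have A1 : 0 <= 4 * l1 ^+ 2 * h ^+ 2 by rewrite !mulr_ge0// exprn_ge0.
have A2 : 0 <= 4 * l2 ^+ 2 * h ^+ 2 by rewrite !mulr_ge0// exprn_ge0.
have A3 : 0 <= 4 * l1 * l2 * h ^+ 2 by rewrite !mulr_ge0.
have A4 : 0 <= 2 * l1 * T * (4 * l2 ^+ 2 * h ^+ 2) by rewrite !mulr_ge0// exprn_ge0.
have -> : (4 * l1 ^+ 2 + (1 + 2 * l1 * T) * (4 * l2 ^+ 2) + 4 * l1 * l2) * h ^+ 2 =
  4 * l1 ^+ 2 * h ^+ 2 + 4 * l2 ^+ 2 * h ^+ 2 + 2 * l1 * T * (4 * l2 ^+ 2 * h ^+ 2) +
  4 * l1 * l2 * h ^+ 2 by ring.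
case: a; case: b => /=; rewrite ?expr0 ?expr1.
- have -> : p1 * p2 - (1 - 2 * (1 * l1 + 1 * l2) * h) =
    (p1 - (1 - 2 * l1 * h)) * p2 + (1 - 2 * l1 * h) * (p2 - (1 - 2 * l2 * h)) + 4 * l1 * l2 * h ^+ 2.
    by ring.
  apply: le_trans (ler_normD _ _) _; rewrite (ger0_norm A3) lerD2r.
  apply: le_trans (ler_normD _ _) _; rewrite !normrM -addrA lerD//.
    by apply: le_trans P1; rewrite ler_piMr.
  have -> : 4 * l2 ^+ 2 * h ^+ 2 + 2 * l1 * T * (4 * l2 ^+ 2 * h ^+ 2) =
    (1 + 2 * l1 * T) * (4 * l2 ^+ 2 * h ^+ 2) by ring.
  apply: ler_pM => //.
  apply: le_trans (ler_normB _ _) _; rewrite normr1 lerD2l ger0_norm ?mulr_ge0//.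
  by rewrite ler_wpM2l ?mulr_ge0.
- have -> : p1 * 1 - (1 - 2 * (1 * l1 + 0 * l2) * h) = p1 - (1 - 2 * l1 * h) by ring.
  lra.
- have -> : 1 * p2 - (1 - 2 * (0 * l1 + 1 * l2) * h) = p2 - (1 - 2 * l2 * h) by ring.
  lra.
- have -> : 1 * 1 - (1 - 2 * (0 * l1 + 0 * l2) * h) = 0 by ring.
  rewrite normr0; lra.
Qed.

(** Right-hand side of the first-order system: each sign present decays at rate 2 l_i, and transport
    along x multiplies by a velocity, which toggles the corresponding exponent. *)
Definition generator_moment (e a b : bool) t (psi psi1 : R -> R) : R :=
  - 2 * (a%:R * l1 + b%:R * l2) * moment e a b t psi +
  c1 * moment e (~~ a) b t psi1 + c2 * moment e a (~~ b) t psi1.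

(** C is fixed before [psi], hence uniform over all test functions with the same bounds; the duality
    argument needs this because its test function depends on time. *)
Theorem moment_step (T M K : R) : 0 <= T -> range_bound T <= M ->
  exists2 C, 0 <= C & forall (psi psi1 : R -> R) (e a b : bool) (t h : R), test_bound M K psi psi1 ->
  0 <= t -> 0 <= h -> t + h <= T ->
  `|moment e a b (t + h) psi - moment e a b t psi - h * generator_moment e a b t psi psi1| <=
  C * h ^+ 2.
Proof.
move=> T0 TM; have [Cp Cp0 HCp] := Ex_parity_product T0.
pose c := `|c1| + `|c2|; have c0 : 0 <= c by rewrite addr_ge0.
(* The sign of K is known only once some test function satisfies the bounds, which is after C has
   been chosen. *)
pose K' := `|K|.
exists (K' * c ^+ 2 + 4 * K' * c * (l1 + l2) + K' * Cp).
  have K'0 : 0 <= K' by exact: normr_ge0.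
  by rewrite !addr_ge0// !mulr_ge0// ?exprn_ge0// addr_ge0.
move=> psi psi1 e a b t h psib t0 h0 thT.
have [mpsi mpsi1 psiK psi1K psiT] := psib.
have th0 : 0 <= t + h by rewrite addr_ge0.
have tth : t <= t + h by rewrite lerDl.
have tM : range_bound t <= M.
  by apply: le_trans TM; apply: range_bound_le; exact: le_trans tth thT.
have thM : range_bound (t + h) <= M by apply: le_trans TM; exact: range_bound_le.
have M0 : 0 <= M.
  by apply: le_trans tM; rewrite !addr_ge0// mulr_ge0// addr_ge0.
have K0 : 0 <= K by apply: le_trans (psiK 0 _); rewrite ?normr0.
have KK : K' = K by rewrite /K' ger0_norm.
rewrite KK {K' KK}.
pose S t w := X1 t w + X2 t w.
have SM s w : 0 <= s -> range_bound s <= M -> `|S s w| <= M.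
  by move=> s0; apply: le_trans (sum_range w s0).
pose s := signs e a b t.
pose v1 := velocity D1 N1 t; pose v2 := velocity D2 N2 t.
pose eps w := parity N1 t (t + h) w ^+ a * parity N2 t (t + h) w ^+ b.
pose J1 := jump N1 t (t + h); pose J2 := jump N2 t (t + h).
set kappa := Ex (parity N1 t (t + h)) ^+ a * Ex (parity N2 t (t + h)) ^+ b.
have bs := bmeas_signs e a b t; rewrite -/s in bs.
have beps : bmeas eps by apply: bmeasM; apply: bmeasX; exact: bmeas_parity.
have eps1 w : `|eps w| = 1.
  by rewrite normrM !normrX normrN1 !expr1n mulr1.
have bp r : 0 <= r -> range_bound r <= M -> bmeas (fun w => psi (S r w)).
  by move=> r0 rM; exact: (bmeas_test_sum r0 rM mpsi psiK).
have bp1 : bmeas (fun w => psi1 (S t w)) by exact: (bmeas_test_sum t0 tM mpsi1 psi1K).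
have bv1 : bmeas v1 by exact: (bmeas_velocity H1).
have bv2 : bmeas v2 by exact: (bmeas_velocity H2).
have bJ1 : bmeas J1 by exact: (bmeas_jump (telegraph_poisson H1)).
have bJ2 : bmeas J2 by exact: (bmeas_jump (telegraph_poisson H2)).
have mK : `|moment e a b t psi| <= K.
  apply: Ex_norm_bound; first by apply: bmeasM => //; exact: bp.
  by move=> w; rewrite normrM norm_signs mul1r; apply: psiK; exact: SM.
pose F w := s w * psi (S t w) * eps w.
have bF : bmeas F by do 2!apply: bmeasM => //; exact: bp.
have FE : Ex F = moment e a b t psi * kappa by exact: (Ex_independent_step e a b t0 h0 tM psib).
pose g w := s w * eps w * psi (S (t + h) w).
have bg : bmeas g by do 2?apply: bmeasM => //; exact: bp.
have gE : Ex g = moment e a b (t + h) psi.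
  by apply: eq_Rintegral => w _; rewrite (signs_step e a b w t0 tth).
pose k w := s w * (c1 * v1 w + c2 * v2 w) * psi1 (S t w).
have bk : bmeas k.
  by do 2?apply: bmeasM => //; apply: bmeasD; exact: bmeasZ.
have kE : Ex k = c1 * moment e (~~ a) b t psi1 + c2 * moment e a (~~ b) t psi1.
  rewrite /moment -!ExZ; try by apply: bmeasM => //; exact: bmeas_signs.
  rewrite -ExD; try by apply: bmeasZ; apply: bmeasM => //; exact: bmeas_signs.
  apply: eq_Rintegral => w _; rewrite -signs_velocity1 -signs_velocity2 /k -/(s w) -/(v1 w) -/(v2 w).
  by rewrite -/(S t w); ring.
have -> : moment e a b (t + h) psi - moment e a b t psi - h * generator_moment e a b t psi psi1 =
  (Ex g - Ex F - h * Ex k) + moment e a b t psi * (kappa - (1 - 2 * (a%:R * l1 + b%:R * l2) * h)).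
  by rewrite FE gE kE /generator_moment; ring.
apply: le_trans (ler_normD _ _) _; rewrite [X in _ <= X]mulrDl lerD//; last first.
  rewrite normrM -[K * Cp * _]mulrA ler_pM//; apply: HCp => //.
  by apply: le_trans thT; rewrite lerDr.
rewrite -ExZ// -ExB// -ExB//; [|exact: bmeasB|exact: bmeasZ].
pose B w := K * c ^+ 2 * h ^+ 2 + 4 * K * c * h * (J1 w + J2 w).
have bB : bmeas B by apply: bmeasD; [exact: bmeas_cst|apply: bmeasZ; exact: bmeasD].
apply: (@le_trans _ _ (Ex B)); last first.
  rewrite ExD; [|exact: bmeas_cst|by apply: bmeasZ; exact: bmeasD].
  rewrite Ex_cst ExZ; last exact: bmeasD.
  rewrite ExD//.
  have E : t + h - t = h by ring.
  have := Ex_jump l10 (telegraph_poisson H1) t0 tth; rewrite E -/J1 => j1.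
  have := Ex_jump l20 (telegraph_poisson H2) t0 tth; rewrite E -/J2 => j2.
  rewrite [X in _ <= X](_ : _ = K * c ^+ 2 * h ^+ 2 + 4 * K * c * h * (l1 * h + l2 * h)); last by ring.
  by rewrite lerD2l ler_wpM2l ?mulr_ge0// lerD.
apply: Ex_norm_le => //.
  by apply: bmeasB; [exact: bmeasB|exact: bmeasZ].
move=> w; pose dS := S (t + h) w - S t w; pose V := c1 * v1 w + c2 * v2 w.
(* The Taylor remainder is at most K (c h)^2. The other two terms vanish unless one process jumps
   and are then each at most 2 c h per jump indicator, up to the factor K. *)
have -> : g w - F w - h * k w = s w * (eps w * (psi (S (t + h) w) - psi (S t w) - dS * psi1 (S t w))
  + psi1 (S t w) * (eps w * (dS - h * V) + (eps w - 1) * (h * V))).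
  by rewrite /g /F /k /V; ring.
rewrite normrM norm_signs mul1r; apply: le_trans (ler_normD _ _) _.
have E : t + h - t = h by ring.
have j1 := displacement_jump H1 w t0 tth; rewrite E -/(v1 w) -/(J1 w) in j1.
have j2 := displacement_jump H2 w t0 tth; rewrite E -/(v2 w) -/(J2 w) in j2.
have d1 := displacement_le H1 w t0 tth; rewrite E in d1.
have d2 := displacement_le H2 w t0 tth; rewrite E in d2.
have dSc : `|dS| <= c * h.
  have -> : dS = (X1 (t + h) w - X1 t w) + (X2 (t + h) w - X2 t w) by rewrite /dS /S; ring.
  by apply: le_trans (ler_normD _ _) _; rewrite /c mulrDl lerD.
have J10 : 0 <= J1 w by exact: ler0n.
have J20 : 0 <= J2 w by exact: ler0n.
have Vc : `|V| <= c.
  apply: le_trans (ler_normD _ _) _; rewrite (normrM c1) (normrM c2) [`|v1 w|](norm_velocity H1) [`|v2 w|](norm_velocity H2) !mulr1.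
  exact: lexx.
rewrite lerD//.
  rewrite normrM eps1 mul1r.
  apply: le_trans (psiT _ _ (SM t w t0 tM) (SM (t + h) w th0 thM)) _.
  rewrite -mulrA -exprMn ler_wpM2l// -sqrnorm lerXn2r ?nnegrE ?mulr_ge0//.
rewrite normrM [X in _ <= X](_ : _ = K * (4 * c * h * (J1 w + J2 w))); last by ring.
rewrite ler_pM// ?psi1K ?SM//.
have dSV : `|dS - h * V| <= 2 * c * h * (J1 w + J2 w).
  have -> : dS - h * V = (X1 (t + h) w - X1 t w - c1 * h * v1 w) + (X2 (t + h) w - X2 t w - c2 * h * v2 w).
    by rewrite /dS /S /V; ring.
  apply: le_trans (ler_normD _ _) _; apply: (le_trans (lerD j1 j2)).
  have : 0 <= 2 * `|c2| * h * J1 w by rewrite !mulr_ge0.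
  have : 0 <= 2 * `|c1| * h * J2 w by rewrite !mulr_ge0.
  by rewrite /c; lra.
have e1 : `|eps w - 1| <= 2 * (J1 w + J2 w).
  have big : `|eps w - 1| <= 2.
    by apply: le_trans (ler_normB _ _) _; rewrite eps1 normr1.
  rewrite /J1 /J2 /jump.
  have [E1|_] := eqVneq (N1 t w) _; have [E2|_] := eqVneq (N2 t w) _;
    try by apply: le_trans big _; rewrite /=; lra.
  by rewrite /eps /parity E1 E2 !subnn !expr0 !expr1n mulr1 subrr normr0 addr0 mulr0.
apply: le_trans (ler_normD _ _) _; rewrite (normrM (eps w)) (normrM (eps w - 1)) (normrM h) eps1 mul1r (ger0_norm h0).
have : `|eps w - 1| * (h * `|V|) <= 2 * (J1 w + J2 w) * (h * c).
  by rewrite ler_pM// ?mulr_ge0// ler_wpM2l.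
lra.
Qed.

Definition bounded_test (M : R) (psi : R -> R) := measurable_fun setT psi /\
  exists K : R, forall x, `|x| <= M -> `|psi x| <= K.

Lemma bounded_test_lin M (r : R) psi phi : bounded_test M psi -> bounded_test M phi ->
  bounded_test M (fun x => r * psi x + phi x).
Proof.
move=> [mpsi [K psiK]] [mphi [L phiL]]; split.
  by apply: measurable_funD => //; apply: measurable_funM.
exists (`|r| * K + L) => x xM; apply: le_trans (ler_normD _ _) _.
by rewrite lerD ?phiL// normrM ler_wpM2l// psiK.
Qed.

Lemma moment_lin e a b t M (r : R) psi phi : 0 <= t -> range_bound t <= M ->
  bounded_test M psi -> bounded_test M phi ->
  moment e a b t (fun x => r * psi x + phi x) = r * moment e a b t psi + moment e a b t phi.
Proof.
move=> t0 tM [mpsi [K psiK]] [mphi [L phiL]]; have bs := bmeas_signs e a b t.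
have b1 := bmeas_test_sum t0 tM mpsi psiK; have b2 := bmeas_test_sum t0 tM mphi phiL.
rewrite /moment -ExZ; last exact: bmeasM.
rewrite -ExD; [|by apply: bmeasZ; exact: bmeasM|exact: bmeasM].
by apply: eq_Rintegral => w _; ring.
Qed.

Lemma moment_cst0 e a b t : moment e a b t (fun=> 0) = 0.
Proof.
by rewrite /moment -[RHS](Ex_cst P 0); apply: eq_Rintegral => w _; rewrite mulr0.
Qed.

Lemma moment_bound e a b t M (K : R) (psi : R -> R) : 0 <= t -> range_bound t <= M ->
  measurable_fun setT psi -> (forall x, `|x| <= M -> `|psi x| <= K) ->
  `|moment e a b t psi| <= K.
Proof.
move=> t0 tM mpsi psiK; apply: Ex_norm_bound.
  by apply: bmeasM; [exact: bmeas_signs|exact: bmeas_test_sum psiK].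
move=> w; rewrite normrM norm_signs mul1r; apply: psiK.
by apply: le_trans (sum_range w t0) tM.
Qed.

Lemma Ex_direction (D : {RV P >-> R}) : (forall w, D w = 1 \/ D w = - 1) ->
  P [set w | D w = 1] = (2^-1)%:E -> Ex (fun w => D w) = 0.
Proof.
move=> HD PD; have mA : measurable [set w | D w = 1].
  rewrite (_ : [set w | _] = setT `&` D @^-1` [set 1]); last by rewrite setTI.
  exact: measurable_funP.
have n1 : (-1 : R) != 1 by apply/eqP; lra.
have -> : Ex (fun w => D w) = Ex (fun w => 2 * \1_[set w | D w = 1] w - 1).
  apply: eq_Rintegral => w _; rewrite indicE; case: (HD w) => E.
    by rewrite mem_set ?E//=; ring.
  by rewrite memNset ?E//=; [ring|rewrite E; exact/eqP].
rewrite ExB; [|by apply: bmeasZ; exact: bmeas_indic|exact: bmeas_cst].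
rewrite ExZ; last exact: bmeas_indic.
by rewrite Ex_indic// PD Ex_cst/= mulfV// subrr.
Qed.

(** At time 0 velocities equal directions, so the sign factor is D1^(e xor a) D2^(e xor b), and D1,
    D2 and D1 D2 are all centred. *)
Lemma moment0 e a b psi : moment e a b 0 psi = ((e == a) && (e == b))%:R * psi (x1 + x2).
Proof.
have v10 w : velocity D1 N1 0 w = D1 w by rewrite /velocity (poisson_start (telegraph_poisson H1)) mulr1.
have v20 w : velocity D2 N2 0 w = D2 w by rewrite /velocity (poisson_start (telegraph_poisson H2)) mulr1.
have b1 := bmeas_direction H1; have b2 := bmeas_direction H2.
have E1 := Ex_direction (telegraph_direction H1) (telegraph_right H1).
have E2 := Ex_direction (telegraph_direction H2) (telegraph_right H2).
have mA (D : {RV P >-> R}) : measurable [set w | D w = 1].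
  rewrite (_ : [set w | _] = setT `&` D @^-1` [set 1]); last by rewrite setTI.
  exact: measurable_funP.
have n1 : (-1 : R) != 1 by apply/eqP; lra.
have DE (D : {RV P >-> R}) w : (D w = 1 \/ D w = - 1) -> D w = 2 * \1_[set w | D w = 1] w - 1.
  rewrite indicE; case=> E; first by rewrite mem_set ?E//=; ring.
  by rewrite memNset ?E//=; [ring|rewrite E; exact/eqP].
have PA : fine (P ([set w | D1 w = 1] `&` [set w | D2 w = 1])) = 2^-1 * 2^-1.
  have sD (D : {RV P >-> R}) : sigma_rv D [set w | D w = 1].
    by exists [set 1] => //; rewrite setTI.
  have sT (N : R -> {RV P >-> nat}) : sigma_process N setT.
    rewrite /sigma_process; set G := \bigcup_(t in _) _.
    exact: (@measurableT _ (g_sigma_algebraType G)).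
  have := independence4 HI (sD D1) (sT N1) (sD D2) (sT N2).
  rewrite !setIT => ->.
  by rewrite (telegraph_right H1) (telegraph_right H2) (probability_setT P)/= !mulr1.
have E12 : Ex (fun w => D1 w * D2 w) = 0.
  pose A := [set w | D1 w = 1]; pose B := [set w | D2 w = 1].
  have bA : bmeas (\1_A : Omega -> R) by apply: bmeas_indic; exact: mA.
  have bAB : bmeas (\1_(A `&` B) : Omega -> R).
    by apply: bmeas_indic; apply: measurableI; exact: mA.
  have -> : (fun w => D1 w * D2 w) = (fun w => 4 * \1_(A `&` B) w - (2 * \1_A w + D2 w)).
    apply/funext => w; rewrite indicI/= (DE D1 w (telegraph_direction H1 w)).
    rewrite (DE D2 w (telegraph_direction H2 w)).
    by rewrite -/A -/B; ring.
  rewrite ExB; [|exact: bmeasZ|by apply: bmeasD => //; exact: bmeasZ].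
  rewrite ExD ?ExZ//; last exact: bmeasZ.
  rewrite E2 !Ex_indic//; [|exact: mA|by apply: measurableI; exact: mA].
  by rewrite PA (telegraph_right H1)/=; field.
have sG w : signs e a b 0 w = D1 w ^+ (e (+) a) * D2 w ^+ (e (+) b).
  rewrite /signs v10 v20; case: (telegraph_direction H1 w) => ->;
    case: (telegraph_direction H2 w) => ->; case: e; case: a; case: b => /=; ring.
have -> : moment e a b 0 psi = psi (x1 + x2) * Ex (fun w => D1 w ^+ (e (+) a) * D2 w ^+ (e (+) b)).
  rewrite -ExZ; last by apply: bmeasM; exact: bmeasX.
  by apply: eq_Rintegral => w _; rewrite (telegraph_start H1) (telegraph_start H2) sG mulrC.
rewrite mulrC; congr (_ * _).
case: e {sG}; case: a; case: b => /=.
all: under eq_Rintegral do rewrite ?expr1 ?expr0 ?mul1r ?mulr1.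
all: by rewrite ?Ex_cst ?E1 ?E2 ?E12.
Qed.

End Moments.

(** * Uniqueness *)

Section TelegraphSumOperator.
Context {R : realType}.
Variables c1 c2 l1 l2 : R.

(* [X k j] stands for the value of d_t^k d_x^j *)
Definition telegraph_sum_form (X : nat -> nat -> R) : R :=
  X 4%N 0%N + 4 * (l1 + l2) * X 3%N 0%N +
  (5 * (l1 + l2) ^+ 2 - (l1 - l2) ^+ 2) * X 2%N 0%N - 2 * (c1 ^+ 2 + c2 ^+ 2) * X 2%N 2%N +
  2 * (l1 + l2) * ((l1 + l2) ^+ 2 - (l1 - l2) ^+ 2) * X 1%N 0%N
  - 4 * (l1 + l2) * (c1 ^+ 2 + c2 ^+ 2) * X 1%N 2%N +
  (2 * (c1 ^+ 2 - c2 ^+ 2) * (l1 ^+ 2 - l2 ^+ 2) - 2 * (l1 + l2) ^+ 2 * (c1 ^+ 2 + c2 ^+ 2)) * X 0%N 2%N +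
  (c1 ^+ 2 - c2 ^+ 2) ^+ 2 * X 0%N 4%N.

(* A weak solution with zero data: [a k t] is its k-th time derivative. *)
Record null_solution (a : nat -> R -> (R -> R) -> R) : Prop := NullSolution {
  null_linear : forall t, 0 <= t -> rlin (a 0%N t) ;
  null_bounded : forall t, 0 <= t -> rbounded (a 0%N t) ;
  null_derive : forall k r t, (k < 4)%N -> rschwartz r -> 0 <= t ->
    hder (fun s => a k s r) t (a k.+1 t r) ;
  null_continuous : forall r t, rschwartz r -> 0 <= t -> hcont (fun s => a 4%N s r) t ;
  null_initial : forall k r, (k < 4)%N -> rschwartz r -> a k 0 r = 0 ;
  null_equation : forall r t, rschwartz r -> 0 < t ->
    telegraph_sum_form (fun k j => a k t r^`(j)) = 0 }.

Section NullSolution.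
Variable a : nat -> R -> (R -> R) -> R.
Hypothesis Ha : null_solution a.
Implicit Types (r : R -> R) (m : nat -> nat -> R).

Lemma null_lin k t : (k <= 4)%N -> 0 <= t -> rlin (a k t).
Proof.
elim: k t => [|k IH] t k4 t0; first exact: null_linear.
move=> q r s rr rs; have dl := null_derive Ha k4 (rschwartz_lin q rr rs) t0.
apply: (hder_unique t0 dl).
apply: (hder_ext t0 _ (hder_scaleD q (null_derive Ha k4 rr t0) (null_derive Ha k4 rs t0))).
by move=> u u0; rewrite (IH u (ltnW k4) u0).
Qed.

(** A time derivative is the pointwise limit of bounded functionals, namely difference quotients;
    convergence bounds them pointwise, and uniform boundedness passes to the limit. *)
Lemma null_bd k t : (k <= 4)%N -> 0 <= t -> rbounded (a k t).
Proof.
elim: k t => [|k IH] t k4 t0; first exact: null_bounded.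
pose u n := t + n.+1%:R^-1.
have u0 n : 0 <= u n by rewrite addr_ge0// invr_ge0.
pose T n r := (a k (u n) r - a k t r) * n.+1%:R.
have kl s : 0 <= s -> rlin (a k s) by move=> s0; exact: (null_lin (ltnW k4)).
have Tl n : rlin (T n) by move=> q r s rr rs; rewrite /T !kl//; ring.
have Tb n : rbounded (T n).
  move=> m; have [M aM] := IH (u n) (ltnW k4) (u0 n) m; have [M' aM'] := IH t (ltnW k4) t0 m.
  exists ((M + M') * n.+1%:R) => r rm; rewrite normrM normr_nat ler_wpM2r//.
  by apply: le_trans (ler_normB _ _) _; rewrite lerD ?aM ?aM'.
have Tcv r : rschwartz r -> T n r @[n --> \oo] --> a k.+1 t r.
  by move=> rr; exact: (hder_seq t0 (null_derive Ha k4 rr t0)).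
have Tp r : rschwartz r -> exists M : R, forall n, `|T n r| <= M.
  move=> /Tcv cv; have /cvg_seq_bounded[M [_ MP]] : cvgn (fun n => T n r) by apply: cvgP cv.
  by exists (M + 1) => n; apply: MP => //; rewrite ltrDl.
move=> m; have [M TM] := uniform_boundedness Tl Tb Tp m; exists M => r rm.
have cv : `|T n r| @[n --> \oo] --> `|a k.+1 t r|.
  by apply: cvg_norm; apply: Tcv; exists m.
by rewrite -(cvg_lim _ cv)//; apply: limr_le; [exact: cvgP cv|near=> n; exact: TM].
Unshelve. all: by end_near. Qed.

Lemma null_hcont k r t : (k <= 4)%N -> rschwartz r -> 0 <= t -> hcont (fun s => a k s r) t.
Proof.
rewrite leq_eqVlt => /predU1P[->|k4] rr t0; first exact: null_continuous.
exact: hder_hcont (null_derive Ha k4 rr t0).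
Qed.

(** Pointwise bounds come from continuity in s on the compact [0, T]; the principle is applied with
    the times as index set. *)
Lemma null_unif k T m : (k <= 4)%N -> exists M : R, forall s r, 0 <= s -> s <= T ->
  bset m r -> `|a k s r| <= M.
Proof.
move=> k4; pose I := {s : R | 0 <= s /\ s <= T}.
have [|||M aM] := @uniform_boundedness R I (fun i => a k (sval i)) _ _ _ m.
- by move=> [s [s0 sT]]; exact: null_lin.
- by move=> [s [s0 sT]]; exact: null_bd.
- move=> r rr; have [C fC] := hcont_bounded T (fun t t0 => null_hcont k4 rr t0).
  by exists C => -[s [s0 sT]]; exact: fC.
- by exists M => s r s0 sT rm; exact: (aM (exist _ s (conj s0 sT))).
Qed.

Lemma null_equation0 r t : rschwartz r -> 0 <= t ->
  telegraph_sum_form (fun k j => a k t r^`(j)) = 0.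
Proof.
move=> rr; rewrite le_eqVlt => /predU1P[<-|]; last exact: null_equation.
pose f t := telegraph_sum_form (fun k j => a k t r^`(j)).
have fc : hcont f 0.
  have ac k j : (k <= 4)%N -> hcont (fun s => a k s r^`(j)) 0.
    by move=> k4; apply: null_hcont => //; exact: rschwartz_derive1n.
  rewrite /f /telegraph_sum_form; cbv beta.
  by repeat first [apply: hcontB|apply: hcontD|apply: hcontZ|exact: ac].
apply: (hcont0_eq0 fc) => s s0; exact: (null_equation Ha).
Qed.

(** The distribution d_t^k w(s) as a smooth function of the shift x: differentiation in x raises j.
    In this form it can be evaluated at S and averaged. *)
Definition translate k j s (r : R -> R) x := a k s (fun y => r^`(j) (y + x)).

Lemma translate_bound k j T M r : (k <= 4)%N -> rschwartz r -> exists2 K : R, 0 <= K & forall s x y,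
  0 <= s -> s <= T -> `|x| <= M -> `|y| <= M ->
  `|translate k j s r x| <= K /\
  `|translate k j s r y - translate k j s r x - (y - x) * translate k j.+1 s r x| <= K * (y - x) ^+ 2.
Proof.
move=> k4 rr; have rj := rschwartz_derive1n j rr.
have [m1 H1] := bset_shift M rj; have [m2 H2] := bset_shift_taylor M rj.
have [K1 HK1] := null_unif T m1 k4; have [K2 HK2] := null_unif T m2 k4.
exists (`|K1| + `|K2|); first by rewrite addr_ge0.
move=> s x y s0 sT xM yM; split.
  apply: le_trans (HK1 s _ s0 sT (H1 x xM)) _.
  by apply: le_trans (ler_norm _) _; rewrite lerDl.
have [->|yx] := eqVneq y x.
  by rewrite !subrr mul0r subr0 normr0 expr0n/= mulr0.
have d0 : 0 < (y - x) ^+ 2 by rewrite exprn_even_gt0//= subr_eq0.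
have := HK2 s _ s0 sT (H2 x y xM yM yx).
have al := null_lin k4 s0.
have sx i z : rschwartz (fun w => r^`(i) (w + z)).
  by apply: rschwartz_shift; exact: rschwartz_derive1n.
have -> : (fun w => ((y - x) ^+ 2)^-1 * (r^`(j) (w + y) - r^`(j) (w + x) - (y - x) * (r^`(j))^`() (w + x))) =
  (fun w => ((y - x) ^+ 2)^-1 * (- (y - x) * r^`(j.+1) (w + x) + (- 1 * r^`(j) (w + x) + r^`(j) (w + y)))).
  by apply/funext => w; congr (_ * _); rewrite derive1nS; ring.
have sB : rschwartz (fun w => - 1 * r^`(j) (w + x) + r^`(j) (w + y)) by apply: rschwartz_lin.
rewrite rlinZ//; last exact: rschwartz_lin.
rewrite al// al// normrM normfV (gtr0_norm d0) ler_pdivrMl// [X in _ <= X]mulrC => H.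
rewrite /translate.
have -> : a k s (fun w => r^`(j) (w + y)) - a k s (fun w => r^`(j) (w + x)) - (y - x) * a k s (fun w => r^`(j.+1) (w + x)) =
  - (y - x) * a k s (fun w => r^`(j.+1) (w + x)) + (-1 * a k s (fun w => r^`(j) (w + x)) + a k s (fun w => r^`(j) (w + y))) by ring.
apply: le_trans H _; rewrite ler_wpM2r ?sqr_ge0//.
by apply: le_trans (ler_norm _) _; rewrite lerDr.
Qed.

Lemma translate_is_derive k j s r (x : R) : (k <= 4)%N -> 0 <= s -> rschwartz r ->
  is_derive x 1 (translate k j s r) (translate k j.+1 s r x).
Proof.
move=> k4 s0 rr; have [K _ H] := translate_bound j s (`|x| + 1) k4 rr.
apply: (@is_derive_quadratic _ _ _ _ K) => h h1.
have xM : `|x| <= `|x| + 1 by rewrite lerDl.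
have hM : `|x + h| <= `|x| + 1 by apply: le_trans (ler_normD _ _) _; rewrite lerD2l.
have [_] := H s x (x + h) s0 (lexx _) xM hM.
by have -> : x + h - x = h by ring.
Qed.

Lemma measurable_translate k j s r : (k <= 4)%N -> 0 <= s -> rschwartz r ->
  measurable_fun setT (translate k j s r).
Proof.
move=> k4 s0 rr; apply: continuous_measurable_fun.
by apply: is_derive_continuous => x; exact: translate_is_derive.
Qed.

Lemma translate_test_bound k j T M r : (k <= 4)%N -> rschwartz r ->
  exists2 K : R, 0 <= K & forall s, 0 <= s -> s <= T ->
  test_bound M K (translate k j s r) (translate k j.+1 s r).
Proof.
move=> k4 rr; have [K K0 H] := translate_bound j T M k4 rr.
have [K' K'0 H'] := translate_bound j.+1 T M k4 rr.
exists (K + K'); first by rewrite addr_ge0.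
move=> s s0 sT; split; try exact: measurable_translate.
- by move=> x xM; have [A _] := H s x x s0 sT xM xM; apply: le_trans A _; rewrite lerDl.
- by move=> x xM; have [A _] := H' s x x s0 sT xM xM; apply: le_trans A _; rewrite lerDr.
- move=> x y xM yM; have [_ A] := H s x y s0 sT xM yM; apply: le_trans A _.
  by rewrite ler_wpM2r ?sqr_ge0// lerDl.
Qed.

Lemma translate_hder k j t r x : (k < 4)%N -> rschwartz r -> 0 <= t ->
  hder (fun s => translate k j s r x) t (translate k.+1 j t r x).
Proof.
move=> k4 rr t0; apply: null_derive => //.
by apply: rschwartz_shift; exact: rschwartz_derive1n.
Qed.

Lemma translate_equation s r x j : rschwartz r -> 0 <= s ->
  telegraph_sum_form (fun k i => translate k (j + i) s r x) = 0.
Proof.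
move=> rr s0.
have rx : rschwartz (fun y => r^`(j) (y + x)).
  by apply: rschwartz_shift; exact: rschwartz_derive1n.
have := null_equation0 rx s0; rewrite /translate.
have [rs _] : rsmooth r^`(j) /\ True.
  by split=> //; have [m []] := rschwartz_derive1n j rr.
have [_ E] := derive1n_shift x rs.
by rewrite /telegraph_sum_form !E !derive1n_derive1n.
Qed.

Lemma translate_lipschitz k j T M r : (k <= 4)%N -> rschwartz r -> exists2 K : R, 0 <= K &
  forall s t x, 0 <= s -> s <= T -> 0 <= t -> t <= T -> `|x| <= M ->
  `|translate k j t r x - translate k j s r x| <= K * `|t - s|.
Proof.
have lt4 i n : (i < 4)%N -> rschwartz r -> exists2 K : R, 0 <= K &
    forall s t x, 0 <= s -> s <= T -> 0 <= t -> t <= T -> `|x| <= M ->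
    `|translate i n t r x - translate i n s r x| <= K * `|t - s|.
  move=> i4 rr; have [K K0 H] := translate_bound n T M i4 rr; exists K => // s t x s0 sT t0 tT xM.
  apply: (@hder_mvt2 _ (fun s => translate i n s r x) (fun s => translate i.+1 n s r x) K T) => //.
    by move=> u u0; exact: translate_hder.
  by move=> u u0 uT; have [] := H u x x u0 uT xM xM.
(* For k = 4 there is no fifth time derivative to bound. The equation expresses the fourth one
   through lower ones with more x-derivatives, which are Lipschitz by [lt4]. *)
rewrite leq_eqVlt => /predU1P[->|k4]; last exact: lt4.
move=> rr.
have [K3 K30 L3] := lt4 3%N j isT rr; have [K2 K20 L2] := lt4 2%N j isT rr.
have [K22 K220 L22] := lt4 2%N (j + 2)%N isT rr; have [K1 K10 L1] := lt4 1%N j isT rr.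
have [K12 K120 L12] := lt4 1%N (j + 2)%N isT rr; have [K02 K020 L02] := lt4 0%N (j + 2)%N isT rr.
have [K04 K040 L04] := lt4 0%N (j + 4)%N isT rr.
have [q3 [q2 [q22 [q1 [q12 [q02 [q04 E]]]]]]] : exists q3 q2 q22 q1 q12 q02 q04 : R,
   forall X, telegraph_sum_form X = X 4%N 0%N + q3 * X 3%N 0%N + q2 * X 2%N 0%N +
     q22 * X 2%N 2%N + q1 * X 1%N 0%N + q12 * X 1%N 2%N + q02 * X 0%N 2%N + q04 * X 0%N 4%N.
  by do 7!eexists; move=> X; rewrite /telegraph_sum_form -!mulNr.
exists (`|q3| * K3 + `|q2| * K2 + `|q22| * K22 + `|q1| * K1 + `|q12| * K12 + `|q02| * K02 + `|q04| * K04).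
  by rewrite !addr_ge0// mulr_ge0.
move=> s t x s0 sT t0 tT xM.
have := translate_equation x j rr t0; have := translate_equation x j rr s0.
rewrite !E !addn0.
set S4 := translate 4 j s r x; set T4 := translate 4 j t r x => ES ET.
have -> : T4 - S4 = - (q3 * (translate 3 j t r x - translate 3 j s r x) +
  q2 * (translate 2 j t r x - translate 2 j s r x) +
  q22 * (translate 2 (j + 2) t r x - translate 2 (j + 2) s r x) +
  q1 * (translate 1 j t r x - translate 1 j s r x) +
  q12 * (translate 1 (j + 2) t r x - translate 1 (j + 2) s r x) +
  q02 * (translate 0 (j + 2) t r x - translate 0 (j + 2) s r x) +
  q04 * (translate 0 (j + 4) t r x - translate 0 (j + 4) s r x)).
  apply/eqP; rewrite -addr_eq0; apply/eqP; rewrite -[RHS](subrr 0) -{1}ET -ES; ring.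
rewrite normrN 6!mulrDl.
have tr (q K u v : R) : `|u - v| <= K * `|t - s| -> `|q * (u - v)| <= `|q| * K * `|t - s|.
  by move=> H; rewrite normrM -mulrA ler_wpM2l.
repeat (apply: le_trans (ler_normD _ _) _; apply: lerD; last by apply: tr; auto).
by apply: tr; auto.
Qed.

Lemma translate_time_taylor k j T M r : (k < 4)%N -> rschwartz r -> exists2 K : R, 0 <= K &
  forall s h x, 0 <= s -> 0 <= h -> s + h <= T -> `|x| <= M ->
  `|translate k j (s + h) r x - translate k j s r x - h * translate k.+1 j s r x| <= K * h ^+ 2.
Proof.
move=> k4 rr; have [K K0 L] := translate_lipschitz j T M k4 rr.
exists K => // s h x s0 h0 shT xM.
have sT : s <= T by apply: le_trans shT; rewrite lerDl.
(* Subtracting the tangent slope leaves a derivative of size at most K |u - s|, so the mean value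
   bound is quadratic. *)
pose f u := translate k j u r x - translate k.+1 j s r x * u.
pose g u := translate k.+1 j u r x - translate k.+1 j s r x * 1.
have idd u : hder (fun v : R => v) u 1.
  by move=> e e0; exists 1 => // v _ _; rewrite mul1r subrr normr0 mulr_ge0// ltW.
have fg u : 0 <= u -> hder f u (g u).
  by move=> u0; apply: hderB; [exact: translate_hder|apply: hderZ].
have := @hder_mvt _ f g s (s + h) (K * h) s0.
rewrite lerDl => /(_ h0); have -> : s + h - s = h by ring.
have -> : f (s + h) - f s = translate k j (s + h) r x - translate k j s r x - h * translate k.+1 j s r x.
  by rewrite /f; ring.
rewrite expr2 mulrA; apply.
- by move=> t t0; exact: hder_hcont (fg t t0).
- by move=> t t0; apply: fg; exact: ltW.
- move=> t st tsh; rewrite /g mulr1.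
  have t0 : 0 <= t by apply: le_trans (ltW st).
  have tT : t <= T by apply: le_trans (ltW tsh) shT.
  apply: le_trans (L s t x s0 sT t0 tT xM) _.
  by rewrite ler_wpM2l// ger0_norm; lra.
Qed.

End NullSolution.
End TelegraphSumOperator.

(** * Algebra of the conserved bilinear form *)

Section DualForm.
Context {R : realType}.
Variables c1 c2 l1 l2 : R.
Implicit Types X Y : nat -> nat -> bool -> bool -> R.

(* The generator of (position, velocity signs), acting on the values [X k j a b]
   of E[V1^a V2^b d_t^k d_x^j f(X1 + X2)] with unit velocities V1, V2. *)
Definition generator X k j (a b : bool) : R :=
  - 2 * (a%:R * l1 + b%:R * l2) * X k j a b + c1 * X k j.+1 (~~ a) b + c2 * X k j.+1 a (~~ b).

Definition shifted_dt X k j (a b : bool) : R := X k.+1 j a b + (l1 + l2) * X k j a b.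

(* With Y_i = (d_t + l_i) Y for each factor, the four products of the
   solutions of the two telegraph equations and their shifted derivatives. *)
Definition prod00 X k j : R := X k j false false.
Definition prod10 X k j : R := l1 * X k j false false + c1 * X k j.+1 true false.
Definition prod01 X k j : R := l2 * X k j false false + c2 * X k j.+1 false true.
Definition prod11 X k j : R := l1 * l2 * X k j false false + l1 * c2 * X k j.+1 false true +
  l2 * c1 * X k j.+1 true false + c1 * c2 * X k j.+2 true true.

(** Put D = d_t + l1 + l2 and a_i = l_i^2 + c_i^2 d_x^2. The fourth-order operator is D^4 - 2 (a1 +
    a2) D^2 + (a1 - a2)^2; the two symbols are a1 + a2 and a1 - a2. *)
Definition sum_symbol (Y : nat -> R) j : R :=
  (l1 ^+ 2 + l2 ^+ 2) * Y j + (c1 ^+ 2 + c2 ^+ 2) * Y j.+2.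
Definition diff_symbol (Y : nat -> R) j : R :=
  (l1 ^+ 2 - l2 ^+ 2) * Y j + (c1 ^+ 2 - c2 ^+ 2) * Y j.+2.

(* The conserved bilinear pairing between a solution of the fourth-order
   equation and the dual solution E[D1 D2 phi(X1 + X2)]. *)
Definition dual_form X : R :=
  diff_symbol (prod01 X 0%N) 0 - diff_symbol (prod10 X 0%N) 0 +
  (2 * prod11 (shifted_dt X) 0 0 - sum_symbol (prod00 (shifted_dt X) 0%N) 0) +
  (prod10 (shifted_dt (shifted_dt X)) 0 0 + prod01 (shifted_dt (shifted_dt X)) 0 0) +
  prod00 (shifted_dt (shifted_dt (shifted_dt X))) 0 0.

Ltac unfold_dual := rewrite /dual_form /sum_symbol /diff_symbol /prod00 /prod01 /prod10 /prod11
  /shifted_dt /generator.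

(** The difference of the two sides is, identically in X, the fourth-order equation itself. *)
Lemma dual_form_conserved X :
  telegraph_sum_form c1 c2 l1 l2 (fun k j => X k j false false) = 0 ->
  dual_form (fun k => X k.+1) = dual_form (generator X).
Proof.
rewrite /telegraph_sum_form => E; apply/eqP; rewrite -subr_eq0 -E; apply/eqP.
unfold_dual => /=; ring.
Qed.

Lemma dual_form_lin (q : R) X Y :
  dual_form (fun k j a b => q * X k j a b + Y k j a b) = q * dual_form X + dual_form Y.
Proof. by unfold_dual; ring. Qed.

(** Only [prod11] reads the component a = b = 1, through its term c1 c2 d_x^2, and it occurs once,
    doubled and under [shifted_dt]. *)
Lemma dual_form_initial (f : nat -> nat -> R) :
  dual_form (fun k j a b => (a && b)%:R * f k j) =
  2 * (c1 * c2) * (f 1%N 2%N + (l1 + l2) * f 0%N 2%N).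
Proof. by unfold_dual => /=; ring. Qed.

Lemma dual_form_eq0 X : (forall k j a b, (k < 4)%N -> X k j a b = 0) -> dual_form X = 0.
Proof. by move=> X0; unfold_dual; rewrite !X0//; ring. Qed.

Lemma dual_form_bound : exists2 C : R, 0 <= C & forall X (e : R),
  (forall k j a b, (k < 4)%N -> (j < 5)%N -> `|X k j a b| <= e) -> `|dual_form X| <= C * e.
Proof.
pose bnd (F : (nat -> nat -> bool -> bool -> R) -> R) := exists2 C : R, 0 <= C & forall X (e : R),
  (forall k j a b, (k < 4)%N -> (j < 5)%N -> `|X k j a b| <= e) -> `|F X| <= C * e.
have bX k j a b : (k < 4)%N -> (j < 5)%N -> bnd (fun X => X k j a b).
  by move=> k4 j5; exists 1 => // X e H; rewrite mul1r; exact: H.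
have bD F G : bnd F -> bnd G -> bnd (fun X => F X + G X).
  move=> [C C0 HF] [C' C'0 HG]; exists (C + C'); first exact: addr_ge0.
  by move=> X e H; apply: le_trans (ler_normD _ _) _; rewrite mulrDl lerD ?HF ?HG.
have bN F : bnd F -> bnd (fun X => - F X).
  by move=> [C C0 HF]; exists C => // X e H; rewrite normrN HF.
have bZ (q : R) F : bnd F -> bnd (fun X => q * F X).
  move=> [C C0 HF]; exists (`|q| * C); first exact: mulr_ge0.
  by move=> X e H; rewrite normrM -mulrA ler_wpM2l ?HF.
suff : bnd (fun X => dual_form X) by [].
unfold_dual; cbv beta.
by repeat first [apply bD|apply bN|apply bZ|exact: bX].
Qed.

End DualForm.

(** * The duality argument and vanishing of null solutions *)

Section Duality.
Context d (Omega : measurableType d) (R : realType) (P : probability Omega R).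
Variables (c1 c2 l1 l2 x1 x2 : R) (D1 D2 : {RV P >-> R}) (N1 N2 : R -> {RV P >-> nat})
  (X1 X2 : R -> {RV P >-> R}).
Hypotheses (c10 : c1 != 0) (c20 : c2 != 0) (l10 : 0 <= l1) (l20 : 0 <= l2).
Hypotheses (H1 : telegraph_process c1 l1 x1 D1 N1 X1)
  (H2 : telegraph_process c2 l2 x2 D2 N2 X2).
Hypothesis HI : mutually_independent P (fun i : 'I_4 =>
    nth set0 [:: sigma_rv D1; sigma_process N1; sigma_rv D2; sigma_process N2] i).
Variable a : nat -> R -> (R -> R) -> R.
Hypothesis Ha : null_solution c1 c2 l1 l2 a.

Local Notation moment := (moment D1 D2 N1 N2 X1 X2).
Local Notation range_bound := (range_bound c1 c2 x1 x2).

Section FixedTest.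
Variables (r : R -> R) (T : R).
Hypotheses (rr : rschwartz r) (T0 : 0 <= T).

Let M := range_bound T.
Let F k j s := translate a k j s r.

(** The time s of the null solution and the time t of the dual solution are kept separate; the
    pairing runs along t = T - s. *)
Let X s t : nat -> nat -> bool -> bool -> R := fun k j b1 b2 => moment true b1 b2 t (F k j s).

Let range_le t : t <= T -> range_bound t <= M.
Proof. exact: range_bound_le. Qed.

Let bF k j s : (k <= 4)%N -> 0 <= s -> s <= T -> bounded_test M (F k j s).
Proof.
move=> k4 s0 sT; have [K _ /(_ s s0 sT)[mF _ FK _ _]] := translate_test_bound Ha j T M k4 rr.
by split=> //; exists K.
Qed.

Let equation_moment s t : 0 <= s -> s <= T -> 0 <= t -> t <= T ->
  telegraph_sum_form c1 c2 l1 l2 (fun k j => X s t k j false false) = 0.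
Proof.
move=> s0 sT t0 tT; have tM := range_le tT.
rewrite -[RHS](moment_cst0 D1 D2 N1 N2 X1 X2 true false false t).
rewrite [in RHS](_ : (fun=> 0) = (fun x => telegraph_sum_form c1 c2 l1 l2 (fun k j => F k j s x))); last first.
  by apply/funext => x; have := translate_equation Ha x 0 rr s0.
(* Nested form q * f + g, so that [moment_lin] carries the pointwise equation under the expectation
   term by term. *)
have [q3 [q2 [q22 [q1 [q12 [q02 [q04 E]]]]]]] : exists q3 q2 q22 q1 q12 q02 q04 : R,
   forall Y, telegraph_sum_form c1 c2 l1 l2 Y = q3 * Y 3%N 0%N + (q2 * Y 2%N 0%N +
     (q22 * Y 2%N 2%N + (q1 * Y 1%N 0%N + (q12 * Y 1%N 2%N + (q02 * Y 0%N 2%N + (q04 * Y 0%N 4%N + Y 4%N 0%N)))))).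
  exists (4 * (l1 + l2)), (5 * (l1 + l2) ^+ 2 - (l1 - l2) ^+ 2), (- (2 * (c1 ^+ 2 + c2 ^+ 2))),
    (2 * (l1 + l2) * ((l1 + l2) ^+ 2 - (l1 - l2) ^+ 2)), (- (4 * (l1 + l2) * (c1 ^+ 2 + c2 ^+ 2))),
    (2 * (c1 ^+ 2 - c2 ^+ 2) * (l1 ^+ 2 - l2 ^+ 2) - 2 * (l1 + l2) ^+ 2 * (c1 ^+ 2 + c2 ^+ 2)),
    ((c1 ^+ 2 - c2 ^+ 2) ^+ 2) => Y.
  by rewrite /telegraph_sum_form; ring.
rewrite E; rewrite [in RHS](_ : (fun x => _) = (fun x => q3 * F 3 0 s x + (q2 * F 2 0 s x +
   (q22 * F 2 2 s x + (q1 * F 1 0 s x + (q12 * F 1 2 s x + (q02 * F 0 2 s x + (q04 * F 0 4 s x +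
   F 4 0 s x)))))))); last by apply/funext => x; rewrite E.
have L q f g := @moment_lin _ _ _ P c1 c2 l1 l2 x1 x2 D1 D2 N1 N2 X1 X2 H1 H2 true false false t M q f g t0 tM.
rewrite !L; try by repeat first [apply: bounded_test_lin|apply: bF].
Qed.

(* [X s (T - s)] evolves in s by d_t minus the generator; [dual_form] is
   invariant under that flow. *)
Let dual_step : exists C : R, forall s h, 0 <= s -> 0 <= h -> s + h <= T ->
  `|dual_form c1 c2 l1 l2 (X (s + h) (T - (s + h))) - dual_form c1 c2 l1 l2 (X s (T - s))| <= C * h ^+ 2.
Proof.
(* Both expansions are taken at the corner (s, T - (s + h)): one moves w forward to s + h, the other
   moves the dual solution up to T - s, whence the minus sign of the generator. *)
have step k j : (k < 4)%N -> exists2 C : R, 0 <= C & forall b1 b2 s h, 0 <= s -> 0 <= h -> s + h <= T ->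
  `|X (s + h) (T - (s + h)) k j b1 b2 - X s (T - s) k j b1 b2 -
   h * (X s (T - (s + h)) k.+1 j b1 b2 - generator c1 c2 l1 l2 (X s (T - (s + h))) k j b1 b2)| <= C * h ^+ 2.
  move=> k4; have [K K0 FK] := translate_test_bound Ha j T M (ltnW k4) rr.
  have [C C0 HC] := moment_step l10 l20 H1 H2 HI K T0 (lexx M).
  have [K' K'0 HK'] := translate_time_taylor Ha j T M k4 rr.
  exists (K' + C); first exact: addr_ge0.
  move=> b1 b2 s h s0 h0 shT; set t := T - (s + h).
  have sT : s <= T by apply: le_trans shT; rewrite lerDl.
  have t0 : 0 <= t by rewrite subr_ge0.
  have tT : t <= T by rewrite /t; lra.
  have th : T - s = t + h by rewrite /t; ring.
  have tM := range_le tT.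
  have thT : t + h <= T by rewrite /t; lra.
  have sh0 : 0 <= s + h by rewrite addr_ge0.
  have A := HC _ _ true b1 b2 t h (FK s s0 sT) t0 h0 thT.
  pose rem x := F k j (s + h) x - F k j s x - h * F k.+1 j s x.
  have remE : rem = (fun x => - h * F k.+1 j s x + (-1 * F k j s x + F k j (s + h) x)).
    by apply/funext => x; rewrite /rem; ring.
  have b0 := bF j (ltnW k4) s0 sT; have b1' := bF j k4 s0 sT; have bsh := bF j (ltnW k4) sh0 shT.
  have remM : moment true b1 b2 t rem = X (s + h) t k j b1 b2 - X s t k j b1 b2 - h * X s t k.+1 j b1 b2.
    rewrite remE (moment_lin H1 H2 _ _ _ _ t0 tM)//; last exact: bounded_test_lin.
    by rewrite (moment_lin H1 H2 _ _ _ _ t0 tM)// /X; ring.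
  have B : `|moment true b1 b2 t rem| <= K' * h ^+ 2.
    apply: (moment_bound H1 H2 _ _ _ t0 tM).
      have [] : bounded_test M rem by rewrite remE; do 2!apply: bounded_test_lin => //.
      by [].
    by move=> x xM; exact: HK'.
  rewrite th.
  have -> : X (s + h) t k j b1 b2 - X s (t + h) k j b1 b2 -
     h * (X s t k.+1 j b1 b2 - generator c1 c2 l1 l2 (X s t) k j b1 b2) =
    moment true b1 b2 t rem - (X s (t + h) k j b1 b2 - X s t k j b1 b2 -
     h * generator c1 c2 l1 l2 (X s t) k j b1 b2) by rewrite remM; ring.
  by apply: le_trans (ler_normB _ _) _; rewrite mulrDl lerD.
have [C0 C00 HC0] : exists2 C : R, 0 <= C & forall k j b1 b2 s h, (k < 4)%N -> (j < 5)%N ->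
   0 <= s -> 0 <= h -> s + h <= T ->
  `|X (s + h) (T - (s + h)) k j b1 b2 - X s (T - s) k j b1 b2 -
   h * (X s (T - (s + h)) k.+1 j b1 b2 - generator c1 c2 l1 l2 (X s (T - (s + h))) k j b1 b2)| <= C * h ^+ 2.
  (* The index range k < 4, j < 5 required by [dual_form_bound] is finite; summing the individual
     constants gives a common one. *)
  have ex (p : 'I_4 * 'I_5) : exists C : R, 0 <= C /\ forall b1 b2 s h, 0 <= s -> 0 <= h -> s + h <= T ->
    `|X (s + h) (T - (s + h)) p.1 p.2 b1 b2 - X s (T - s) p.1 p.2 b1 b2 -
     h * (X s (T - (s + h)) p.1.+1 p.2 b1 b2 - generator c1 c2 l1 l2 (X s (T - (s + h))) p.1 p.2 b1 b2)| <= C * h ^+ 2.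
    by have [C C0 HC] := step p.1 p.2 (ltn_ord _); exists C.
  have [C HC] := choice ex.
  exists (\sum_p C p); first by apply: sumr_ge0 => p _; case: (HC p).
  move=> k j b1 b2 s h k4 j5 s0 h0 shT; have [_ H] := HC (Ordinal k4, Ordinal j5).
  apply: le_trans (H b1 b2 s h s0 h0 shT) _; rewrite ler_wpM2r ?sqr_ge0//.
  rewrite (bigD1 (Ordinal k4, Ordinal j5))//= lerDl.
  by apply: sumr_ge0 => p _; case: (HC p).
have [C1 C10 HC1] := dual_form_bound c1 c2 l1 l2.
exists (C1 * C0) => s h s0 h0 shT; set t := T - (s + h).
have sT : s <= T by apply: le_trans shT; rewrite lerDl.
have t0 : 0 <= t by rewrite subr_ge0.
have tT : t <= T by rewrite /t; lra.
pose Y k j b1 b2 := X (s + h) t k j b1 b2 - X s (T - s) k j b1 b2 -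
   h * (X s t k.+1 j b1 b2 - generator c1 c2 l1 l2 (X s t) k j b1 b2).
(* By linearity the first-order part of Y contributes a difference that [dual_form_conserved]
   cancels. *)
have -> : dual_form c1 c2 l1 l2 (X (s + h) t) - dual_form c1 c2 l1 l2 (X s (T - s)) =
  dual_form c1 c2 l1 l2 Y.
  have -> : Y = (fun k j b1 b2 => - h * (X s t k.+1 j b1 b2) +
     (h * (generator c1 c2 l1 l2 (X s t) k j b1 b2) + (-1 * (X s (T - s) k j b1 b2) + X (s + h) t k j b1 b2))).
    by do 4!apply/funext => ?; rewrite /Y; ring.
  rewrite (dual_form_lin c1 c2 l1 l2 (- h) (fun k => X s t k.+1)).
  rewrite (dual_form_lin c1 c2 l1 l2 h (generator c1 c2 l1 l2 (X s t))).
  rewrite (dual_form_lin c1 c2 l1 l2 (-1) (X s (T - s))).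
  by rewrite (dual_form_conserved (equation_moment s0 sT t0 tT)); ring.
rewrite -mulrA; apply: HC1 => k j b1 b2 k4 j5; exact: HC0.
Qed.

Lemma dual_form_vanishes :
  translate a 1 2 T r (x1 + x2) + (l1 + l2) * translate a 0 2 T r (x1 + x2) = 0.
Proof.
have [C HC] := dual_step.
have := @quadratic_cst _ (fun s => dual_form c1 c2 l1 l2 (X s (T - s))) C T.
move=> /(_ _ T0); rewrite subrr subr0.
have -> : dual_form c1 c2 l1 l2 (X T 0) =
  2 * (c1 * c2) * (translate a 1 2 T r (x1 + x2) + (l1 + l2) * translate a 0 2 T r (x1 + x2)).
  rewrite -(dual_form_initial c1 c2 l1 l2 (fun k j => F k j T (x1 + x2))).
  congr (dual_form _ _ _ _ _); do 4!apply/funext => ?.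
  by rewrite /X (moment0 H1 H2 HI) eq_sym eqb_id eq_sym eqb_id.
have -> : dual_form c1 c2 l1 l2 (X 0 T) = 0.
  apply: dual_form_eq0 => k j b1 b2 k4.
  rewrite /X -[RHS](moment_cst0 D1 D2 N1 N2 X1 X2 true b1 b2 T); congr (moment _ _ _ _ _).
  apply/funext => x; rewrite /F /translate; apply: (null_initial Ha) => //.
  by apply: rschwartz_shift; exact: rschwartz_derive1n.
move=> H; have {}H : 2 * (c1 * c2) * (translate a 1 2 T r (x1 + x2) +
   (l1 + l2) * translate a 0 2 T r (x1 + x2)) = 0.
  apply: H => s t s0 st tT.
  have := HC s (t - s) s0; have -> : s + (t - s) = t by ring.
  by rewrite subr_ge0; apply.
by move/eqP: H; rewrite mulf_eq0 mulf_eq0 mulf_eq0 (negPf c10) (negPf c20) pnatr_eq0/= => /eqP.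
Qed.

End FixedTest.

(** [dual_form_vanishes] tests at the starting point x1 + x2; translating r by its opposite
    recentres the result. *)
Lemma null_second_derivative r t : rschwartz r -> 0 <= t ->
  a 1%N t r^`(2) + (l1 + l2) * a 0%N t r^`(2) = 0.
Proof.
move=> rr t0.
have rs := rschwartz_shift (- (x1 + x2)) rr.
have := dual_form_vanishes rs t0; rewrite /translate.
have [_ E] : rsmooth r /\ forall k, (fun x => r (x - (x1 + x2)))^`(k) = (fun x => r^`(k) (x - (x1 + x2))).
  have [m [rsm _]] := rr; split=> //.
  by have [] := derive1n_shift (- (x1 + x2)) rsm.
rewrite E; have -> // : (fun y => r^`(2) (y + (x1 + x2) - (x1 + x2))) = r^`(2).
by apply/funext => y; rewrite addrK.
Qed.

Theorem null_solution_eq0 r t : rschwartz r -> 0 <= t -> a 0%N t r = 0.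
Proof.
move=> rr.
have r2 := rschwartz_derive1n 2 rr; have r4 := rschwartz_derive1n 4 rr.
have z0 s t' : rschwartz s -> 0 <= t' -> a 0%N t' s^`(2) = 0.
  move=> ss; apply: (@hder_exp_unique _ (fun u => a 0%N u s^`(2)) (l1 + l2)) => [u u0|].
    have -> : - (l1 + l2) * a 0%N u s^`(2) = a 1%N u s^`(2).
      by have := null_second_derivative ss u0; lra.
    exact: (null_derive Ha (k := 0%N) isT (rschwartz_derive1n 2 ss) u0).
  exact: (null_initial Ha (k := 0%N) isT (rschwartz_derive1n 2 ss)).
have z1 t' : 0 <= t' -> a 1%N t' r^`(2) = 0.
  by move=> t0; have := null_second_derivative rr t0; rewrite z0// mulr0 addr0.
have z2 t' : 0 <= t' -> a 2%N t' r^`(2) = 0.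
  move=> t0; apply: (hder_unique t0 (null_derive Ha (k := 1%N) isT r2 t0)).
  apply: (hder_ext t0 _ (@hder_cst _ 0 t')) => s s0.
  by rewrite z1.
have z04 t' : 0 <= t' -> a 0%N t' r^`(4) = 0.
  by move=> t0; have := z0 _ _ r2 t0; rewrite derive1n_derive1n.
(* What is left of the equation is d_t (d_t + 2(l1+l2)) (d_t + 2 l1) (d_t + 2 l2). *)
have eq t' : 0 <= t' -> a 4%N t' r + 4 * (l1 + l2) * a 3%N t' r +
    (5 * (l1 + l2) ^+ 2 - (l1 - l2) ^+ 2) * a 2%N t' r +
    2 * (l1 + l2) * ((l1 + l2) ^+ 2 - (l1 - l2) ^+ 2) * a 1%N t' r = 0.
  move=> t0; have := null_equation0 Ha rr t0.
  by rewrite /telegraph_sum_form z0// z1// z2// z04// !mulr0 !subr0 !addr0.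
have dr k t' : (k < 4)%N -> 0 <= t' -> hder (fun s => a k s r) t' (a k.+1 t' r).
  by move=> k4; exact: (null_derive Ha).
have i0 k : (k < 4)%N -> a k 0 r = 0 by move=> k4; exact: (null_initial Ha).
(* The factors are peeled off one at a time: [g3] is what remains after d_t, [g2] after d_t + 2 (l1
   + l2), [g1] after d_t + 2 l1. Each solves a first-order equation with zero datum. *)
pose g3 t := a 3%N t r + (4 * (l1 + l2) * a 2%N t r + ((5 * (l1 + l2) ^+ 2 - (l1 - l2) ^+ 2) * a 1%N t r +
   2 * (l1 + l2) * ((l1 + l2) ^+ 2 - (l1 - l2) ^+ 2) * a 0%N t r)).
have g30 t' : 0 <= t' -> g3 t' = 0.
  move=> t0; rewrite (@hder0_cst _ g3 _ t')//; first by rewrite /g3 !i0//; ring.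
  move=> s s0; rewrite -(eq s s0) -!addrA.
  by do ![apply: hderD|apply: hderZ|apply: dr].
pose g2 t := a 2%N t r + (2 * (l1 + l2) * a 1%N t r + 4 * l1 * l2 * a 0%N t r).
have g20 t' : 0 <= t' -> g2 t' = 0.
  apply: (@hder_exp_unique _ g2 (2 * (l1 + l2))); last by rewrite /g2 !i0//; ring.
  move=> s s0.
  have -> : - (2 * (l1 + l2)) * g2 s = a 3%N s r + (2 * (l1 + l2) * a 2%N s r + 4 * l1 * l2 * a 1%N s r).
    by apply/eqP; rewrite eq_sym -subr_eq0; apply/eqP; rewrite -(g30 s s0) /g2 /g3; ring.
  by do ![apply: hderD|apply: hderZ|apply: dr].
pose g1 t := a 1%N t r + 2 * l2 * a 0%N t r.
have g10 t' : 0 <= t' -> g1 t' = 0.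
  apply: (@hder_exp_unique _ g1 (2 * l1)); last by rewrite /g1 !i0//; ring.
  move=> s s0.
  have -> : - (2 * l1) * g1 s = a 2%N s r + 2 * l2 * a 1%N s r.
    by apply/eqP; rewrite eq_sym -subr_eq0; apply/eqP; rewrite -(g20 s s0) /g2 /g1; ring.
  by do ![apply: hderD|apply: hderZ|apply: dr].
apply: (@hder_exp_unique _ (fun t => a 0%N t r) (2 * l2)); last exact: i0.
move=> s s0; have -> : - (2 * l2) * a 0%N s r = a 1%N s r.
  by apply/eqP; rewrite eq_sym -subr_eq0; apply/eqP; rewrite -(g10 s s0) /g1; ring.
exact: dr.
Qed.

End Duality.

(** * Existence *)

Section MomentEvolution.
Context d (Omega : measurableType d) (R : realType) (P : probability Omega R).
Variables (c1 c2 l1 l2 x1 x2 : R) (D1 D2 : {RV P >-> R}) (N1 N2 : R -> {RV P >-> nat})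
  (X1 X2 : R -> {RV P >-> R}).
Hypotheses (l10 : 0 <= l1) (l20 : 0 <= l2).
Hypotheses (H1 : telegraph_process c1 l1 x1 D1 N1 X1)
  (H2 : telegraph_process c2 l2 x2 D2 N2 X2).
Hypothesis HI : mutually_independent P (fun i : 'I_4 =>
    nth set0 [:: sigma_rv D1; sigma_process N1; sigma_rv D2; sigma_process N2] i).

Local Notation moment := (moment D1 D2 N1 N2 X1 X2).
Local Notation range_bound := (range_bound c1 c2 x1 x2).
Local Notation generator_moment := (generator_moment c1 c2 l1 l2 D1 D2 N1 N2 X1 X2).

Lemma moment_lipschitz T K : 0 <= T -> exists2 L, 0 <= L &
  forall (psi psi1 : R -> R) (e a b : bool) (s t : R),
  test_bound (range_bound T) K psi psi1 -> 0 <= s -> s <= t -> t <= T ->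
  `|moment e a b t psi - moment e a b s psi| <= L * (t - s).
Proof.
move=> T0; have [C C0 HC] := moment_step l10 l20 H1 H2 HI K T0 (lexx _).
exists (C * T + (2 * (l1 + l2) + `|c1| + `|c2|) * `|K|).
  by rewrite addr_ge0 ?mulr_ge0// !addr_ge0// mulr_ge0// addr_ge0.
move=> psi psi1 e a b s t psib s0 st tT.
have ts0 : 0 <= t - s by rewrite subr_ge0.
have := HC psi psi1 e a b s (t - s) psib s0 ts0; have -> : s + (t - s) = t by ring.
move=> /(_ tT) A.
have sM : range_bound s <= range_bound T by apply: range_bound_le; exact: le_trans tT.
have [mpsi mpsi1 psiK psi1K _] := psib.
have B1 := moment_bound H1 H2 e a b s0 sM mpsi psiK.
have B2 := moment_bound H1 H2 e (~~ a) b s0 sM mpsi1 psi1K.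
have B3 := moment_bound H1 H2 e a (~~ b) s0 sM mpsi1 psi1K.
have G : `|generator_moment e a b s psi psi1| <= (2 * (l1 + l2) + `|c1| + `|c2|) * `|K|.
  have KK := ler_norm K.
  have -> : (2 * (l1 + l2) + `|c1| + `|c2|) * `|K| =
    2 * (l1 + l2) * `|K| + `|c1| * `|K| + `|c2| * `|K| by ring.
  rewrite /generator_moment; apply: le_trans (ler_normD _ _) _.
  rewrite lerD//; last by rewrite normrM ler_wpM2l// (le_trans B3).
  apply: le_trans (ler_normD _ _) _.
  rewrite lerD//; last by rewrite normrM ler_wpM2l// (le_trans B2).
  rewrite normrM ler_pM//; last by rewrite (le_trans B1).
  rewrite normrM normrN normr_nat ler_wpM2l// ger0_norm; last by rewrite addr_ge0 ?mulr_ge0.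
  by rewrite lerD// ler_piMl//; case: (a); case: (b).
have -> : moment e a b t psi - moment e a b s psi =
  (moment e a b t psi - moment e a b s psi - (t - s) * generator_moment e a b s psi psi1) +
  (t - s) * generator_moment e a b s psi psi1 by ring.
apply: le_trans (ler_normD _ _) _; rewrite normrM (ger0_norm ts0) [X in _ <= X]mulrDl lerD//.
  apply: le_trans A _; rewrite expr2 mulrA ler_wpM2r// ler_wpM2l//; lra.
by rewrite mulrC ler_wpM2r.
Qed.

(** To the right of t this is [moment_step]. To the left, the step starts at s and yields the
    generator at s; moving it to t costs O((t - s)^2) by the Lipschitz bound, which is why [psi1]
    must be a test function too. *)
Lemma moment_hder psi psi1 psi2 e a b t : 0 <= t ->
  (forall M, exists K : R, test_bound M K psi psi1) ->
  (forall M, exists K : R, test_bound M K psi1 psi2) ->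
  hder (fun s => moment e a b s psi) t (generator_moment e a b t psi psi1).
Proof.
move=> t0 H H'; pose T := t + 1; have T0 : 0 <= T by rewrite /T; lra.
have [K HK] := H (range_bound T); have [K' HK'] := H' (range_bound T).
have [C C0 HC] := moment_step l10 l20 H1 H2 HI K T0 (lexx _).
have [L L0 HL] := moment_lipschitz K T0; have [L' L'0 HL'] := moment_lipschitz K' T0.
pose q := 2 * (l1 + l2) * L + `|c1| * L' + `|c2| * L'.
have q0 : 0 <= q by rewrite !addr_ge0// mulr_ge0// ?mulr_ge0// addr_ge0.
apply: (@hder_quadratic _ _ _ _ (C + q)); first exact: addr_ge0.
move=> s s0 sT.
have [ts|/ltW st] := leP t s.
  have st0 : 0 <= s - t by rewrite subr_ge0.
  have := HC _ _ e a b t (s - t) HK t0 st0; have -> : t + (s - t) = s by ring.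
  move=> /(_ sT); rewrite [(s - t) * generator_moment _ _ _ _ _ _]mulrC => A.
  by apply: le_trans A _; rewrite ler_wpM2r ?sqr_ge0// lerDl.
have ts0 : 0 <= t - s by rewrite subr_ge0.
have tT : t <= T by rewrite /T; lra.
have := HC _ _ e a b s (t - s) HK s0 ts0; have -> : s + (t - s) = t by ring.
move=> /(_ tT) A.
have G : `|generator_moment e a b t psi psi1 - generator_moment e a b s psi psi1| <= q * (t - s).
  have -> : generator_moment e a b t psi psi1 - generator_moment e a b s psi psi1 =
    - (2 * (a%:R * l1 + b%:R * l2)) * (moment e a b t psi - moment e a b s psi) +
    c1 * (moment e (~~ a) b t psi1 - moment e (~~ a) b s psi1) +
    c2 * (moment e a (~~ b) t psi1 - moment e a (~~ b) s psi1).
    by rewrite /generator_moment; ring.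
  have -> : q * (t - s) = 2 * (l1 + l2) * (L * (t - s)) + `|c1| * (L' * (t - s)) + `|c2| * (L' * (t - s)).
    by rewrite /q; ring.
  apply: le_trans (ler_normD _ _) _.
  rewrite lerD//; last by rewrite normrM ler_wpM2l//; exact: HL' HK' s0 st tT.
  apply: le_trans (ler_normD _ _) _.
  rewrite lerD//; last by rewrite normrM ler_wpM2l//; exact: HL' HK' s0 st tT.
  rewrite normrM ler_pM//; last exact: HL HK s0 st tT.
  rewrite normrN normrM normr_nat ler_wpM2l// ger0_norm; last by rewrite addr_ge0 ?mulr_ge0.
  by rewrite lerD// ler_piMl//; case: (a); case: (b).
have -> : moment e a b s psi - moment e a b t psi - generator_moment e a b t psi psi1 * (s - t) =
  - (moment e a b t psi - moment e a b s psi - (t - s) * generator_moment e a b s psi psi1) +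
  (t - s) * (generator_moment e a b t psi psi1 - generator_moment e a b s psi psi1) by ring.
have -> : (s - t) ^+ 2 = (t - s) ^+ 2 by ring.
apply: le_trans (ler_normD _ _) _; rewrite normrN [X in _ <= X]mulrDl lerD//.
by rewrite normrM (ger0_norm ts0) mulrC expr2 mulrA ler_wpM2r.
Qed.

Lemma rschwartz_test_bound (r : R -> R) j M : rschwartz r ->
  exists K : R, test_bound M K r^`(j) r^`(j.+1).
Proof.
move=> [m [rs rm]]; exists (m 0%N j + m 0%N j.+1 + m 0%N j.+2).
have B k x : `|r^`(k) x| <= m 0%N k by have := rm 0%N k x; rewrite expr0 mul1r.
have m0 k : 0 <= m 0%N k by apply: le_trans (B k 0).
have mr k : measurable_fun setT r^`(k).
  apply: continuous_measurable_fun; apply: is_derive_continuous => x; exact: rsmooth_is_derive.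
split=> //.
- by move=> x _; apply: le_trans (B _ _) _; rewrite -addrA lerDl addr_ge0.
- by move=> x _; apply: le_trans (B _ _) _; rewrite addrAC lerDr addr_ge0.
- move=> x y _ _; apply: le_trans (taylor1_bound (C := m 0%N j.+2) _ _ _) _.
  + by move=> z; exact: rsmooth_is_derive.
  + by move=> z; exact: rsmooth_is_derive.
  + by move=> z _; exact: B.
  + by rewrite ler_wpM2r ?sqr_ge0// lerDr addr_ge0.
Qed.

(* The time index is idle here: d_t acts on these values as [generator]. *)
Definition moments (r : R -> R) t : nat -> nat -> bool -> bool -> R :=
  fun _ j a b => moment false a b t r^`(j).

Definition moment_dt (r : R -> R) n t : R :=
  iter n (generator c1 c2 l1 l2) (moments r t) 0%N 0%N false false.

Lemma moments_hder r n k j a b t : rschwartz r -> 0 <= t ->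
  hder (fun s => iter n (generator c1 c2 l1 l2) (moments r s) k j a b) t
    (iter n.+1 (generator c1 c2 l1 l2) (moments r t) k j a b).
Proof.
move=> rr t0; elim: n k j a b => [|n IH] k j a b.
  apply: (@moment_hder r^`(j) r^`(j.+1) r^`(j.+2)) => // M; exact: rschwartz_test_bound.
exact: (hderD (hderD (hderZ _ (IH k j a b)) (hderZ c1 (IH k j.+1 (~~ a) b)))
  (hderZ c2 (IH k j.+1 a (~~ b)))).
Qed.

Lemma moment_dt_hder r n t : rschwartz r -> 0 <= t ->
  hder (moment_dt r n) t (moment_dt r n.+1 t).
Proof. by move=> rr t0; exact: moments_hder. Qed.

Lemma moment_dt_derive1n r j n t : moment_dt r^`(j) n t =
  iter n (generator c1 c2 l1 l2) (moments r t) 0%N j false false.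
Proof.
have E n' k i a b : iter n' (generator c1 c2 l1 l2) (moments r^`(j) t) k i a b =
    iter n' (generator c1 c2 l1 l2) (moments r t) k (j + i)%N a b.
  elim: n' k i a b => [|n' IH] k i a b; first by rewrite /= /moments derive1n_derive1n.
  by rewrite !iterS /generator !IH !addnS.
by rewrite /moment_dt E addn0.
Qed.

End MomentEvolution.

(** * Elimination as an algebraic identity *)

Section GeneratorAlgebra.
Context {R : realType}.
Variables c1 c2 l1 l2 : R.

(** Cayley-Hamilton: the generator is a 4 x 4 matrix over polynomials in d_x, and the fourth-order
    operator is its characteristic polynomial. No property of X enters. *)
Lemma generator_equation (X : nat -> nat -> bool -> bool -> R) :
  telegraph_sum_form c1 c2 l1 l2
    (fun k j => iter k (generator c1 c2 l1 l2) X 0%N j false false) = 0.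
Proof. by rewrite /telegraph_sum_form /= /generator/=; ring. Qed.

Lemma generator_initial (f : nat -> R) (X := fun _ j (a b : bool) => (~~ a && ~~ b)%:R * f j)
  (Y := fun n => iter n (generator c1 c2 l1 l2) X 0%N 0%N false false) :
  [/\ Y 0%N = f 0%N, Y 1%N = 0, Y 2%N = (c1 ^+ 2 + c2 ^+ 2) * f 2%N &
  Y 3%N = - (2 * (l1 * c1 ^+ 2 + l2 * c2 ^+ 2)) * f 2%N].
Proof. by rewrite /Y /X /= /generator/=; split; ring. Qed.

End GeneratorAlgebra.

Section MomentEquation.
Context d (Omega : measurableType d) (R : realType) (P : probability Omega R).
Variables (c1 c2 l1 l2 x1 x2 : R) (D1 D2 : {RV P >-> R}) (N1 N2 : R -> {RV P >-> nat})
  (X1 X2 : R -> {RV P >-> R}).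
Hypotheses (H1 : telegraph_process c1 l1 x1 D1 N1 X1)
  (H2 : telegraph_process c2 l2 x2 D2 N2 X2).
Hypothesis HI : mutually_independent P (fun i : 'I_4 =>
    nth set0 [:: sigma_rv D1; sigma_process N1; sigma_rv D2; sigma_process N2] i).
Local Notation moment_dt := (moment_dt c1 c2 l1 l2 D1 D2 N1 N2 X1 X2).

Lemma moment_dt_equation (r : R -> R) t :
  telegraph_sum_form c1 c2 l1 l2 (fun k j => moment_dt r^`(j) k t) = 0.
Proof.
rewrite -[RHS](generator_equation c1 c2 l1 l2 (moments D1 D2 N1 N2 X1 X2 r t)).
by congr telegraph_sum_form; apply/funext => k; apply/funext => j; exact: moment_dt_derive1n.
Qed.

Lemma moment_dt_initial (r : R -> R) :
  [/\ moment_dt r 0 0 = r (x1 + x2), moment_dt r 1 0 = 0,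
  moment_dt r 2 0 = (c1 ^+ 2 + c2 ^+ 2) * r^`(2) (x1 + x2) &
  moment_dt r 3 0 = - (2 * (l1 * c1 ^+ 2 + l2 * c2 ^+ 2)) * r^`(2) (x1 + x2)].
Proof.
have E : moments D1 D2 N1 N2 X1 X2 r 0 =
    (fun _ j (a b : bool) => (~~ a && ~~ b)%:R * r^`(j) (x1 + x2)).
  apply/funext => k; apply/funext => j; apply/funext => a; apply/funext => b.
  by rewrite /moments (moment0 H1 H2 HI); case: a; case: b.
rewrite /moment_dt E.
exact: (generator_initial c1 c2 l1 l2 (fun j => r^`(j) (x1 + x2))).
Qed.

End MomentEquation.

(** * Complex test functions and the fourth-order operator *)

Section ComplexParts.
Context {R : realType}.
Implicit Types (phi : R -> R[i]) (f : R -> R[i]) (z w : R[i]) (r : R -> R).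

(** One boolean index lets every statement about complex values be proved once for both real
    components. *)
Definition part (b : bool) z : R := if b then complex.Im z else complex.Re z.

Lemma partD b z w : part b (z + w) = part b z + part b w.
Proof. by case: b z w => -[? ?] [? ?]. Qed.

Lemma part0 b : part b (0 : R[i]) = 0.
Proof. by case: b. Qed.

Lemma partZ b (x : R) z : part b (real_complex R x * z) = x * part b z.
Proof. by case: b z => -[? ?] /=; ring. Qed.

Lemma part_inj z w : (forall b, part b z = part b w) -> z = w.
Proof. by move=> H; have := H true; have := H false; case: z {H} => ? ?; case: w => ? ? /= -> ->. Qed.

Lemma part_normc b z : `|part b z| <= Normc.normc z.
Proof.
case: b z => -[x y] /=; rewrite -sqrtr_sqr ler_wsqrtr//.
  by rewrite lerDr sqr_ge0.
by rewrite lerDl sqr_ge0.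
Qed.

Lemma normc_part z : Normc.normc z <= `|part false z| + `|part true z|.
Proof.
case: z => x y /=; rewrite -[X in _ <= X]ger0_norm ?addr_ge0// -sqrtr_sqr ler_wsqrtr//.
rewrite sqrrD !sqrnorm addrAC lerDl mulrn_wge0// mulr_ge0//.
Qed.

Lemma part_cderive b k phi : part b \o iter k cderive phi = derive1n k (part b \o phi).
Proof.
elim: k => // k IH; rewrite derive1nS -IH iterS.
by apply/funext => x; case: b {IH}.
Qed.

Lemma part_chderive b k f t : part b (iter k chderive f t) = iter k hderive (part b \o f) t.
Proof.
suff -> : iter k hderive (part b \o f) = part b \o iter k chderive f by [].
by elim: k => // k IH; rewrite !iterS IH; apply/funext => x; case: b {IH}.
Qed.

Lemma schwartzP phi : schwartz phi <-> forall b, rschwartz (part b \o phi).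
Proof.
split=> [[cs bd] b|H].
  have bd' (jk : nat * nat) : exists M : R, forall x, `|x| ^+ jk.1 * Normc.normc (iter jk.2 cderive phi x) <= M.
    exact: bd.
  have [m mP] := choice bd'; exists (fun j k => m (j, k)); split.
    move=> k x; rewrite -part_cderive; have [A B] := cs k x; by case: b.
  move=> j k x; rewrite -part_cderive; apply: le_trans (mP (j, k) x).
  by rewrite ler_wpM2l ?exprn_ge0// part_normc.
have [m [s0 b0]] := H false; have [m' [s1 b1]] := H true; split.
  move=> k x; split.
    by have := s0 k x; rewrite -part_cderive.
  by have := s1 k x; rewrite -part_cderive.
move=> j k; exists (m j k + m' j k) => x.
apply: le_trans (ler_wpM2l _ (normc_part _)) _; first exact: exprn_ge0.
rewrite mulrDr lerD//.
  by have := b0 j k x; rewrite -part_cderive.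
by have := b1 j k x; rewrite -part_cderive.
Qed.

Definition cof r : R -> R[i] := fun x => real_complex R (r x).

Lemma part_cof b r : part b \o cof r = if b then fun=> 0 else r.
Proof. by case: b. Qed.

Lemma schwartz_cof r : rschwartz r -> schwartz (cof r).
Proof. by move=> rr; apply/schwartzP => b; rewrite part_cof; case: b => //; exact: rschwartz0. Qed.

Lemma iter_cderive_cof j r : iter j cderive (cof r) = cof (derive1n j r).
Proof.
apply/funext => x; apply: part_inj => b.
have := part_cderive b j (cof r); rewrite part_cof => /(congr1 (@^~ x)) /= ->.
by case: b => //; rewrite derive1n_cst0.
Qed.

Lemma schwartz_iter j phi : schwartz phi -> schwartz (iter j cderive phi).
Proof.
by move=> /schwartzP H; apply/schwartzP => b; rewrite part_cderive; exact: rschwartz_derive1n.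
Qed.

Lemma half_line_CP n f : half_line_C n f <-> forall b,
  (forall k t, (k < n)%N -> 0 <= t ->
     hder (iter k hderive (part b \o f)) t (iter k.+1 hderive (part b \o f) t)) /\
  (forall t, 0 <= t -> hcont (iter n hderive (part b \o f)) t).
Proof.
have E b k : part b \o iter k chderive f = iter k hderive (part b \o f).
  by apply/funext => t; exact: part_chderive.
split=> [[H [c0 c1]] b|H].
  split=> [k t kn t0|t t0].
    rewrite iterS -E; apply: hderivable_hder; have [A B] := H k t kn t0.
    by case: b.
  by rewrite -E; case: b; [apply/(hcontP _).1|apply/(hcontP _).1].
split=> [k t kn t0|].
  have [A _] := H false; have [B _] := H true.
  have [] := hder_hderivable t0 (A k t kn t0); rewrite -(E false) => ? _.
  by have [] := hder_hderivable t0 (B k t kn t0); rewrite -(E true) => ? _.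
have [_ A] := H false; have [_ B] := H true.
by split; apply/hcontP; [rewrite -(E false) in A|rewrite -(E true) in B].
Qed.

Lemma hder_chain n (g : nat -> R -> R) :
  (forall k t, (k < n)%N -> 0 <= t -> hder (g k) t (g k.+1 t)) ->
  forall k t, (k <= n)%N -> 0 <= t -> iter k hderive (g 0%N) t = g k t.
Proof.
move=> H; elim=> // k IH t kn t0.
have ext : hder (iter k hderive (g 0%N)) t (g k.+1 t).
  by apply: (hder_ext t0 _ (H k t kn t0)) => s s0; rewrite IH// ltnW.
by rewrite iterS; have [] := hder_hderivable t0 ext.
Qed.

Lemma hder_chain_iter n (g : nat -> R -> R) :
  (forall k t, (k < n)%N -> 0 <= t -> hder (g k) t (g k.+1 t)) ->
  (forall t, 0 <= t -> hcont (g n) t) ->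
  (forall k t, (k < n)%N -> 0 <= t ->
     hder (iter k hderive (g 0%N)) t (iter k.+1 hderive (g 0%N) t)) /\
  (forall t, 0 <= t -> hcont (iter n hderive (g 0%N)) t).
Proof.
move=> H Hn; have E := hder_chain H; split=> [k t kn t0|t t0].
  rewrite (E k.+1 t kn t0); apply: (hder_ext t0 _ (H k t kn t0)) => s s0.
  by rewrite E// ltnW.
move=> e /(Hn t t0)[d d0 dH]; exists d => // s s0 sd.
by rewrite !E//; exact: dH.
Qed.

Lemma iter_ddt k (p : R -> functional) t phi :
  iter k ddt p t phi = iter k chderive (fun s => p s phi) t.
Proof.
elim: k t => // k IH t; rewrite !iterS /ddt.
by congr (chderive _ t); apply/funext => s; exact: IH.
Qed.

Lemma tempered_real_linear (T : functional) b : tempered T -> rlin (fun r => part b (T (cof r))).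
Proof.
move=> [Tl _] a r s rr rs.
have -> : cof (fun x => a * r x + s x) = (fun x => real_complex R a * cof r x + cof s x).
  by apply/funext => x; rewrite /cof rmorphD rmorphM.
by rewrite Tl ?partD ?partZ//; exact: schwartz_cof.
Qed.

Lemma seminorm_bset m r j k : bset m r -> 0 <= schwartz_seminorm j k (cof r) <= m j k.
Proof.
move=> [rs rm].
have B x : `|x| ^+ j * Normc.normc (iter k cderive (cof r) x) <= m j k.
  rewrite iter_cderive_cof /cof /= expr0n/= addr0 sqrtr_sqr; exact: rm.
rewrite /schwartz_seminorm; apply/andP; split.
  apply: (@le_trans _ _ (`|0 : R| ^+ j * Normc.normc (iter k cderive (cof r) 0))).
    by rewrite mulr_ge0 ?exprn_ge0// (le_trans _ (part_normc false _)).
  by apply: ub_le_sup; [exists (m j k) => _ [x _ <-]; exact: B|exists 0].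
by apply: ge_sup; [by exists (`|0 : R| ^+ j * Normc.normc (iter k cderive (cof r) 0)), 0|
  move=> _ [x _ <-]; exact: B].
Qed.

(** Otherwise some r_n in the bounded set have |T(r_n)| > n + 1; then r_n / (n + 1) tends to 0 in
    all seminorms while its image stays above 1, against sequential continuity. *)
Lemma tempered_real_bounded (T : functional) b : tempered T -> rbounded (fun r => part b (T (cof r))).
Proof.
move=> Tt m; apply: contrapT => noM.
have Tl := tempered_real_linear b Tt; have [_ Tc] := Tt.
have H n : exists r : R -> R, bset m r /\ n.+1%:R < `|part b (T (cof r))|.
  apply: contrapT => nH; apply: noM; exists n.+1%:R => r rm.
  by rewrite leNgt; apply/negP => lt; apply: nH; exists r.
have [u uP] := choice H.
pose v n x := n.+1%:R^-1 * u n x.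
have vm n : bset (fun j k => n.+1%:R^-1 * m j k) (v n).
  have := bset_scale (n.+1%:R^-1) (uP n).1.
  by rewrite (ger0_norm (x := n.+1%:R^-1)) ?invr_ge0.
have vs n : rschwartz (v n) by eexists; exact: vm.
have /cvgrPdist_lt/(_ 1 ltr01) : Normc.normc (T (cof (v n))) @[n --> \oo] --> (0 : R).
  apply: (Tc (fun n => cof (v n))) => [n|j k]; first exact: schwartz_cof.
  apply: (@squeeze_cvgr _ _ _ _ (fun=> 0) (fun n => n.+1%:R^-1 * m j k)).
  - by near=> n; exact: (seminorm_bset j k (vm n)).
  - exact: cvg_cst.
  - rewrite -[X in _ --> X](mul0r (m j k)); apply: cvgM; last exact: cvg_cst.
    exact: cvg_harmonic.
case=> N _ /(_ N (leqnn N)) /=; rewrite sub0r normrN => lt1.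
have := part_normc b (T (cof (v N))).
rewrite (rlinZ _ Tl); last by eexists; exact: (uP N).1.
have [_ big] := uP N; rewrite normrM (ger0_norm (x := N.+1%:R^-1)) ?invr_ge0//.
have big' : 1 < N.+1%:R^-1 * `|part b (T (cof (u N)))|.
  by rewrite ltr_pdivlMl// mulr1.
move=> le; have := lt_le_trans big' le.
by have := le_lt_trans (ler_norm _) lt1; lra.
Unshelve. all: by end_near. Qed.

End ComplexParts.

(** * Coefficients and hyperbolicity of the fourth-order operator *)

Section Operator.
Context {R : realType}.
Variables c1 c2 l1 l2 : R.
Local Notation RC := (real_complex R).
Local Notation Q := (telegraph_sum_op c1 c2 l1 l2).

Let q30 := 4 * (l1 + l2).
Let q20 := 5 * (l1 + l2) ^+ 2 - (l1 - l2) ^+ 2.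
Let q22 := - (2 * (c1 ^+ 2 + c2 ^+ 2)).
Let q10 := 2 * (l1 + l2) * ((l1 + l2) ^+ 2 - (l1 - l2) ^+ 2).
Let q12 := - (4 * (l1 + l2) * (c1 ^+ 2 + c2 ^+ 2)).
Let q02 := 2 * (c1 ^+ 2 - c2 ^+ 2) * (l1 ^+ 2 - l2 ^+ 2) - 2 * (l1 + l2) ^+ 2 * (c1 ^+ 2 + c2 ^+ 2).
Let q04 := (c1 ^+ 2 - c2 ^+ 2) ^+ 2.

Let coefs : seq {poly R[i]} :=
  [:: Poly [:: RC 0; RC 0; RC q02; RC 0; RC q04]; Poly [:: RC q10; RC 0; RC q12];
      Poly [:: RC q20; RC 0; RC q22]; Poly [:: RC q30]; Poly [:: RC 1]].

(** Abstract rings and morphisms keep [ring] away from concrete polynomials; the right side is the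
    Horner form into which [cons_poly_def] unfolds [Poly]. *)
Let expansion (A B : comNzRingType) (mu : {rmorphism R -> B}) (iota : {rmorphism B -> A})
    (y : B) (x : A) :
  (x + iota (mu (l1 + l2))) ^+ 2 *
    (x ^+ 2 + iota (mu (2 * (l1 + l2))) * x - iota (mu (2 * (c1 ^+ 2 + c2 ^+ 2))) * iota y ^+ 2
      - iota (mu ((l1 - l2) ^+ 2))) +
  (iota (mu (c1 ^+ 2 - c2 ^+ 2)) * iota y ^+ 2 + iota (mu (l1 ^+ 2 - l2 ^+ 2))) ^+ 2 =
  ((((0 * x + iota (0 * y + mu 1)) * x + iota (0 * y + mu q30)) * x +
    iota (((0 * y + mu q22) * y + mu 0) * y + mu q20)) * x +
    iota (((0 * y + mu q12) * y + mu 0) * y + mu q10)) * x +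
    iota (((((0 * y + mu q04) * y + mu 0) * y + mu q02) * y + mu 0) * y + mu 0).
Proof. by rewrite /q30 /q20 /q22 /q10 /q12 /q02 /q04; ring. Qed.

Lemma telegraph_sum_opE : Q = Poly coefs.
Proof.
have := @expansion {poly {poly R[i]}} {poly R[i]} (polyC \o RC) polyC 'X 'X.
rewrite /coefs /= !cons_poly_def => <-.
by [].
Qed.

Lemma size_telegraph_sum_op : (size Q <= 5)%N.
Proof. by rewrite telegraph_sum_opE; apply: leq_trans (size_Poly _) _. Qed.

Lemma coef_telegraph_sum_op k : Q`_k = nth 0 coefs k.
Proof. by rewrite telegraph_sum_opE coef_Poly. Qed.

Lemma size_coef_telegraph_sum_op k : (k < 5)%N -> (size (Q`_k)%R <= 5 - k)%N.
Proof.
rewrite coef_telegraph_sum_op; case: k => [|[|[|[|[|]]]]] // _.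
- exact: (size_Poly [:: RC 0; RC 0; RC q02; RC 0; RC q04]).
- by apply: leq_trans (size_Poly [:: RC q10; RC 0; RC q12]) _.
- exact: (size_Poly [:: RC q20; RC 0; RC q22]).
- by apply: leq_trans (size_Poly [:: RC q30]) _.
- exact: (size_Poly [:: RC 1]).
Qed.

Let table : seq (seq R[i]) :=
  [:: [:: RC 0; RC 0; RC q02; RC 0; RC q04]; [:: RC q10; RC 0; RC q12];
      [:: RC q20; RC 0; RC q22]; [:: RC q30]; [:: RC 1]].

Let coef_table k j : (k < 5)%N -> (Q`_k)%R`_j = nth 0 (nth [::] table k) j.
Proof.
move=> k5; rewrite coef_telegraph_sum_op.
have -> : coefs = map (@Poly _) table by [].
by rewrite (nth_map [::])// coef_Poly.
Qed.

(** Sizes of the coefficients depend on the parameters, for instance when c1 = c2; padding with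
    zeros gives sums of fixed length. *)
Lemma sum_coef_widen (V : nmodType) (S : nzSemiRingType) (p : {poly S}) n (H : S -> nat -> V) :
  (forall k, H 0 k = 0) -> (size p <= n)%N ->
  \sum_(k < size p) H p`_k k = \sum_(k < n) H p`_k k.
Proof.
move=> H0 pn; rewrite (big_ord_widen n (fun k => H p`_k k) pn) big_mkcond /=.
by apply: eq_bigr => k _; case: ltnP => // kp; rewrite nth_default.
Qed.

Lemma sum_telegraph_sum_op (G : nat -> nat -> R[i]) b :
  part b (\sum_(k < size Q) \sum_(j < size (Q`_k)%R) (Q`_k)%R`_j * G k j) =
  telegraph_sum_form c1 c2 l1 l2 (fun k j => part b (G k j)).
Proof.
rewrite (@sum_coef_widen _ _ Q 5 (fun p k => \sum_(j < size p) p`_j * G k j)); last 2 first.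
- by move=> k; rewrite size_poly0 big_ord0.
- exact: size_telegraph_sum_op.
under eq_bigr => k _.
  rewrite (@sum_coef_widen _ _ (Q`_k)%R 5 (fun x j => x * G k j)); last 2 first.
  - by move=> j; rewrite mul0r.
  - by apply: leq_trans (size_coef_telegraph_sum_op (ltn_ord k)) _; exact: leq_subr.
  over.
rewrite !big_ord_recl !big_ord0 !coef_table//.
rewrite [table]lock /= -lock /= !(partD, partZ).
rewrite /telegraph_sum_form /q30 /q20 /q22 /q10 /q12 /q02 /q04.
rewrite /bump /= !part0; ring.
Qed.

(** The signs from integration by parts cancel in pairs, and the equation contains only even powers
    of d_x. *)
Lemma iter_ddx_even i (T : @functional R) phi : iter i.*2 ddx T phi = T (iter i.*2 cderive phi).
Proof.
elim: i phi => // i IH phi; rewrite doubleS.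
rewrite [LHS](_ : _ = - - iter i.*2 ddx T (cderive (cderive phi)))//.
by rewrite opprK IH -!iterSr.
Qed.

Lemma telegraph_sum_form_eq (X Y : nat -> nat -> R) :
  (forall k j, ~~ odd j -> X k j = Y k j) ->
  telegraph_sum_form c1 c2 l1 l2 X = telegraph_sum_form c1 c2 l1 l2 Y.
Proof. by move=> XY; rewrite /telegraph_sum_form !XY. Qed.

Lemma apply_op_part (p : R -> functional) t phi b :
  part b (apply_op Q p t phi) =
  telegraph_sum_form c1 c2 l1 l2
    (fun k j => iter k hderive (fun s => part b (p s (iter j cderive phi))) t).
Proof.
rewrite /apply_op.
rewrite (sum_telegraph_sum_op (fun k j => iter k ddt (fun s => iter j ddx (p s)) t phi)).
apply: telegraph_sum_form_eq => k j j2.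
rewrite iter_ddt part_chderive; congr (iter k hderive _ t).
by apply/funext => s /=; rewrite -(even_halfK j2) iter_ddx_even.
Qed.

Lemma op_order_telegraph_sum_op : op_order Q = 4%N.
Proof.
have c4 : (Q`_4)%R = Poly [:: RC 1] by rewrite coef_telegraph_sum_op.
have n4 : (Q`_4)%R != 0.
  by apply/eqP => /(congr1 (fun p : {poly R[i]} => p`_0)); rewrite c4 coef_Poly coef0 /= => /eqP; rewrite oner_eq0.
have s4 : (4 < size Q)%N.
  by rewrite ltnNge; apply: contra n4 => sQ; rewrite nth_default.
apply/eqP; rewrite eqn_leq; apply/andP; split.
  apply/bigmax_leqP => k _; have k5 := leq_trans (ltn_ord k) size_telegraph_sum_op.
  have := size_coef_telegraph_sum_op k5.
  by case: (k : nat) k5 => [|[|[|[|[|k']]]]] //= _; case: (size _) => [|[|[|[|[|[|]]]]]].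
by apply: leq_trans (@leq_bigmax_cond _ _ _ (Ordinal s4) n4) => /=; exact: leq_addr.
Qed.

(** A square root of a real number is real or purely imaginary. *)
Lemma Re_sqrt_bound (x : R) (l : R) (z : R[i]) : 0 <= l -> x <= l ^+ 2 ->
  z ^+ 2 = RC x -> `|complex.Re z| <= l.
Proof.
case: z => u v l0 xl; rewrite expr2 => -[E1 E2] /=.
have uv : u * v = 0 by lra.
have : u ^+ 2 <= l ^+ 2.
  move/eqP: uv; rewrite mulf_eq0 => /orP[]/eqP E.
    by rewrite E expr0n/= sqr_ge0.
  by rewrite E mulr0 subr0 -expr2 in E1; rewrite E1.
by rewrite -sqrnorm ler_sqr ?nnegrE.
Qed.

Lemma telegraph_sum_op_hyperbolic : 0 <= l1 -> 0 <= l2 -> hyperbolic Q.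
Proof.
move=> l10 l20; split.
  by rewrite op_order_telegraph_sum_op coef_telegraph_sum_op /= coef_cons /= oner_eq0.
exists (2 * (l1 + l2)) => xi tau.
(* An opaque name for i xi, so that [ring] treats it as an atom. *)
have [y yE] : exists y : R[i], y = Complex 0 xi by eexists.
rewrite -yE.
rewrite /telegraph_sum_op /op_const.
rewrite !(hornerD, hornerN, hornerM, horner_exp, hornerX, hornerC).
pose a1 := l1 ^+ 2 - c1 ^+ 2 * xi ^+ 2; pose a2 := l2 ^+ 2 - c2 ^+ 2 * xi ^+ 2.
pose z := tau + RC (l1 + l2).
have xi2 : RC (xi ^+ 2) = - y ^+ 2.
  by rewrite yE; apply/eqP; rewrite expr2 eq_complex /=; apply/andP; split; apply/eqP; ring.
have A1 : RC a1 = RC (l1 ^+ 2) + RC (c1 ^+ 2) * y ^+ 2.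
  rewrite (_ : RC a1 = RC (l1 ^+ 2) - RC (c1 ^+ 2) * RC (xi ^+ 2)); first by rewrite xi2; ring.
  by rewrite /a1; ring.
have A2 : RC a2 = RC (l2 ^+ 2) + RC (c2 ^+ 2) * y ^+ 2.
  rewrite (_ : RC a2 = RC (l2 ^+ 2) - RC (c2 ^+ 2) * RC (xi ^+ 2)); first by rewrite xi2; ring.
  by rewrite /a2; ring.
pose s1 := sqrtC (RC a1 : R[i]); pose s2 := sqrtC (RC a2 : R[i]).
have E1 : s1 ^+ 2 = RC a1 by rewrite sqrtCK.
have E2 : s2 ^+ 2 = RC a2 by rewrite sqrtCK.
move=> E.
have {}E : (z - s1 - s2) * (z - s1 + s2) * (z + s1 - s2) * (z + s1 + s2) = 0.
  have -> : (z - s1 - s2) * (z - s1 + s2) * (z + s1 - s2) * (z + s1 + s2) =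
    z ^+ 4 - 2 * (s1 ^+ 2 + s2 ^+ 2) * z ^+ 2 + (s1 ^+ 2 - s2 ^+ 2) ^+ 2 by ring.
  by rewrite E1 E2 A1 A2 /z -[RHS]E; ring.
have b1 : `|complex.Re s1| <= l1.
  by apply: (Re_sqrt_bound l10 _ E1); rewrite /a1 gerBl mulr_ge0 ?sqr_ge0.
have b2 : `|complex.Re s2| <= l2.
  by apply: (Re_sqrt_bound l20 _ E2); rewrite /a2 gerBl mulr_ge0 ?sqr_ge0.
have Rez : complex.Re tau = complex.Re z - (l1 + l2).
  have := partD false tau (RC (l1 + l2)); rewrite -/z /= => ->; ring.
have bz : `|complex.Re z| <= l1 + l2.
  have D w w' : complex.Re (w + w' : R[i]) = complex.Re w + complex.Re w' by case: w; case: w'.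
  have O w : complex.Re (- w : R[i]) = - complex.Re w by case: w.
  move: b1 b2; rewrite !ler_norml => /andP[? ?] /andP[? ?].
  move/eqP: E; rewrite !mulf_eq0 => /orP[/orP[/orP[]|]|] /eqP/(congr1 (@complex.Re R));
    rewrite !(D, O) /= => e; apply/andP; split; lra.
rewrite Rez; apply: le_trans (ler_normB _ _) _; rewrite (ger0_norm (x := l1 + l2)) ?addr_ge0//; lra.
Qed.

End Operator.

Lemma telegraph_sum_formB (R : realType) (c1 c2 l1 l2 : R) (A B : nat -> nat -> R) :
  telegraph_sum_form c1 c2 l1 l2 (fun k j => A k j - B k j) =
  telegraph_sum_form c1 c2 l1 l2 A - telegraph_sum_form c1 c2 l1 l2 B.
Proof. by rewrite /telegraph_sum_form; ring. Qed.

Section IvpRealParts.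
Context {R : realType}.
Variables (c1 c2 l1 l2 : R) (g : seq (@functional R)) (b : bool).
Hypothesis g4 : size g = 4%N.
Local Notation Q := (telegraph_sum_op c1 c2 l1 l2).
Local Notation u p k t r := (iter k hderive (fun s => part b (p s (cof r))) t).

Lemma ivp_real_part (p : R -> functional) : ivp_solution Q g p ->
  [/\ forall t, 0 <= t -> rlin (fun r => u p 0%N t r) /\ rbounded (fun r => u p 0%N t r),
   forall k r t, (k < 4)%N -> rschwartz r -> 0 <= t -> hder (fun s => u p k s r) t (u p k.+1 t r),
   forall r t, rschwartz r -> 0 <= t -> hcont (fun s => u p 4 s r) t,
   forall k r, (k < 4)%N -> rschwartz r -> u p k 0 r = part b (nth zerod g k (cof r)) &
   forall r t, rschwartz r -> 0 < t ->
     telegraph_sum_form c1 c2 l1 l2 (fun k j => u p k t (derive1n j r)) = 0].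
Proof.
move=> [pt pC pE pI]; rewrite g4 in pC pI.
have C r : rschwartz r -> half_line_C 4 (fun t => p t (cof r)).
  by move=> rr; apply: pC; exact: schwartz_cof.
split.
- move=> t t0; split; first exact: (tempered_real_linear b (pt t t0)).
  exact: (tempered_real_bounded b (pt t t0)).
- by move=> k r t k4 /C /half_line_CP/(_ b)[H _] t0; exact: H.
- by move=> r t /C /half_line_CP/(_ b)[_ H] t0; exact: H.
- move=> k r k4 rr; rewrite -(pI k k4 _ (schwartz_cof rr)) iter_ddt part_chderive//.
- move=> r t rr t0; have := pE t t0 _ (schwartz_cof rr).
  move=> /(congr1 (part b)); rewrite part0 apply_op_part => <-.
  by apply: telegraph_sum_form_eq => k j _; rewrite iter_cderive_cof.
Qed.

(** Equal data cancel, so each real component of the difference on real test functions falls under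
    the duality argument. *)
Lemma ivp_difference p q : ivp_solution Q g p -> ivp_solution Q g q ->
  null_solution c1 c2 l1 l2 (fun k t r => u q k t r - u p k t r).
Proof.
move=> /ivp_real_part[p0 pd pc pi pe] /ivp_real_part[q0 qd qc qi qe]; split.
- move=> t t0 a r s rr rs; have [pl _] := p0 t t0; have [ql _] := q0 t t0.
  by rewrite pl// ql//; ring.
- move=> t t0 m; have [_ /(_ m)[M pM]] := p0 t t0; have [_ /(_ m)[N qN]] := q0 t t0.
  exists (N + M) => r rm; apply: le_trans (ler_normB _ _) _.
  by rewrite lerD ?pM ?qN.
- by move=> k r t k4 rr t0; apply: hderB; [exact: qd|exact: pd].
- by move=> r t rr t0; apply: hcontB; [exact: qc|exact: pc].
- by move=> k r k4 rr; rewrite qi// pi// subrr.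
- move=> r t rr t0; rewrite telegraph_sum_formB.
  by rewrite (qe r t rr t0) (pe r t rr t0) subrr.
Qed.

End IvpRealParts.

(** * The law of the sum as the unique solution *)

Section SumDensity.
Context d (Omega : measurableType d) (R : realType) (P : probability Omega R).
Variables (c1 c2 l1 l2 x1 x2 : R) (D1 D2 : {RV P >-> R}) (N1 N2 : R -> {RV P >-> nat})
  (X1 X2 : R -> {RV P >-> R}).
Hypotheses (c10 : c1 != 0) (c20 : c2 != 0) (l10 : 0 <= l1) (l20 : 0 <= l2).
Hypotheses (H1 : telegraph_process c1 l1 x1 D1 N1 X1)
  (H2 : telegraph_process c2 l2 x2 D2 N2 X2).
Hypothesis HI : mutually_independent P (fun i : 'I_4 =>
    nth set0 [:: sigma_rv D1; sigma_process N1; sigma_rv D2; sigma_process N2] i).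
Local Notation Q := (telegraph_sum_op c1 c2 l1 l2).
Local Notation p := (fun t => density P ((X1 t : {mfun Omega >-> R}) + X2 t)).
Local Notation mean t := (moment D1 D2 N1 N2 X1 X2 false false false t).
Local Notation moment_dt := (moment_dt c1 c2 l1 l2 D1 D2 N1 N2 X1 X2).

Lemma measurable_rschwartz (r : R -> R) : rschwartz r -> measurable_fun setT r.
Proof. by move=> rr; have [K []] := rschwartz_test_bound 0 0 rr. Qed.

Lemma rschwartz_bounded_test M (r : R -> R) : rschwartz r -> bounded_test M r.
Proof.
by move=> rr; have [K [mr _ rK _ _]] := rschwartz_test_bound 0 M rr; split=> //; exists K.
Qed.

Lemma density_part b t phi : schwartz phi -> part b (p t phi) = mean t (part b \o phi).
Proof.
move=> /schwartzP/(_ b) rr; set r := part b \o phi in rr *.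
have mr := measurable_rschwartz rr.
have br : bmeas (fun w => r (X1 t w + X2 t w)).
  have [m [_ rm]] := rr; split; last by exists (m 0%N 0%N) => w; have := rm 0%N 0%N (X1 t w + X2 t w); rewrite expr0 mul1r.
  rewrite -[X in measurable_fun _ X]/(r \o (fun w => X1 t w + X2 t w)).
  by apply: measurableT_comp => //; exact: measurable_funD.
have -> : part b (p t phi) = \int[distribution P ((X1 t : {mfun Omega >-> R}) + X2 t)]_x r x by case: b @r rr mr br.
rewrite /Rintegral integral_distribution; last 2 first.
- exact/measurable_EFinP.
- exact: (bmeas_integrable P br).
rewrite /moment /Rintegral; congr fine; apply: eq_integral => w _ /=.
by rewrite /signs !expr0 !mul1r.
Qed.

Lemma mean_rlin t : 0 <= t -> rlin (fun r => mean t r).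
Proof.
move=> t0 a r s rr rs.
by apply: (moment_lin H1 H2 _ _ _ _ t0 (lexx _)); exact: rschwartz_bounded_test.
Qed.

Lemma schwartz_seminorm0 (phi : R -> R[i]) x : schwartz phi -> Normc.normc (phi x) <= schwartz_seminorm 0 0 phi.
Proof.
move=> [_ /(_ 0%N 0%N)[M HM]]; apply: ub_le_sup.
  by exists M => _ [y _ <-]; exact: HM.
by exists x => //=; rewrite expr0 mul1r.
Qed.

Lemma density_tempered t : 0 <= t -> tempered (p t).
Proof.
move=> t0; split.
  move=> a phi psi sphi spsi.
  have sR := (schwartzP phi).1 sphi; have sS := (schwartzP psi).1 spsi.
  (* A complex scalar mixes the two components, hence the term with [part (~~ b)]. *)
  have E b : part b \o (fun x => a * phi x + psi x) =
     (fun x => complex.Re a * (part b \o phi) x + ((if b then complex.Im a else - complex.Im a) * (part (~~ b) \o phi) x + (part b \o psi) x)).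
    apply/funext => x /=; case: a => a1 a2; case: b; case: (phi x) => f1 f2; case: (psi x) => g1 g2 /=; ring.
  have ss b : rschwartz (fun x => (if b then complex.Im a else - complex.Im a) * (part (~~ b) \o phi) x + (part b \o psi) x).
    exact: rschwartz_lin.
  have sl : schwartz (fun x => a * phi x + psi x).
    by apply/schwartzP => b; rewrite E; exact: rschwartz_lin.
  apply: part_inj => b; rewrite density_part// E mean_rlin// mean_rlin//.
  rewrite -!density_part//; set T := p t.
  by case: a {E ss sl} => a1 a2; case: b; case: (T phi) => f1 f2; case: (T psi) => g1 g2 /=; ring.
move=> phi_ sphi cv.
apply: (@squeeze_cvgr _ _ _ _ (fun=> 0) (fun n => schwartz_seminorm 0 0 (phi_ n) + schwartz_seminorm 0 0 (phi_ n))).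
- near=> n; apply/andP; split; first exact: le_trans (normr_ge0 _) (part_normc false _).
  have B b : `|part b (p t (phi_ n))| <= schwartz_seminorm 0 0 (phi_ n).
    rewrite density_part//; apply: (moment_bound H1 H2 _ _ _ t0 (lexx _)).
      by apply: measurable_rschwartz; exact: (schwartzP _).1.
    move=> x _; apply: le_trans (part_normc _ _) _; exact: schwartz_seminorm0.
  by apply: le_trans (normc_part _) _; rewrite lerD.
- exact: cvg_cst.
- by rewrite -[X in _ --> X](addr0 0); apply: cvgD; exact: cv.
Unshelve. all: by end_near. Qed.

Lemma density_real b phi : schwartz phi -> part b \o (fun t => p t phi) = moment_dt (part b \o phi) 0.
Proof. by move=> sphi; apply/funext => t /=; rewrite density_part. Qed.

Lemma density_derivatives b phi k t : schwartz phi -> 0 <= t ->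
  iter k hderive (fun s => part b (p s phi)) t = moment_dt (part b \o phi) k t.
Proof.
move=> sphi t0; have -> : (fun s => part b (p s phi)) = moment_dt (part b \o phi) 0.
  exact: density_real.
apply: (hder_chain (n := k)) => // j s _ s0.
by apply: (moment_dt_hder l10 l20 H1 H2 HI) => //; exact: (schwartzP _).1.
Qed.

Lemma density_ivp : ivp_solution Q (telegraph_sum_data c1 c2 l1 l2 (x1 + x2)) p.
Proof.
have H phi b k t : schwartz phi -> 0 <= t ->
    hder (moment_dt (part b \o phi) k) t (moment_dt (part b \o phi) k.+1 t).
  move=> sphi t0; apply: (moment_dt_hder l10 l20 H1 H2 HI) => //; exact: (schwartzP _).1.
split.
- exact: density_tempered.
- move=> phi sphi; apply/half_line_CP => b; rewrite density_real//.
  apply: hder_chain_iter => [k t _ t0|t t0]; first exact: H.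
  exact: hder_hcont (H phi b 4%N t sphi t0).
- move=> t t0 phi sphi; apply: part_inj => b; rewrite apply_op_part part0.
  rewrite -[RHS](moment_dt_equation c1 c2 l1 l2 D1 D2 N1 N2 X1 X2 (part b \o phi) t).
  apply: telegraph_sum_form_eq => k j _.
  by rewrite density_derivatives ?part_cderive//; [exact: schwartz_iter|exact: ltW].
- move=> k k4 phi sphi; apply: part_inj => b.
  rewrite iter_ddt part_chderive density_derivatives//.
  have [i0 i1 i2 i3] := moment_dt_initial H1 H2 HI (part b \o phi).
  have E : part b (iter 2 ddx (delta (x1 + x2)) phi) = derive1n 2 (part b \o phi) (x1 + x2).
    by rewrite (iter_ddx_even 1) -part_cderive.
  case: k k4 => [|[|[|[|]]]] // _.
  + by rewrite [LHS]i1 part0.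
  + by rewrite [LHS]i2 [RHS]partZ E.
  + by rewrite [LHS]i3 [RHS]partZ E.
Qed.

Theorem density_unique_ivp :
  unique_ivp_solution Q (telegraph_sum_data c1 c2 l1 l2 (x1 + x2)) p.
Proof.
have pI := density_ivp; split=> // q qI t t0 phi sphi.
have eq r : rschwartz r -> q t (cof r) = p t (cof r).
  move=> rr; apply: part_inj => b.
  have N := ivp_difference b (erefl : size (telegraph_sum_data c1 c2 l1 l2 (x1 + x2)) = 4%N) pI qI.
  by have /eqP := null_solution_eq0 c10 c20 l10 l20 H1 H2 HI N rr t0; rewrite subr_eq0 => /eqP.
have sR := (schwartzP phi).1 sphi.
(* Agreement on real test functions extends to complex ones by complex linearity of both
   distributions. *)
have -> : phi = (fun x => Complex 0 1 * cof (part true \o phi) x + cof (part false \o phi) x).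
  apply/funext => x; rewrite /cof /=; case: (phi x) => a b.
  by apply/eqP; rewrite eq_complex /=; apply/andP; split; apply/eqP; ring.
have [qt _ _ _] := qI; have [ql _] := qt t t0; have [pl _] := density_tempered t0.
by rewrite ql ?pl ?eq//; exact: schwartz_cof.
Qed.

End SumDensity.

(** The sign is put into the speed while D and N are kept, so the independence hypothesis carries
    over verbatim. *)
Lemma telegraph_process_opp d (Omega : measurableType d) (R : realType) (P : probability Omega R)
    (c l x0 : R) (D : {RV P >-> R}) (N : R -> {RV P >-> nat}) (X : R -> {RV P >-> R}) :
  telegraph_process c l x0 D N X ->
  telegraph_process (- c) l (- x0) D N (fun t => (- (X t : {mfun Omega >-> R}) : {mfun Omega >-> R})).
Proof.
move=> [Dd Dr Dl HN HI HX]; split=> // t w t0.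
by rewrite -[LHS]/(- X t w) HX// opprD mulNr.
Qed.

Theorem theorem4 (d : measure_display) (Omega : measurableType d)
    (R : realType) (P : probability Omega R)
    (c1 c2 l1 l2 x1 x2 : R)
    (D1 D2 : {RV P >-> R}) (N1 N2 : R -> {RV P >-> nat})
    (X1 X2 : R -> {RV P >-> R}) :
  0 < c1 -> 0 < c2 -> 0 < l1 -> 0 < l2 ->
  telegraph_process c1 l1 x1 D1 N1 X1 ->
  telegraph_process c2 l2 x2 D2 N2 X2 ->
  mutually_independent P (fun i : 'I_4 =>
    nth set0 [:: sigma_rv D1; sigma_process N1;
                 sigma_rv D2; sigma_process N2] i) ->
  let Q := telegraph_sum_op c1 c2 l1 l2 in
  [/\ unique_ivp_solution Q (telegraph_sum_data c1 c2 l1 l2 (x1 + x2))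
        (fun t => density P ((X1 t : {mfun Omega >-> R}) + X2 t)),
      unique_ivp_solution Q (telegraph_sum_data c1 c2 l1 l2 (x1 - x2))
        (fun t => density P ((X1 t : {mfun Omega >-> R}) - X2 t))
    & hyperbolic Q].
Proof.
move=> /lt0r_neq0 c10 /lt0r_neq0 c20 /ltW l10 /ltW l20 H1 H2 HI Q.
split; last exact: telegraph_sum_op_hyperbolic.
  exact: (density_unique_ivp c10 c20 l10 l20 H1 H2 HI).
have c20' : - c2 != 0 by rewrite oppr_eq0.
have := density_unique_ivp c10 c20' l10 l20 H1 (telegraph_process_opp H2) HI.
(* The speeds enter the operator and the data only through their squares. *)
by rewrite /Q /telegraph_sum_op /telegraph_sum_data sqrrN.
Qed.
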